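(* Let $m,n\ge 1$, let $q_1,\dots,q_n$ be monomials in $\mathbb{C}\langle X_1,\dots,X_m\rangle$ and, for $t=(t_1,\dots,t_n)\in\mathbb{R}^n$, let $V_t=\sum_{i=1}^n t_i(q_i+q_i^* )$. Let $R>2$. Then there exists an open neighborhood $U\subset\mathbb{R}^n$ of the origin (a ball of positive radius) such that: (1) For every $t\in U$ there exists a unique $\tau_t\in\mathbb{C}\langle X_1,\dots,X_m\rangle^*$ which is a solution to $\mathbf{SD}[V_t]$ and such that for all $p\in\mathbb{N}$ and all $i_1,\dots,i_p\in\{1,\dots,m\}$, $|\tau_t(X_{i_1}\cdots X_{i_p})|\le R^p$. (2) For every monomial $P\in\mathbb{C}\langle X_1,\dots,X_m\rangle$, the map $t\mapsto\tau_t(P)$ is analytic on $U$, and for all integers $k_1,\dots,k_n\ge 0$, $$(-1)^{\sum_i k_i}\,\partial_{t_1}^{k_1}\cdots\partial_{t_n}^{k_n}\tau_t(P)\big|_{t=0}$$ is the number $\mathcal{M}(P,(q_1,k_1),\dots,(q_n,k_n))$ of planar maps with $k_i$ stars of type $q_i$ or $q_i^*$ ($1\le i\le n$) and one star of type $P$.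
   Context: **Non-commutative polynomials.** $\mathbb{C}\langle X_1,\dots,X_m\rangle$ is the algebra of polynomials in $m$ self-adjoint non-commutative variables, with involution $(zX_{i_1}\cdots X_{i_p})^*=\bar z X_{i_p}\cdots X_{i_1}$. A monomial is a word $X_{i_1}\cdots X_{i_p}$. $\mathbb{C}\langle X_1,\dots,X_m\rangle^*$ denotes the set of linear forms $\tau$ with $\tau(a^* )=\overline{\tau(a)}$. The non-commutative derivative $D_i$ is the linear map into $\mathbb{C}\langle X\rangle\otimes\mathbb{C}\langle X\rangle$ given on monomials by $D_iP=\sum_{P=P_1X_iP_2}P_1\otimes P_2$, and the cyclic derivative $\mathcal{D}_i$ is given on monomials by $\mathcal{D}_iP=\sum_{P=P_1X_iP_2}P_2P_1$ (sums over all decompositions of $P$ as $P_1X_iP_2$). **Schwinger–Dyson equation.** $\tau$ satisfies $\mathbf{SD}[V]$ if $\tau(1)=1$ and $\tau\otimes\tau(D_iP)=\tau((\mathcal{D}_iV+X_i)P)$ for all $i\in\{1,\dots,m\}$ and $P\in\mathbb{C}\langle X_1,\dots,X_m\rangle$. **Maps.** A star of type $q=X_{i_1}\cdots X_{i_l}$ is a vertex with $l$ branches (half-edges), listed clockwise, the $k$-th branch having color $i_k$, the first branch being marked; the star of type $1$ is a point. A planar map built on a finite collection of labeled stars is a connected graph embedded in the sphere obtained by gluing each branch to exactly one other branch of the same color so that the edges do not cross; maps are considered up to orientation-preserving homeomorphisms of the sphere respecting labels, colors and marked branches (equivalently, one counts color-preserving perfect matchings of the branches whose associated ribbon graph is connected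 of genus $0$; a single point counts as one map). $\mathcal{M}_0((q_1,k_1),\dots,(q_n,k_n))$ is the number of planar maps built with $k_i$ stars of type $q_i$ (all stars labeled; the $q_i$ not necessarily distinct); e.g. $\mathcal{M}_0((X^4,2))=36$. $\mathcal{M}_0(P,\dots)$ means there is in addition one star of type $P$. The number of planar maps with $k_i$ stars of type $q_i$ or $q_i^*$ and one star of type $P$ is $$\mathcal{M}(P,(q_1,k_1),\dots,(q_n,k_n))=\sum_{0\le p_i\le k_i,\,1\le i\le n}\ \prod_{i=1}^n\binom{k_i}{p_i}\ \mathcal{M}_0(P,(q_1,p_1),(q_1^*,k_1-p_1),\dots,(q_n,p_n),(q_n^*,k_n-p_n)).$$ *)

(* Defs.v *)
From HB Require Import structures.
From mathcomp Require Import all_boot all_order all_algebra.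
From mathcomp Require Import finmap complex.
From mathcomp Require Import all_classical all_reals all_analysis.
From mathcomp.analysis Require summability.
(* The notations of monalg clash with those of MathComp-Analysis. *)
From mathcomp Require monalg.
Export -(notations) monalg.

Set Implicit Arguments.
Unset Strict Implicit.
Unset Printing Implicit Defensive.

Import Order.TTheory GRing.Theory Num.Theory numFieldNormedType.Exports.
Local Open Scope classical_set_scope.
Local Open Scope ring_scope.

(* The complex numbers as a normed space over the reals: real-closed gives
   [Rcomplex R] (convertible to [R[i]]) its R-linear structure and its
   modulus, to which the following instances attach the metric topology. *)
Section RcomplexNormed.
Variable R : realType.

Lemma Rcomplex_normZ (l : R) (x : Rcomplex R) : `|l *: x| = `|l| * `|x|.
Proof.
case: x => a b.
change (Num.sqrt ((l * a) ^+ 2 + (l * b) ^+ 2) =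
        `|l| * Num.sqrt (a ^+ 2 + b ^+ 2)).
by rewrite -sqrtr_sqr -sqrtrM ?sqr_ge0 // !exprMn mulrDr.
Qed.

HB.instance Definition _ := PseudoMetric.copy (Rcomplex R)
  (pseudoMetric_normed (Rcomplex R)).
HB.instance Definition _ := isPointed.Build (Rcomplex R) 0.
HB.instance Definition _ :=
  NormedZmod_PseudoMetric_eq.Build R (Rcomplex R) erefl.
HB.instance Definition _ :=
  PseudoMetricNormedZmod_Lmodule_isNormedModule.Build R (Rcomplex R)
    Rcomplex_normZ.

End RcomplexNormed.

Section NCPolynomials.
Variables (R : realType) (m : nat).

Definition word := fmonom 'I_m.
Definition wrev (w : word) : word := FMonom (rev w).

(* The monoid algebra of the free monoid on the m letters. *)
Definition ncpoly := malg word R[i].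
Definition ncmon (w : word) : ncpoly := mkmalgU w 1.
Definition ncX (i : 'I_m) : ncpoly := ncmon (fmu i).

Definition ncstar (P : ncpoly) : ncpoly :=
  \sum_(w <- msupp P) mkmalgU (wrev w) (mcoeff w P)^*.

(* The tensor square of [ncpoly]: the free vector space on pairs of words,
   the pair (u, v) standing for the elementary tensor of u and v. *)
Definition nctensor := malg (word * word)%type R[i].

(* In both derivatives, the decompositions w = P1 X_i P2 are indexed by the
   positions k of the letter i in w. *)
Definition ncder (i : 'I_m) (P : ncpoly) : nctensor :=
  \sum_(w <- msupp P) mcoeff w P *:
    \sum_(k < size w | tnth (in_tuple w) k == i)
      mkmalgU (FMonom (take k w), FMonom (drop k.+1 w)) 1.

Definition cycder (i : 'I_m) (P : ncpoly) : ncpoly :=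
  \sum_(w <- msupp P) mcoeff w P *:
    \sum_(k < size w | tnth (in_tuple w) k == i)
      ncmon (FMonom (drop k.+1 w ++ take k w)).

(* [tau] tensor [tau], as a linear form on the tensor square *)
Definition tensor_form (tau : ncpoly -> R[i]) (T : nctensor) : R[i] :=
  \sum_(uv <- msupp T) mcoeff uv T * (tau (ncmon uv.1) * tau (ncmon uv.2)).

Definition hermitian_form (tau : ncpoly -> R[i]) : Prop :=
  forall a, tau (ncstar a) = (tau a)^*.

Definition schwinger_dyson (V : ncpoly) (tau : ncpoly -> R[i]) : Prop :=
  tau 1 = 1 /\
  forall (i : 'I_m) (P : ncpoly),
    tensor_form tau (ncder i P) = tau ((cycder i V + ncX i) * P).

Definition potential (n : nat) (q : 'I_n -> word) (t : 'rV[R]_n) : ncpoly :=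
  \sum_(i < n) ((t 0 i)%:C)%C *: (ncmon (q i) + ncstar (ncmon (q i))).

Definition bounded_SD_solution (V : ncpoly) (rho : R) (tau : ncpoly -> R[i]) :
    Prop :=
  [/\ hermitian_form tau, schwinger_dyson V tau &
      forall w : word, `|tau (ncmon w)| <= ((rho ^+ size w)%:C)%C].

End NCPolynomials.

Section PlanarMaps.
Variable m : nat.

(* A collection of labelled stars is a sequence of words; a branch is a pair
   (label of the star, position in its word). *)
Definition branch (s : seq (word m)) : finType :=
  {v : 'I_(size s) & 'I_(size (tnth (in_tuple s) v))}.

Definition branch_color (s : seq (word m)) (b : branch s) : 'I_m :=
  tnth (in_tuple (tnth (in_tuple s) (tag b))) (tagged b).

(* the next branch, clockwise, around the same star *)
Definition branch_next (s : seq (word m)) (b : branch s) : branch s :=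
  Tagged (fun v : 'I_(size s) => 'I_(size (tnth (in_tuple s) v)))
    (ordS (tagged b)).

Definition is_gluing (s : seq (word m)) (g : {ffun branch s -> branch s}) :
    bool :=
  [forall b, [&& g b != b, g (g b) == b &
                 branch_color (g b) == branch_color b]].

Definition star_adj (s : seq (word m)) (g : {ffun branch s -> branch s}) :
    rel 'I_(size s) :=
  fun v v' => [exists b, (tag b == v) && (tag (g b) == v')].

Definition gluing_connected (s : seq (word m))
    (g : {ffun branch s -> branch s}) : bool :=
  [forall v, forall v', connect (star_adj g) v v'].

(* The faces are the cycles of [branch_next \o g], except that a star without
   branches, being a sphere with a single marked point, bounds one face which
   no branch sees. *)
Definition nb_faces (s : seq (word m)) (g : {ffun branch s -> branch s}) : nat :=
  (fcard (@branch_next s \o g) (branch s) + count (fun w : word m => nilp w) s)%N.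

(* For connected gluings, this is genus 0: V - E + F = 2. *)
Definition euler_planar (s : seq (word m)) (g : {ffun branch s -> branch s}) :
    bool :=
  (size s + nb_faces g == #|branch s|./2 + 2)%N.

Definition nb_planar_maps (s : seq (word m)) : nat :=
  #|[set g : {ffun branch s -> branch s} |
      [&& is_gluing g, gluing_connected g & euler_planar g]]|.

Definition M0 (qk : seq (word m * nat)) : nat :=
  nb_planar_maps (flatten [seq nseq x.2 x.1 | x <- qk]).

Definition Mstar (n : nat) (P : word m) (q : 'I_n -> word m) (k : 'I_n -> nat) :
    nat :=
  (\sum_(p : {dffun forall i : 'I_n, 'I_(k i).+1})
     (\prod_(i < n) 'C(k i, p i)) *
     M0 ((P, 1%N) ::
         flatten [seq [:: (q i, p i : nat); (wrev (q i), (k i - p i)%N)]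
                 | i <- enum 'I_n]))%N.

End PlanarMaps.

Section SeveralRealVariables.
Variables (R : realType) (n : nat) (W : normedModType R).
Implicit Types (f : 'rV[R]_n -> W).

(* Near each point of U, f is the sum of a convergent power series in n
   variables; the sum over multi-indices is unordered (limit along the finite
   sets of multi-indices), hence absolutely convergent when dim W is finite. *)
Definition analytic_on (U : set 'rV[R]_n) f : Prop :=
  forall a, U a -> exists c : {ffun 'I_n -> nat} -> W,
    exists2 r : R, 0 < r & forall t : 'rV[R]_n, ball a r t ->
      summability.partial_sum
        (fun al : {ffun 'I_n -> nat} =>
           (\prod_(i < n) (t 0 i - a 0 i) ^+ al i) *: c al)
      @ summability.totally --> f t.

Definition pderiv (i : 'I_n) f : 'rV[R]_n -> W :=
  fun t => 'D_(delta_mx 0 i) f t.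

Definition mixed_pderiv (k : 'I_n -> nat) f : 'rV[R]_n -> W :=
  foldr (fun i g => iter (k i) (pderiv i) g) f (enum 'I_n).

End SeveralRealVariables.

(* Main.v *)
(** At the level of words, SD[V_t] reads: tau(1) = 1 and
    tau(X_i w) = sum_(w = u X_i v) tau(v) tau(u)
                 - sum_j t_j sum_(q = u X_i v, q in {q_j, rev q_j}) tau(v u w).
    Erasing the edge that carries the first branch of the root star shows that
    the numbers of planar maps obey the same recursion: either the edge is a
    loop and splits the map in two, or it merges the root with another star.
    Hence the generating series of planar maps is a formal solution. Gluings are
    handled as permutations, planarity being the equality case of the genus
    inequality, which makes both surgeries computations with transpositions.

    For 0 < e <= 1 and small t, induction along the recursion bounds the series
    on words of length l by b_l, where b_(l+1) = e b_l + sum_k b_k b_(l-1-k)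
    (weighted Motzkin numbers), and b_l <= (2 + e)^l; with 2 + e <= rho this
    gives existence and analyticity, and the derivatives at 0 are the
    coefficients. For uniqueness, the difference of two solutions contracts in
    the norm that weighs a word of length l by (2 rho)^(-l), for small t. *)

Require Import Defs.
From HB Require Import structures.
From mathcomp Require Import all_boot all_order all_fingroup.
From mathcomp Require Import zify.

Set Implicit Arguments.
Unset Strict Implicit.
Unset Printing Implicit Defensive.

(** * Permutations and the genus inequality *)

(** All permutations live on one fixed finite type [T] of darts. Removing an edge or a dart leaves
    fixed points behind, which is harmless: a dart isolated for the stars and for the gluing adds 3
    to the left side of [planar] and 1 + 2 to the right side. So the surgeries are mere products
    with transpositions.

    The stars are labelled, hence a split distributes labels and produces binomial coefficients;
    dividing by factorials turns the recursion into a Cauchy product, which is why derivatives at 0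
    rather than Taylor coefficients count maps.

    The obstacle to convergence is that absorbing a star lengthens the word: a bound [b] on words of
    length [l] must satisfy [b (l + j) <= K ^ j * b l]. The moments of the case t = 0 (in one
    letter, Catalan numbers at even lengths) vanish at odd lengths and have no such ratio. The added
    term e b_l repairs this, with K = 2 e + 4 / e, and is also the room into which the potential
    term, small with t, is absorbed. The price is the growth rate 2 + e instead of 2, whence the
    assumption R > 2. *)

Section Classes.
Variable T : finType.
Implicit Types (r : rel T) (x y z : T).

Definition nclass r := #|[set [set y | r x y] | x : T]|.

Lemma eq_nclass r1 r2 : r1 =2 r2 -> nclass r1 = nclass r2.
Proof.
move=> e; rewrite /nclass; congr #|pred_of_set _|; apply: eq_imset => x.
by apply/setP => y; rewrite !inE e.
Qed.

Lemma class_eq r x y : equivalence_rel r ->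
  ([set z | r x z] == [set z | r y z]) = r x y.
Proof.
move=> er; apply/eqP/idP => [/setP/(_ y)|rxy].
  by rewrite !inE => ->; have [] := er y y y.
by apply/setP => z; rewrite !inE; have [_ ->] := er x y z.
Qed.

Lemma eqvP r : equivalence_rel r ->
  [/\ reflexive r, symmetric r & transitive r].
Proof.
move=> er; split=> [x|x y|y x z].
- by have [] := er x x x.
- have s u v : r u v -> r v u.
    by move=> ruv; have [] := er u v u => + /(_ ruv) => ->.
  by apply/idP/idP; apply: s.
- by move=> rxy; have [_ ->] := er x y z.
Qed.

(** If [x] and [y] are not yet related, the classes of [r'] are their common class together with the
    classes of [r] that contain neither; the boolean records whether a merge really takes place. *)
Lemma nclass_link r r' x y : equivalence_rel r -> equivalence_rel r' ->
  subrel r r' -> r' x y ->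
  (forall u v, r' u v -> [|| r u v, r u x && r y v | r u y && r x v]) ->
  nclass r = nclass r' + ~~ r x y.
Proof.
move=> er er' sub r'xy min.
have [rr rs rt] := eqvP er; have [rr' rs' rt'] := eqvP er'.
have [rxy|nrxy] := boolP (r x y).
  rewrite addn0; apply: eq_nclass => u v; apply/idP/idP => [/sub //|].
  case/min/or3P => // /andP[a b]; first exact: rt (rt _ _ _ a rxy) b.
  by rewrite rs in rxy; apply: rt (rt _ _ _ a rxy) b.
pose cl z := [set u | r z u]; pose cl' z := [set u | r' z u].
have clE z w : (cl z == cl w) = r z w by exact: class_eq.
have clE' z w : (cl' z == cl' w) = r' z w by exact: class_eq.
have -> : nclass r' = #|cl' x |: ([set cl z | z : T] :\ cl x :\ cl y)|.
  rewrite /nclass; congr #|pred_of_set _|.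
  have far z : ~~ r z x -> ~~ r z y -> cl' z = cl z.
    move=> nx ny; apply/setP => u; rewrite !inE; apply/idP/idP => [|/sub //].
    by case/min/or3P => // /andP[]; rewrite (negPf nx, negPf ny).
  apply/setP => C; apply/imsetP/setU1P.
    case=> z _ ->; have [rzx|nzx] := boolP (r z x).
      by left; apply/eqP; rewrite -/(cl' z) clE' sub.
    have [rzy|nzy] := boolP (r z y).
      left; apply/eqP; rewrite -/(cl' z) clE'; apply: rt' (sub _ _ rzy) _.
      by rewrite rs'.
    right; rewrite -/(cl' z) (far z) // !inE !clE nzx nzy /=.
    by apply/imsetP; exists z.
  case=> [->|]; first by exists x.
  rewrite !inE => /and3P[+ + /imsetP[z _ Cz]]; rewrite {}Cz -/(cl z) !clE.
  by move=> ny nx; exists z => //; rewrite -/(cl' z) far.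
rewrite cardsU1 {1}/nclass (cardsD1 (cl x)) (cardsD1 (cl y) (_ :\ _)).
rewrite !inE !clE (rs y x) nrxy !imset_f //=.
suff H : cl' x \notin [set cl z | z : T] by rewrite (negPf H) !andbF /= add1n add1n addn1.
apply/negP => /imsetP[z _ /setP e].
have := e x; have := e y; rewrite !inE rr' r'xy => /esym rzy /esym rzx.
by case/negP: nrxy; apply: rt rzy; rewrite rs.
Qed.

Lemma nclass_transversal r (A : {set T}) : equivalence_rel r ->
  (forall x, exists2 y, y \in A & r x y) ->
  {in A &, forall x y, r x y -> x = y} -> nclass r = #|A|.
Proof.
move=> er cov un; rewrite /nclass -(@card_in_imset _ _ (fun x => [set y | r x y]) A).
  congr #|pred_of_set _|; apply/setP => X; apply/imsetP/imsetP => -[x _ ->].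
    by have [y yA rxy] := cov x; exists y => //; apply/eqP; rewrite class_eq.
  by exists x.
by move=> x y xA yA /eqP; rewrite class_eq // => /un; apply.
Qed.

(** The choice made by [pick] depends on the class only. It turns the number of classes into a sum
    over points, which [nclass_disjoint] compares term by term. *)
Lemma nclass_roots r : equivalence_rel r ->
  nclass r = #|[set x | [pick y | r x y] == Some x]|.
Proof.
move=> er; have pke x y : r x y -> [pick z | r x z] = [pick z | r y z].
  by move=> rxy; apply: eq_pick => z; have [_ ->] := er x y z.
apply: nclass_transversal => // [x|x y].
  have [y ey rxy] : exists2 y, [pick y | r x y] = Some y & r x y.
    by case: pickP => [y rxy|/(_ x)]; [exists y | have [-> _] := er x x x].
  by exists y; rewrite // inE -(pke _ _ rxy) ey.
by rewrite !inE => /eqP ex /eqP ey /pke; rewrite ex ey => -[].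
Qed.

(** Every point of [T] is a singleton class of at least one of [r1] and [r2]; this surplus of one
    per point accounts for the term [#|T|]. *)
Lemma nclass_disjoint r r1 r2 (D1 D2 : {set T}) : [disjoint D1 & D2] ->
  equivalence_rel r -> equivalence_rel r1 -> equivalence_rel r2 ->
  (forall x, x \in D1 -> r x =1 r1 x) ->
  (forall x, x \in D2 -> r x =1 r2 x) ->
  (forall x, x \notin D1 -> r1 x =1 pred1 x) ->
  (forall x, x \notin D2 -> r2 x =1 pred1 x) ->
  (forall x, x \notin D1 -> x \notin D2 -> r x =1 pred1 x) ->
  nclass r + #|T| = nclass r1 + nclass r2.
Proof.
move=> dis er er1 er2 e1 e2 n1 n2 n3; rewrite !nclass_roots // -cardsT -!sum1_card.
rewrite big_mkcond [X in _ + X]big_mkcond [X in _ = X + _]big_mkcond.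
rewrite [X in _ = _ + X]big_mkcond.
rewrite -!big_split /=; apply: eq_bigr => x _; rewrite !inE.
have triv r' : r' x =1 pred1 x -> [pick y | r' x y] == Some x.
  by move=> e; rewrite (eq_pick e); case: pickP => [y /eqP ->|/(_ x)] //=; rewrite eqxx.
have [x1|x1] := boolP (x \in D1).
  have x2 : x \notin D2 by rewrite (disjointFr dis x1).
  by rewrite (eq_pick (e1 _ x1)) (triv r2 (n2 _ x2)).
have [x2|x2] := boolP (x \in D2).
  by rewrite (eq_pick (e2 _ x2)) (triv r1 (n1 _ x1)) addnC.
by rewrite (triv r (n3 _ x1 x2)) (triv r1 (n1 _ x1)) (triv r2 (n2 _ x2)).
Qed.

End Classes.

(** * Connectivity, faces and genus of a pair of permutations *)

Section Genus.
Local Open Scope group_scope.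
Variable T : finType.
Implicit Types (s a : {perm T}) (x y z : T).

Definition conn s a : rel T := connect [rel x y | (y == s x) || (y == a x)].

Lemma conn1 s a x : conn s a x (s x).
Proof. by apply: connect1; rewrite /= eqxx. Qed.

Lemma conn2 s a x : conn s a x (a x).
Proof. by apply: connect1; rewrite /= eqxx orbT. Qed.

(** The induction principle for connectivity, used below in place of inductions on paths. *)
Lemma conn_min (r : rel T) s a : reflexive r -> transitive r ->
  (forall x, r x (s x)) -> (forall x, r x (a x)) -> subrel (conn s a) r.
Proof.
move=> rr rt rs ra x y /connectP[p + ->]; elim: p x => //= z p IH x.
by case/andP=> /orP[] /eqP -> /IH; apply: rt.
Qed.

Lemma fconnect_conn s a (b : {perm T}) :
  (forall x, conn s a x (b x)) -> subrel (fconnect b) (conn s a).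
Proof.
move=> h x y; apply: connect_sub => u v /eqP <-; exact: h.
Qed.

(** [connect] is directed, but the inverse of a permutation of a finite type is one of its powers,
    so every step can be undone by forward steps. *)
Lemma conn_eqv s a : equivalence_rel (conn s a).
Proof.
have cs : symmetric (conn s a).
  suff H u v : conn s a u v -> conn s a v u by move=> u v; apply/idP/idP; apply: H.
  pose r : rel T := fun u v => conn s a v u.
  move: u v; apply: (@conn_min r).
  - by move=> u; apply: connect0.
  - by move=> u v w uv vw; apply: connect_trans vw uv.
  - move=> u; apply: (fconnect_conn (@conn1 s a)).
    by rewrite fconnect_sym ?fconnect1 //; apply: perm_inj.
  - move=> u; apply: (fconnect_conn (@conn2 s a)).
    by rewrite fconnect_sym ?fconnect1 //; apply: perm_inj.
move=> x y z; split; first exact: connect0.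
move=> xy; apply/idP/idP; apply: connect_trans => //.
by rewrite -[connect _ _ _]/(conn s a y x) cs.
Qed.

Lemma conn0 s a x : conn s a x x. Proof. exact: connect0. Qed.
Lemma conn_sym s a : symmetric (conn s a).
Proof. by have [] := eqvP (conn_eqv s a). Qed.
Lemma conn_trans s a : transitive (conn s a).
Proof. by have [] := eqvP (conn_eqv s a). Qed.
Hint Resolve conn0 conn1 conn2 : core.

Lemma conn_sub s a s' a' : (forall x, conn s' a' x (s x)) ->
  (forall x, conn s' a' x (a x)) -> subrel (conn s a) (conn s' a').
Proof. by move=> h1 h2; apply: conn_min => //; apply: conn_trans. Qed.

Lemma conn_stable s a (D : {set T}) x y : (forall x, x \in D -> s x \in D) ->
  (forall x, x \in D -> a x \in D) -> conn s a x y -> x \in D -> y \in D.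
Proof.
move=> hs ha xy; apply/implyP.
apply: (@conn_min (fun u v => (u \in D) ==> (v \in D))) xy.
- by move=> u; apply: implybb.
- by move=> u v w /implyP h /implyP g; apply/implyP => /h /g.
- by move=> u; apply/implyP; apply: hs.
- by move=> u; apply/implyP; apply: ha.
Qed.

Lemma conn_fixed s a x y : s x = x -> a x = x -> conn s a x y = (x == y).
Proof.
move=> sx ax; apply/idP/eqP => [xy|<-]; last exact: conn0.
have := conn_stable (D := [set x]) _ _ xy; rewrite !inE => h.
by apply/esym/eqP/h => // z; rewrite !inE => /eqP ->; rewrite ?sx ?ax.
Qed.

Lemma conn_porbit s a (b : {perm T}) x y : (forall x, conn s a x (b x)) ->
  y \in porbit b x -> conn s a x y.
Proof.
move=> h /porbitP[i ->]; rewrite permX; elim: i => //= i IH.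
exact: conn_trans IH _.
Qed.

Lemma porbitE s x y : (y \in porbit s x) = conn s 1 x y.
Proof.
apply/idP/idP; first exact: conn_porbit.
move: x y; apply: (@conn_min (fun x y => y \in porbit s x)).
- by move=> x; apply: porbit_id.
- by move=> u v w; rewrite -!eq_porbit_mem => /eqP <- /eqP <-.
- by move=> x; apply: (mem_porbit s 1).
- by move=> x; rewrite perm1 porbit_id.
Qed.

Lemma porbit_nclass s : #|porbits s| = nclass (conn s 1).
Proof.
rewrite /porbits /nclass; congr #|pred_of_set _|; apply: eq_imset => x.
by apply/setP => y; rewrite inE porbitE.
Qed.

(* Twice the number of components minus the Euler characteristic is twice the
   genus: [planar] says that the gluing [a] of the stars of [s] has genus 0. *)
Definition planar s a :=
  #|porbits s| + #|porbits a| + #|porbits (a * s)|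
  == #|T| + (nclass (conn s a)).*2.

Section Unlink.
Variables (s a : {perm T}) (b0 b1 : T).
Hypotheses (aK : involutive a) (ab : a b0 = b1) (b01 : b0 != b1).
Let t := tperm b0 b1.

Lemma unlinkE z : (a * t) z = if (z == b0) || (z == b1) then z else a z.
Proof.
rewrite permM /t; have [->|zb0] := eqVneq z b0; first by rewrite ab tpermR.
have [->|zb1] := eqVneq z b1; first by rewrite -ab aK tpermL.
rewrite /= tpermD //; last by rewrite -ab (inj_eq perm_inj) eq_sym.
by rewrite -[b0]aK ab (inj_eq perm_inj) eq_sym.
Qed.

Lemma unlink_inv : involutive (a * t).
Proof.
move=> z; rewrite [X in (a * t) X]unlinkE; case: ifP => h; rewrite unlinkE ?h //.
case: ifP; rewrite ?aK // => /orP[]/eqP e; move: h.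
  by rewrite -[z]aK e ab eqxx orbT.
by rewrite -[z]aK e -ab aK eqxx.
Qed.

Let link_sub : forall z, conn s a z (t z).
Proof.
move=> z; rewrite /t; case: tpermP => [->|->|_ _].
- by rewrite -ab.
- by rewrite conn_sym -ab.
- exact: conn0.
Qed.

Let e1 z : conn s a z ((t * s) z).
Proof. by rewrite permM; apply: conn_trans (link_sub z) _. Qed.

Let e2 z : conn s a z ((a * t) z).
Proof. by rewrite permM; apply: conn_trans (link_sub _). Qed.

Lemma unlink_sub : subrel (conn (t * s) (a * t)) (conn s a).
Proof. by apply: conn_sub. Qed.

Let c := conn (t * s) (a * t).

(** Restoring the edge adds a single link, between [b0] and [b1]; a path needs it at most once, in
    one of its two directions. *)
Lemma unlink_min u v : conn s a u v ->
  [|| c u v, c u b0 && c b1 v | c u b1 && c b0 v].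
Proof.
move=> uv; have cs : symmetric c by apply: conn_sym.
have ct : transitive c by apply: conn_trans.
pose r u v := [|| c u v, c u b0 && c b1 v | c u b1 && c b0 v].
have rt : transitive r.
  move=> y x z; rewrite /r => /or3P[h1|/andP[h1 h2]|/andP[h1 h2]];
     move=> /or3P[h3|/andP[h3 h4]|/andP[h3 h4]]; apply/or3P.
  - by apply: Or31; apply: ct h3.
  - by apply: Or32; rewrite h4 (ct _ _ _ h1 h3).
  - by apply: Or33; rewrite h4 (ct _ _ _ h1 h3).
  - by apply: Or32; rewrite h1 (ct _ _ _ h2 h3).
  - by apply: Or32; rewrite h1 h4.
  - by apply: Or31; apply: ct h1 h4.
  - by apply: Or33; rewrite h1 (ct _ _ _ h2 h3).
  - by apply: Or31; apply: ct h1 h4.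
  - by apply: Or33; rewrite h1 h4.
have r0 : reflexive r by move=> x; rewrite /r /c conn0.
have rl : forall z, r z (t z).
  move=> z; rewrite /t; case: tpermP => [->|->|_ _].
  - by rewrite /r /c !conn0 orbT.
  - by rewrite /r /c !conn0 !orbT.
  - exact: r0.
have tK : t * t = 1 by rewrite /t tperm2.
apply: (@conn_min r _ _ r0 rt) uv => z.
  apply: rt (rl z) _; rewrite /r; apply/or3P/Or31.
  by have := conn1 (t * s) (a * t) (t z); rewrite permM tpermK.
have := rl (t (a z)); rewrite tpermK => h; apply: rt h.
rewrite /r; apply/or3P/Or31.
by have := conn2 (t * s) (a * t) z; rewrite permM.
Qed.

Lemma unlink_nclass : nclass (conn (t * s) (a * t))
  = nclass (conn s a) + ~~ conn (t * s) (a * t) b0 b1.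
Proof.
apply: nclass_link; [exact: conn_eqv..|exact: unlink_sub|by rewrite -ab|].
exact: unlink_min.
Qed.

(** The reason for multiplying the stars by the same transposition as the gluing: the edge
    disappears while the face permutation stays literally the same, so only vertices, edges and
    components have to be followed. *)
Lemma unlink_faces : (a * t) * (t * s) = a * s.
Proof. by rewrite mulgA -[a * t * t]mulgA tperm2 mulg1. Qed.

Lemma unlink_edges : #|porbits (a * t)| = #|porbits a| + 1%N.
Proof.
have -> : a * t = t * a.
  apply/permP => z; rewrite unlinkE permM /t.
  case: tpermP => [->|->|/eqP z0 /eqP z1]; rewrite ?eqxx ?orbT //=.
  - by rewrite -ab aK.
  - by rewrite (negPf z0) (negPf z1).
have := porbits_mul_tperm a b0 b1; rewrite /= b01.
suff -> : b0 \in porbit a b1 by rewrite addn0.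
by rewrite -[b0]aK ab (mem_porbit a 1).
Qed.

(** A transposition joins two cycles when its points lie on different ones, and cuts a cycle
    otherwise. *)
Lemma unlink_verts :
  #|porbits (t * s)| + (b0 \notin porbit s b1).*2 = #|porbits s| + 1%N.
Proof. by have := porbits_mul_tperm s b0 b1; rewrite /= b01. Qed.

(** Two joined stars form one cycle through both ends. This is read off the cycle count of [t * s],
    which the same transposition turns back into [s]. *)
Lemma unlink_conn : b0 \notin porbit s b1 -> conn (t * s) (a * t) b0 b1.
Proof.
move=> n; apply: (@conn_porbit _ _ (t * s)) => //.
have := porbits_mul_tperm (t * s) b0 b1; rewrite /= mulgA tperm2 mul1g b01.
have := unlink_verts; rewrite n /= porbit_sym; case: (b1 \in _) => //=.
by lia.
Qed.

End Unlink.

(** An involution is a product of disjoint transpositions: removing edges one at a time ends with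
    the gluing without edges. The measure is the number of moved points. *)
Lemma involution_ind (P : {perm T} -> Prop) : P 1 ->
  (forall a b, involutive a -> b != a b -> P (a * tperm b (a b)) -> P a) ->
  forall a, involutive a -> P a.
Proof.
move=> P1 step a; have [k] := ubnP #|[set x | a x != x]|.
elim: k a => // k IH a; rewrite ltnS => hk aK.
have [a1|/set0Pn[b]] := eqVneq [set x | a x != x] set0.
  suff -> : a = 1 by []; apply/permP => x; rewrite perm1; apply/eqP.
  by rewrite -[_ == _]negbK; have := in_set0 x; rewrite -a1 inE => ->.
rewrite inE eq_sym => ab; apply: (step a b) => //; apply: IH (unlink_inv aK erefl).
apply: leq_trans hk; apply: proper_card; apply/properP; split.
  by apply/subsetP => z; rewrite !inE unlinkE //; case: ifP => //; rewrite eqxx.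
by exists b; rewrite !inE; [rewrite eq_sym|rewrite unlinkE // eqxx /= eqxx].
Qed.

(** Induction on the edges. Removing an edge between two stars loses a vertex and gains a cycle of
    [a], with the same components. Removing a loop gains one of each, that is 2 on the left, while
    the right side grows by 0 or 2 according to whether a component is created. *)
Lemma genus_ge0 s a : involutive a ->
  #|porbits s| + #|porbits a| + #|porbits (a * s)|
  <= #|T| + (nclass (conn s a)).*2.
Proof.
move=> aK; move: a aK s; apply: involution_ind => [s|a b aK ab IH s].
  rewrite mul1g -porbit_nclass addnAC addnn addnC leq_add2r.
  by rewrite /porbits (leq_trans (leq_imset_card _ _)) // max_card.
have := IH (tperm b (a b) * s).
rewrite unlink_faces unlink_edges // unlink_nclass //.
have := unlink_verts s ab; have := @unlink_conn s a b _ ab.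
case: (b \in _) => /= [_|->//]; last by lia.
by case: (conn _ _ _ _) => /=; lia.
Qed.

(** The equality case of the same computation. When the edge is a loop, equality forces the creation
    of a component: this is a combinatorial Jordan curve theorem. *)
Lemma planar_unlink s a b0 b1 : involutive a -> a b0 = b1 -> b0 != b1 ->
  planar s a = planar (tperm b0 b1 * s) (a * tperm b0 b1) &&
    ((b0 \in porbit s b1) ==> ~~ conn (tperm b0 b1 * s) (a * tperm b0 b1) b0 b1).
Proof.
move=> aK ab b01; rewrite /planar unlink_faces (unlink_edges aK ab b01).
have := genus_ge0 (tperm b0 b1 * s) (unlink_inv aK ab).
rewrite unlink_faces (unlink_edges aK ab b01) (unlink_nclass _ ab).
have := unlink_verts s b01; have := @unlink_conn s a b0 _ b01.
case: (b0 \in _) => /= [_|->//]; last by lia.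
by case: (conn _ _ _ _) => /=; lia.
Qed.

(* A dart [x] fixed by the gluing can be spliced out of its star. *)
Section Splice.
Variables (s a : {perm T}) (x y : T).
Hypotheses (ax : a x = x) (sy : s y = x) (yx : y != x).
Let s' := tperm x y * s.

Lemma spliceE z : s' z = if z == x then x else if z == y then s x else s z.
Proof.
rewrite permM; case: tpermP => [->|->|/eqP zx /eqP zy].
- by rewrite eqxx.
- by rewrite eqxx (negPf yx).
- by rewrite (negPf zx) (negPf zy).
Qed.

Let s'x : s' x = x. Proof. by rewrite spliceE eqxx. Qed.

Lemma splice_isolated z : conn s' a x z -> z = x.
Proof. by rewrite conn_fixed // => /eqP. Qed.

Let e1 z : conn s a z (s' z).
Proof.
rewrite spliceE; case: eqP => [-> //|_]; case: eqP => [->|_ //].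
by apply: conn_trans (conn1 _ _ x); rewrite -sy.
Qed.

Let r u v := [|| conn s' a u v, conn s' a u x && conn s' a y v | conn s' a u y && conn s' a x v].

Lemma splice_min : subrel (conn s a) r.
Proof.
have cs := conn_sym s' a; have ct := @conn_trans s' a.
apply: conn_min.
- by move=> u; rewrite /r conn0.
- move=> v u w; rewrite /r => /or3P[h1|/andP[h1 h2]|/andP[h1 h2]];
     move=> /or3P[h3|/andP[h3 h4]|/andP[h3 h4]]; apply/or3P.
  - by apply: Or31; apply: ct h3.
  - by apply: Or32; rewrite h4 (ct _ _ _ h1 h3).
  - by apply: Or33; rewrite h4 (ct _ _ _ h1 h3).
  - by apply: Or32; rewrite h1 (ct _ _ _ h2 h3).
  - by apply: Or32; rewrite h1 h4.
  - by apply: Or31; apply: ct h1 h4.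
  - by apply: Or33; rewrite h1 (ct _ _ _ h2 h3).
  - by apply: Or31; apply: ct h1 h4.
  - by apply: Or33; rewrite h1 h4.
- move=> z; rewrite /r; have [->|zx] := eqVneq z x.
    apply/or3P/Or32; rewrite conn0 /=.
    by have := conn1 s' a y; rewrite spliceE (negPf yx) eqxx.
  have [->|zy] := eqVneq z y; first by rewrite sy !conn0 !orbT.
  by have := conn1 s' a z; rewrite spliceE (negPf zx) (negPf zy) => ->.
- by move=> z; rewrite /r conn2.
Qed.

Lemma splice_conn u v : u != x -> v != x -> conn s a u v = conn s' a u v.
Proof.
move=> ux vx; apply/idP/idP => [/splice_min/or3P[//|/andP[+ _]|/andP[_]]|].
- by rewrite conn_sym => /splice_isolated /eqP; rewrite (negPf ux).
- by move=> /splice_isolated /eqP; rewrite (negPf vx).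
- by apply: conn_sub.
Qed.

(** The isolated dart adds one cycle to the stars, one to the faces and one component; being already
    fixed by [a], it changes nothing for the edges. Both sides grow by 2. *)
Lemma planar_splice : planar s a = planar s' a.
Proof.
have n : nclass (conn s' a) = nclass (conn s a) + 1%N.
  have -> : 1%N = ~~ conn s' a x y.
    by case E: (conn _ _ _ _) => //; move/splice_isolated/eqP: E; rewrite (negPf yx).
  apply: nclass_link; [exact: conn_eqv..|exact: conn_sub| |exact: splice_min].
  by rewrite conn_sym -sy.
have v : #|porbits s'| = #|porbits s| + 1%N.
  have := porbits_mul_tperm s x y; rewrite /= eq_sym yx.
  suff -> : x \in porbit s y by rewrite addn0.
  by rewrite -sy (mem_porbit s 1).
have f : #|porbits (a * s')| = #|porbits (a * s)| + 1%N.
  (* The faces are cut by a transposition too: conjugation by [a], which fixes [x], moves it to the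
     front. *)
  have -> : a * s' = tperm x (a^-1 y) * (a * s).
    by rewrite /s' !mulgA; congr (_ * _); rewrite [RHS]conjgC tpermJ ax permKV.
  have := porbits_mul_tperm (a * s) x (a^-1 y); rewrite /=.
  have -> : x != a^-1 y by rewrite -(inj_eq (@perm_inj _ a)) permKV ax eq_sym.
  suff -> : x \in porbit (a * s) (a^-1 y) by rewrite addn0.
  by have := mem_porbit (a * s) 1 (a^-1 y); rewrite expg1 permM permKV sy.
by rewrite /planar n v f; lia.
Qed.

End Splice.
End Genus.

(** * Stars and their gluings *)

Section Restrict.
Local Open Scope group_scope.
Variable T : finType.
Implicit Types (s a : {perm T}) (x y z : T) (D : {set T}).

(** Darts outside [D] become fixed points instead of disappearing, so that a part of a map is again
    a permutation of [T]. *)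
Definition restricts s s1 D :=
  (forall x, x \in D -> s x \in D /\ s1 x = s x) /\
  (forall x, x \notin D -> s1 x = x).

Lemma restricts1 D : restricts 1 1 D.
Proof. by split=> x h; rewrite !perm1. Qed.

Lemma restrictsM s s1 a a1 D : restricts s s1 D -> restricts a a1 D ->
  restricts (a * s) (a1 * s1) D.
Proof.
move=> [h1 h2] [g1 g2]; split=> x xD; rewrite !permM.
  have [axD ->] := g1 x xD; exact: h1.
by rewrite g2 // h2.
Qed.

Lemma restrict_exists s D : (forall x, x \in D -> s x \in D) ->
  exists s1, restricts s s1 D.
Proof.
move=> st; exists (restr_perm D s); split=> x xD.
  split; first exact: st.
  rewrite restr_permE //; apply/astabsP => z; rewrite /= /aperm.
  have e : s @: D = D.
    apply/eqP; rewrite eqEcard card_imset; last exact: perm_inj.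
    by rewrite leqnn andbT; apply/subsetP => _ /imsetP[u uD ->]; apply: st.
  by rewrite -{1}e mem_imset //; exact: perm_inj.
by apply: out_perm xD; apply: restr_perm_on.
Qed.

Lemma restricts_uniq s s1 s2 D : restricts s s1 D -> restricts s s2 D -> s1 = s2.
Proof.
move=> [h1 h2] [g1 g2]; apply/permP => x.
have [xD|xD] := boolP (x \in D); last by rewrite h2 ?g2.
by have [_ ->] := h1 x xD; have [_ ->] := g1 x xD.
Qed.

Lemma conn_restrict s s1 a a1 D x y : restricts s s1 D -> restricts a a1 D ->
  x \in D -> conn s a x y = conn s1 a1 x y.
Proof.
move=> [h1 h2] [g1 g2] xD; apply/idP/idP.
  move=> xy; pose r u v := (u \in D) ==> (v \in D) && conn s1 a1 u v.
  suff: r x y by rewrite /r xD => /andP[].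
  apply: conn_min xy; rewrite /r.
  - by move=> u; rewrite conn0 andbT implybb.
  - move=> u v w /implyP h /implyP g; apply/implyP => /h /andP[/g /andP[-> hw] vu].
    exact: conn_trans vu hw.
  - move=> u; apply/implyP => uD; have [-> <-] := h1 u uD; exact: conn1.
  - move=> u; apply/implyP => uD; have [-> <-] := g1 u uD; exact: conn2.
move: x y {xD}; apply: conn_sub => u.
  have [uD|uD] := boolP (u \in D); first by have [_ ->] := h1 u uD; apply: conn1.
  by rewrite h2 ?conn0.
have [uD|uD] := boolP (u \in D); first by have [_ ->] := g1 u uD; apply: conn2.
by rewrite g2 ?conn0.
Qed.

Lemma nclass_restrict s s1 s2 a a1 a2 D1 D2 : [disjoint D1 & D2] ->
  restricts s s1 D1 -> restricts s s2 D2 ->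
  restricts a a1 D1 -> restricts a a2 D2 ->
  (forall x, x \notin D1 -> x \notin D2 -> s x = x /\ a x = x) ->
  nclass (conn s a) + #|T| = nclass (conn s1 a1) + nclass (conn s2 a2).
Proof.
move=> dis h1 h2 g1 g2 o.
apply: (nclass_disjoint dis); try exact: conn_eqv.
- by move=> x xD y; apply: conn_restrict xD.
- by move=> x xD y; apply: conn_restrict xD.
- move=> x xD y; rewrite /= [y == x]eq_sym.
  by apply: conn_fixed; [case: h1 => _; apply|case: g1 => _; apply].
- move=> x xD y; rewrite /= [y == x]eq_sym.
  by apply: conn_fixed; [case: h2 => _; apply|case: g2 => _; apply].
- move=> x x1 x2 y; rewrite /= [y == x]eq_sym.
  by have [sx ax] := o x x1 x2; apply: conn_fixed.
Qed.

(** The three cycle counts and the number of components are additive up to [#|T|], hence so is the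
    genus; since both genera are nonnegative, their sum vanishes only if both do. *)
Lemma planar_restrict s s1 s2 a a1 a2 D1 D2 : [disjoint D1 & D2] ->
  restricts s s1 D1 -> restricts s s2 D2 ->
  restricts a a1 D1 -> restricts a a2 D2 ->
  (forall x, x \notin D1 -> x \notin D2 -> s x = x /\ a x = x) ->
  involutive a -> planar s a = planar s1 a1 && planar s2 a2.
Proof.
move=> dis h1 h2 g1 g2 o aK.
have inv ai D : restricts a ai D -> involutive ai.
  move=> [r1 r2] x; have [xD|xD] := boolP (x \in D); last by rewrite !r2.
  by have [axD ->] := r1 x xD; have [_ ->] := r1 _ axD; rewrite aK.
have := genus_ge0 s1 (inv _ _ g1); have := genus_ge0 s2 (inv _ _ g2).
have := nclass_restrict dis h1 h2 g1 g2 o.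
have := nclass_restrict dis h1 h2 (restricts1 _) (restricts1 _).
have := nclass_restrict dis g1 g2 (restricts1 _) (restricts1 _).
have := nclass_restrict dis (restrictsM h1 g1) (restrictsM h2 g2) (restricts1 _) (restricts1 _).
rewrite /planar -!porbit_nclass => e1 e2 e3.
have {}e1 := e1 _; have {}e2 := e2 _; have {}e3 := e3 _.
have {}e1 : #|porbits (a * s)| + #|T| = #|porbits (a1 * s1)| + #|porbits (a2 * s2)|.
  by apply: e1 => x x1 x2; rewrite perm1 permM; have [es ->] := o x x1 x2.
have {}e2 : #|porbits a| + #|T| = #|porbits a1| + #|porbits a2|.
  by apply: e2 => x x1 x2; rewrite perm1; have [_ ->] := o x x1 x2.
have {}e3 : #|porbits s| + #|T| = #|porbits s1| + #|porbits s2|.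
  by apply: e3 => x x1 x2; rewrite perm1; have [-> _] := o x x1 x2.
by move: e1 e2 e3; lia.
Qed.

End Restrict.

Section Stars.
Local Open Scope group_scope.
Variables (T : finType) (C : eqType) (col : T -> C).
Implicit Types (s a : {perm T}) (x y z : T) (d r : seq (seq T)) (c : seq T).

(* [d] lists the stars, i.e. the cycles of [s]; the head of each star is a
   marked dart without branch, so that a star of type 1 is still a cycle, and
   all the other darts of the star are branches. *)
Definition stars s d :=
  [/\ uniq (flatten d), [::] \notin d, {in d, forall c, fcycle s c} &
      forall x, x \notin flatten d -> s x = x].

Definition letters d := flatten (map behead d).

Definition matching d a :=
  [&& [forall x, a (a x) == x], [forall x, (a x != x) == (x \in letters d)] &
      [forall x, col (a x) == col x]].

Definition conn_on s a d :=
  [forall x in flatten d, forall y in flatten d, conn s a x y].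

Definition nbmaps s d :=
  #|[set a | [&& matching d a, conn_on s a d & planar s a]]|.

Lemma matchingP d a :
  reflect [/\ involutive a, forall x, (a x != x) = (x \in letters d) &
              forall x, col (a x) = col x] (matching d a).
Proof.
apply: (iffP and3P) => -[h1 h2 h3]; split.
- by move=> x; exact: (eqP (forallP h1 x)).
- by move=> x; exact: (eqP (forallP h2 x)).
- by move=> x; exact: (eqP (forallP h3 x)).
- by apply/forallP => x; apply/eqP; apply: h1.
- by apply/forallP => x; apply/eqP; apply: h2.
- by apply/forallP => x; apply/eqP; apply: h3.
Qed.

Lemma letters_sub d : {subset letters d <= flatten d}.
Proof.
move=> x /flattenP[_ /mapP[c cd ->] /mem_behead xc].
by apply/flattenP; exists c.
Qed.

Lemma star_closed s d c x : stars s d -> c \in d -> x \in c -> s x \in c.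
Proof.
move=> [_ _ h _] cd xc; have := next_cycle (h c cd) xc.
by rewrite /= => /eqP ->; rewrite mem_next.
Qed.

Lemma stars_closed s d d' x : stars s d -> {subset d' <= d} ->
  x \in flatten d' -> s x \in flatten d'.
Proof.
move=> h sub /flattenP[c cd xc]; apply/flattenP; exists c => //.
by apply: star_closed h (sub _ cd) xc.
Qed.

Lemma stars_sub s s1 d d' : stars s d -> {subset d' <= d} -> uniq (flatten d') ->
  restricts s s1 [set x in flatten d'] -> stars s1 d'.
Proof.
move=> [h1 h2 h3 h4] sub u [g1 g2]; split=> //.
- by apply: contra h2; apply: sub.
- move=> c cd; rewrite (@eq_in_cycle _ (mem c) _ (frel s)) ?h3 ?sub //.
    move=> x y xc _ /=; have [|_ ->] // := g1 x.
    by rewrite inE; apply/flattenP; exists c.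
- by move=> x xd; rewrite g2 ?inE.
Qed.

Lemma nth_in_mask (A : eqType) (w : seq A) b (x0 : A) i : i < size w -> nth false b i ->
  nth x0 w i \in mask b w.
Proof.
elim: w b i => [|e w IH] [|[] b] [|i] //=; rewrite ?nth_nil // ?inE ?eqxx //.
  by rewrite ltnS => h g; rewrite IH ?orbT.
by rewrite ltnS; apply: IH.
Qed.

Lemma mem_maskP (A : eqType) (w : seq A) b (x0 u : A) : u \in mask b w ->
  exists2 i, i < size w & nth false b i /\ u = nth x0 w i.
Proof.
elim: w b => [|e w IH] [|[] b] //=; rewrite ?inE.
  case/predU1P => [->|/IH[i iw h]]; first by exists 0.
  by exists i.+1.
by move/IH => [i iw h]; exists i.+1.
Qed.

Lemma perm_maskC (A : eqType) (w : seq A) b : size b = size w ->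
  perm_eq (mask b w ++ mask (map negb b) w) w.
Proof.
elim: w b => [|e w IH] [|[] b] //= [/IH h]; first by rewrite perm_cons.
by rewrite -[X in _ ++ X]cat1s perm_catCA /= perm_cons.
Qed.

Lemma star_conn s a d c x y : stars s d -> c \in d -> x \in c -> y \in c ->
  conn s a x y.
Proof.
move=> [_ _ h _] cd xc yc; apply: (fconnect_conn (@conn1 _ s a)).
by rewrite (fconnect_cycle (h _ cd) xc).
Qed.

Lemma matching_fix d a x : matching d a -> x \notin letters d -> a x = x.
Proof. by case/matchingP => _ h _; rewrite -h negbK => /eqP. Qed.

Lemma matching_letters d a x : matching d a -> (a x \in letters d) = (x \in letters d).
Proof. by case/matchingP => aK h _; rewrite -!h aK eq_sym. Qed.

Lemma matching_closed d a x : matching d a -> x \in flatten d -> a x \in flatten d.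
Proof.
move=> m xd; have [xl|xl] := boolP (x \in letters d); last by rewrite (matching_fix m).
by apply: letters_sub; rewrite matching_letters.
Qed.

Lemma letters_cat d d' : letters (d ++ d') = letters d ++ letters d'.
Proof. by rewrite /letters map_cat flatten_cat. Qed.

Lemma perm_letters d d' : perm_eq d d' -> letters d =i letters d'.
Proof. by move=> p x; apply: perm_mem; apply/perm_flatten/perm_map. Qed.

Lemma letters_cons c d : letters (c :: d) = behead c ++ letters d. Proof. by []. Qed.

Lemma matching_split d d1 d2 a a1 a2 : uniq (flatten d) -> perm_eq (d1 ++ d2) d ->
  restricts a a1 [set x in flatten d1] -> restricts a a2 [set x in flatten d2] ->
  (forall x, x \notin flatten d -> a x = x) ->
  matching d a = matching d1 a1 && matching d2 a2.
Proof.
move=> ud pd ra1 ra2 out.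
have pf : perm_eq (flatten d1 ++ flatten d2) (flatten d).
  by rewrite -flatten_cat; apply: perm_flatten.
have dis x : x \in flatten d1 -> x \notin flatten d2.
  move: ud; rewrite -(perm_uniq pf) cat_uniq => /and3P[_ h _] x1.
  by apply: contra h => x2; apply/hasP; exists x.
have lE x : (x \in letters d) = (x \in letters d1) || (x \in letters d2).
  by rewrite -(perm_letters pd) letters_cat mem_cat.
have l0 e x : x \notin flatten e -> (x \in letters e) = false.
  exact: contraNF (@letters_sub e x).
have l1 x : x \in flatten d1 -> (x \in letters d) = (x \in letters d1).
  by move=> /dis n; rewrite lE [X in _ || X]l0 ?orbF.
have l2 x : x \in flatten d2 -> (x \in letters d) = (x \in letters d2).
  by move=> x2; rewrite lE l0 //; apply: contraL x2; apply: dis.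
have rE e ai : restricts a ai [set x in flatten e] ->
    (forall x, x \in flatten e -> a x \in flatten e /\ ai x = a x) /\
    (forall x, x \notin flatten e -> ai x = x).
  by move=> [r o]; split=> x; [have := r x|have := o x]; rewrite !in_set.
have [r1 o1] := rE _ _ ra1; have [r2 o2] := rE _ _ ra2.
apply/matchingP/andP => [[aK aL aC]|[/matchingP[K1 L1 C1] /matchingP[K2 L2 C2]]].
  have half e ai : restricts a ai [set x in flatten e] ->
      (forall x, x \in flatten e -> (x \in letters d) = (x \in letters e)) -> matching e ai.
    move=> /rE[r o] l; apply/matchingP; split=> x;
    (have [xe|xe] := boolP (x \in flatten e); [have [ye ax] := r x xe|have ax := o x xe]);
    rewrite ?ax //; first by have [_ ->] := r _ ye.
      by rewrite aL l.
    by rewrite eqxx l0.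
  by split; apply: half; eauto.
split=> x; (have [x1|x1] := boolP (x \in flatten d1); [have [y1 e1] := r1 x x1|
  have [x2|x2] := boolP (x \in flatten d2); [have [y2 e2] := r2 x x2|
    have e : a x = x by apply: out; rewrite -(perm_mem pf) mem_cat negb_or x1]]).
- by have [_ <-] := r1 _ y1; rewrite -e1.
- by have [_ <-] := r2 _ y2; rewrite -e2.
- by rewrite !e.
- by rewrite -e1 L1 l1.
- by rewrite -e2 L2 l2.
- by rewrite e eqxx lE !l0.
- by rewrite -e1.
- by rewrite -e2.
- by rewrite e.
Qed.

Lemma conn_on_restrict s s1 a a1 e h : restricts s s1 [set x in flatten e] ->
  restricts a a1 [set x in flatten e] -> h \in flatten e ->
  conn_on s1 a1 e = [forall x in flatten e, conn s a h x].
Proof.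
move=> rs ra he; have cE x y : x \in flatten e -> conn s a x y = conn s1 a1 x y.
  by move=> xe; apply: conn_restrict rs ra _; rewrite inE.
apply/forall_inP/forall_inP => co x xe.
  by rewrite cE //; move/forall_inP: (co h he); apply.
apply/forall_inP => y ye; rewrite -cE //.
by apply: (conn_trans (y := h)); [rewrite conn_sym|]; apply: co.
Qed.

(** * Planar gluings in two components, one for each of two given stars *)

Section Split.
Variables (s : {perm T}) (h1 h2 : T) (p1 p2 : seq T) (r : seq (seq T)).
Let c1 := h1 :: p1.
Let c2 := h2 :: p2.
Let d := [:: c1, c2 & r].
Hypothesis (sd : stars s d).

Let X := [set a | [&& matching d a, planar s a, ~~ conn s a h1 h2 &
  [forall x in flatten d, conn s a h1 x || conn s a h2 x]]].

(** The two parts are realized by different restrictions of [s]; the hypothesis on [F] says that the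
    number of maps depends on the stars only. *)
Variable F : seq (seq T) -> nat.
Hypothesis NF : forall s1 d1, {subset d1 <= d} -> stars s1 d1 ->
  nbmaps s1 d1 = F d1.

Let d1 (b : seq bool) := c1 :: mask b r.
Let d2 (b : seq bool) := c2 :: mask (map negb b) r.

Let permd b : size b = size r -> perm_eq (d1 b ++ d2 b) d.
Proof.
move=> /perm_maskC e; rewrite /d1 /d2 /d /= perm_cons.
by rewrite -[X in _ ++ X]cat1s perm_catCA /= perm_cons.
Qed.

Let phi a := [seq conn s a h1 (head h1 c) | c <- r].

(** The mask [b] tells which of the other stars lie in the component of [h1]. For a fixed mask, a
    gluing is the product of its restrictions to the two parts, and any two gluings of the parts can
    be multiplied because their supports are disjoint. *)
Lemma card_splitting_class (b : seq bool) : size b = size r ->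
  #|[set a in X | phi a == b]| = (F (d1 b) * F (d2 b))%N.
Proof.
move=> sb; have pd := permd sb.
pose D1 := [set x in flatten (d1 b)]; pose D2 := [set x in flatten (d2 b)].
have sub1 : {subset d1 b <= d}.
  by move=> c cd; rewrite -(perm_mem pd) mem_cat cd.
have sub2 : {subset d2 b <= d}.
  by move=> c cd; rewrite -(perm_mem pd) mem_cat cd orbT.
have [ud nd cd od] := sd.
have pf : perm_eq (flatten (d1 b) ++ flatten (d2 b)) (flatten d).
  by rewrite -flatten_cat; apply: perm_flatten.
have ufl := ud; rewrite -(perm_uniq pf) cat_uniq in ufl.
have /and3P[u1 dis12 u2] := ufl.
have dis : [disjoint D1 & D2].
  apply/pred0P => x /=; rewrite !inE; apply/negP => /andP[x1 x2].
  by case/hasP: dis12; exists x.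
have [s1 rs1] : exists s1, restricts s s1 D1.
  apply: restrict_exists => x; rewrite !in_set; exact: stars_closed sd sub1.
have [s2 rs2] : exists s2, restricts s s2 D2.
  apply: restrict_exists => x; rewrite !in_set; exact: stars_closed sd sub2.
rewrite -(NF sub1 (stars_sub sd sub1 u1 rs1)) -(NF sub2 (stars_sub sd sub2 u2 rs2)) -cardsX.
have fl x : (x \in flatten d) = (x \in D1) || (x \in D2).
  by rewrite !in_set -(perm_mem pf) [LHS]mem_cat.
have D1nD2 x : x \in D1 -> x \notin D2 by move=> h; rewrite (disjointFr dis h).
have D2nD1 x : x \in D2 -> x \notin D1 by move=> h; rewrite (disjointFl dis h).
have h1D : h1 \in flatten (d1 b) by rewrite mem_head.
have h2D : h2 \in flatten (d2 b) by rewrite mem_head.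
have out x : x \notin D1 -> x \notin D2 -> x \notin flatten d.
  by rewrite fl => /negPf -> /negPf ->.
set A1 := [set a | [&& matching (d1 b) a, _ & _]].
set A2 := [set a | [&& matching (d2 b) a, _ & _]].
have key a a1 a2 : restricts a a1 D1 -> restricts a a2 D2 ->
    (forall x, x \notin flatten d -> a x = x) ->
    (a1 \in A1) && (a2 \in A2) = [&& matching d a, planar s a,
      [forall x in flatten (d1 b), conn s a h1 x] & [forall x in flatten (d2 b), conn s a h2 x]].
  move=> ra1 ra2 ao; have me := matching_split ud pd ra1 ra2 ao.
  rewrite !inE (conn_on_restrict rs1 ra1 h1D) (conn_on_restrict rs2 ra2 h2D) me.
  case m1 : (matching (d1 b) a1); case m2 : (matching (d2 b) a2); rewrite ?andbF //=.
  have aK : involutive a by move: me; rewrite m1 m2 => /matchingP[].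
  rewrite (planar_restrict dis rs1 rs2 ra1 ra2) //.
    by rewrite andbACA andbC.
  by move=> x x1 x2; have xd := out x x1 x2; rewrite od ?ao.
have prodP a1 a2 : a1 \in A1 -> a2 \in A2 ->
    restricts (a1 * a2) a1 D1 /\ restricts (a1 * a2) a2 D2.
  rewrite !inE => /and3P[m1 _ _] /and3P[m2 _ _].
  have f1 x : x \notin D1 -> a1 x = x.
    by rewrite in_set => n; apply: matching_fix m1 _; apply: contra n; apply: letters_sub.
  have f2 x : x \notin D2 -> a2 x = x.
    by rewrite in_set => n; apply: matching_fix m2 _; apply: contra n; apply: letters_sub.
  have c1' x : x \in D1 -> a1 x \in D1.
    by rewrite !in_set; apply: matching_closed m1.
  have c2' x : x \in D2 -> a2 x \in D2.
    by rewrite !in_set; apply: matching_closed m2.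
  split; split=> // x xD; rewrite permM.
    by rewrite f2 ?D1nD2 ?c1'.
  by rewrite (f1 x) ?D2nD1 ?c2'.
(* The product is injective on pairs, as each factor is recovered by restriction. *)
rewrite -(@card_in_imset _ _ (fun p : {perm T} * {perm T} => p.1 * p.2)); last first.
  move=> [a1 a2] [a1' a2']; rewrite !in_setX /= => /andP[m1 m2] /andP[m1' m2'] e.
  have [r1 r2] := prodP _ _ m1 m2; have [r1' r2'] := prodP _ _ m1' m2'.
  by rewrite e in r1 r2; rewrite (restricts_uniq r1 r1') (restricts_uniq r2 r2').
congr #|pred_of_set _|; apply/setP => a; rewrite [a \in [set _ in X | _]]inE.
apply/andP/imsetP => [[]|[[a1 a2]]].
  rewrite inE => /and4P[m pl nc /forall_inP cov] /eqP pb.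
  have ct := @conn_trans _ s a; have cs := conn_sym s a.
  have head_c c x : c \in d -> x \in c -> conn s a (head h1 c) x.
    move=> cd' xc; apply: (star_conn _ sd cd' _ xc).
    by case: c {cd'} xc => //= y c _; rewrite in_cons eqxx.
  have rd c : c \in r -> c \in d by move=> cr; rewrite /d !inE cr !orbT.
  have D1c x : x \in D1 -> conn s a h1 x.
    rewrite in_set => /flattenP[c]; rewrite /d1 in_cons => /orP[/eqP ->|cm] xc.
      by apply: (head_c c1) xc; rewrite in_cons eqxx.
    have [i ir [bi ce]] := mem_maskP [::] cm; move: bi.
    rewrite -pb (nth_map [::]) // -ce => hc; apply: ct hc _.
    by apply: head_c xc; apply: rd; rewrite ce mem_nth.
  have D2c x : x \in D2 -> ~~ conn s a h1 x.
    rewrite in_set => /flattenP[c]; rewrite /d2 in_cons => /orP[/eqP ->|cm] xc.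
      apply: contra nc => hx; apply: ct hx _; rewrite cs.
      have c2d : c2 \in d by rewrite !in_cons eqxx orbT.
      by apply: (star_conn _ sd c2d) => //; rewrite in_cons eqxx.
    have [i ir [bi ce]] := mem_maskP [::] cm; move: bi.
    rewrite (nth_map false) ?sb // -pb (nth_map [::]) // -ce.
    apply: contra => hx; apply: ct hx _; rewrite cs.
    by apply: head_c xc; apply: rd; rewrite ce mem_nth.
  have aflat x : x \in flatten d -> a x \in flatten d by apply: matching_closed m.
  have [aK _ _] := matchingP _ _ m.
  have aD1 x : x \in D1 -> a x \in D1.
    move=> xD; have := aflat x; rewrite !fl xD => /(_ isT)/orP[//|/D2c].
    by rewrite (ct _ _ _ (D1c x xD)) ?conn2.
  have aD2 x : x \in D2 -> a x \in D2.
    move=> xD; have := aflat x; rewrite !fl xD orbT => /(_ isT)/orP[/aD1|//].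
    by rewrite aK (negPf (D2nD1 x xD)).
  have [a1 ra1] := restrict_exists aD1; have [a2 ra2] := restrict_exists aD2.
  have aout x : x \notin flatten d -> a x = x.
    by move=> xd; apply: (matching_fix m); apply: contra xd; apply: letters_sub.
  exists (a1, a2); last first.
    apply/permP => x; rewrite permM /=; have [g1 g2] := ra1; have [k1 k2] := ra2.
    have [x1|x1] := boolP (x \in D1).
      by have [xD ->] := g1 x x1; rewrite k2 ?D1nD2.
    rewrite g2 //; have [x2|x2] := boolP (x \in D2); first by have [_ ->] := k1 x x2.
    by rewrite k2 // aout ?out.
  rewrite in_setX (key a) // m pl /=; apply/andP; split; apply/forall_inP => x xD.
    by apply: D1c; rewrite in_set.
  have xD2 : x \in D2 by rewrite in_set.
  by have := cov x; rewrite fl xD2 orbT (negPf (D2c x xD2)); apply.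
rewrite in_setX /= => /andP[m1 m2] ->{a}; have [r1 r2] := prodP _ _ m1 m2.
set a := a1 * a2 in r1 r2 *.
have := key a a1 a2 r1 r2; rewrite m1 m2 => /(_ _)/esym/and4P[].
  move=> x; rewrite fl negb_or => /andP[x1 x2]; rewrite permM.
  by have [_ ->//] := r1; have [_ ->//] := r2.
move=> ma pl /forall_inP D1c /forall_inP D2c.
(* The first part is stable under [s] and [a], so that [h1] cannot reach the second. *)
have nc x : x \in flatten (d2 b) -> ~~ conn s a h1 x.
  move=> xD; have {}xD : x \in D2 by rewrite in_set.
  apply/negP => h; have := D2nD1 x xD; apply/negP; rewrite negbK.
  apply: conn_stable h _ => [z zD|z zD|]; last by rewrite in_set.
    by have [h _] := rs1; have [] := h z zD.
  by have [h _] := r1; have [] := h z zD.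
split.
  rewrite inE ma pl nc //=; apply/forall_inP => x; rewrite fl !in_set.
  by case/orP => [/D1c ->|/D2c ->]; rewrite ?orbT.
apply/eqP/(@eq_from_nth _ false); first by rewrite size_map sb.
move=> i; rewrite size_map => ir; rewrite (nth_map [::]) //.
have cr : nth [::] r i \in r by apply: mem_nth.
have hc : head h1 (nth [::] r i) \in nth [::] r i.
  case E: (nth _ _ _) cr => [|y c] //= cr; last by rewrite in_cons eqxx.
  by case/negP: nd; rewrite !in_cons cr !orbT.
case E: (nth false b i).
  apply: D1c; apply/flattenP; exists (nth [::] r i) => //.
  by rewrite in_cons nth_in_mask ?orbT.
apply/negbTE/nc; apply/flattenP; exists (nth [::] r i) => //.
by rewrite in_cons nth_in_mask ?orbT // (nth_map false) ?sb // E.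
Qed.

Lemma card_splitting :
  #|X| = (\sum_(b : (size r).-tuple bool) F (d1 b) * F (d2 b))%N.
Proof.
have sphi a : size (phi a) == size r by rewrite size_map.
rewrite -sum1_card (partition_big (fun a => Tuple (sphi a)) predT) //=.
apply: eq_bigr => b _; rewrite -card_splitting_class ?size_tuple // -sum1_card.
by apply: eq_bigl => a; rewrite !inE -val_eqE.
Qed.

End Split.
End Stars.

(** * Gluings of branches as matchings of darts *)

Section Transversal.
Local Open Scope group_scope.
Variable T : finType.

Lemma porbits_transversal (p : {perm T}) (A : {set T}) :
  (forall x, exists2 y, y \in A & y \in porbit p x) ->
  {in A &, forall x y, y \in porbit p x -> x = y} -> #|porbits p| = #|A|.
Proof.
move=> cov un; rewrite porbit_nclass; apply: nclass_transversal => [|x|x y xA yA].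
- exact: conn_eqv.
- by have [y yA xy] := cov x; exists y; rewrite -?porbitE.
- by rewrite -porbitE; apply: un.
Qed.

Lemma porbit_fix (p : {perm T}) x y : p x = x -> y \in porbit p x -> y = x.
Proof.
move=> px /porbitP[i ->]; rewrite permX; elim: i => //= i ->; exact: px.
Qed.

Lemma porbits_involution (a : {perm T}) : involutive a ->
  (#|porbits a|.*2 + #|[set x | a x != x]| = #|T|.*2)%N.
Proof.
move: a; apply: involution_ind => [|a b aK ab].
  rewrite [X in (_ + X)%N]eq_card0 => [|x]; last by rewrite !inE perm1 eqxx.
  rewrite addn0 -cardsT; congr _.*2; apply: porbits_transversal => [x|x y _ _].
    by exists x => //; apply: porbit_id.
  by move/porbit_fix => -> //; rewrite perm1.
rewrite unlink_edges //.
have -> : [set x | a x != x] = b |: (a b |: [set x | (a * tperm b (a b)) x != x]).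
  apply/setP => z; rewrite !inE (unlinkE aK erefl).
  have [->|zb] := eqVneq z b; first by rewrite eq_sym ab.
  by have [->|zb'] := eqVneq z (a b); rewrite //= aK ab.
rewrite !cardsU1 !inE !(unlinkE aK erefl) !eqxx !orbT !eqxx (negPf ab) /=.
by lia.
Qed.

End Transversal.

Section Bridge.
Local Open Scope group_scope.
Variables (m : nat) (T : finType) (col : T -> 'I_m).
Variables (s : {perm T}) (d : seq (seq T)).
Hypothesis (sd : stars s d).
Variable x0 : T.

Definition star_word (c : seq T) : word m := monalg.FMonom (map col (behead c)).
Let sl := map star_word d.
Let B := branch sl.

Let ssl : size sl = size d. Proof. by rewrite size_map. Qed.

Let tagK (v : 'I_(size sl)) : tnth (in_tuple sl) v = star_word (nth [::] d v).
Proof. by rewrite (tnth_nth (star_word [::])) /= (nth_map [::]) // -ssl. Qed.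

Let ssz (v : 'I_(size sl)) :
  size (tnth (in_tuple sl) v) = size (behead (nth [::] d v)).
Proof. by rewrite tagK /= size_map. Qed.

Definition dart (b : B) : T := nth x0 (behead (nth [::] d (tag b))) (tagged b).

Let nd v : v < size d -> nth [::] d v = head x0 (nth [::] d v) :: behead (nth [::] d v).
Proof.
move=> vd; have := mem_nth [::] vd; case: (nth _ _ _) => //=.
by have [_ /negPf ->] := sd.
Qed.

Let tlt (b : B) : tag b < size d. Proof. by rewrite -ssl. Qed.
Let klt (b : B) : tagged b < size (behead (nth [::] d (tag b))).
Proof. by rewrite -ssz. Qed.

Lemma dart_mem b : dart b \in behead (nth [::] d (tag b)).
Proof. by apply: mem_nth; apply: klt. Qed.

Lemma dart_star b : dart b \in nth [::] d (tag b).
Proof. by apply: mem_behead; apply: dart_mem. Qed.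

Lemma dart_letters b : dart b \in letters d.
Proof.
apply/flattenP; exists (behead (nth [::] d (tag b))); last exact: dart_mem.
by apply/map_f/mem_nth/tlt.
Qed.

Let ud : uniq (flatten d). Proof. by case: sd. Qed.

Lemma uniq_flatten_nth (d' : seq (seq T)) i j x : uniq (flatten d') ->
  i < size d' -> j < size d' ->
  x \in nth [::] d' i -> x \in nth [::] d' j -> i = j.
Proof.
elim: d' i j => // c d' IH [|i] [|j] //= ; rewrite cat_uniq => /and3P[_ /hasPn h u] ii jj.
- move=> xc xj; have /negP[] // : x \notin c.
  by apply: h; apply/flattenP; exists (nth [::] d' j); rewrite ?mem_nth.
- move=> xi xc; have /negP[] // : x \notin c.
  by apply: h; apply/flattenP; exists (nth [::] d' i); rewrite ?mem_nth.
- by move=> xi xj; rewrite (IH i j).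
Qed.

Lemma uniq_star v : v < size d -> uniq (nth [::] d v).
Proof.
move=> vd; have := mem_nth [::] vd; move: ud; move: (nth _ _ _) => c.
elim: d => //= c' d' IH; rewrite cat_uniq in_cons => /and3P[u _ /IH h].
by case/predU1P => [->|/h].
Qed.

Let mkb (v : 'I_(size sl)) (k : 'I_(size (tnth (in_tuple sl) v))) : B :=
  Tagged (fun v : 'I_(size sl) => 'I_(size (tnth (in_tuple sl) v))) k.

Lemma dart_inj : injective dart.
Proof.
move=> b b' e; have tt : tag b = tag b'.
  apply: val_inj; apply: (@uniq_flatten_nth d _ _ (dart b)) => //; try exact: tlt.
    exact: dart_star.
  by rewrite e; apply: dart_star.
case: b b' e tt => [v k] [v' k'] /= e tt; move: k' e; rewrite -tt => k'.
rewrite /dart /= => e; congr (Tagged _ _); apply: val_inj => /=.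
have vd : v < size d by rewrite -ssl.
have ub : uniq (behead (nth [::] d v)).
  by have := uniq_star vd; rewrite (nd vd) => /andP[].
by have := nth_uniq x0 (klt (mkb k)) (klt (mkb k')) ub; rewrite /= e eqxx => /esym/eqP.
Qed.

Lemma letters_dart x : x \in letters d -> exists b, x = dart b.
Proof.
case/flattenP => _ /mapP[c cd ->] xc.
have vd : index c d < size sl by rewrite ssl index_mem.
have nc : nth [::] d (index c d) = c by apply: nth_index.
have kd : index x (behead c) < size (tnth (in_tuple sl) (Ordinal vd)).
  by rewrite ssz /= nc index_mem.
exists (mkb (Ordinal kd)).
by rewrite /dart /= nc nth_index.
Qed.

Lemma branch_colorE b : branch_color b = col (dart b).
Proof.
rewrite /branch_color (tnth_nth (col x0)) /= /dart.
have := klt b; set k := nat_of_ord (tagged b) => kl.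
by rewrite tagK /= (nth_map x0).
Qed.

Lemma card_branch : #|B| = #|[set x in letters d]|.
Proof.
rewrite -(card_codom dart_inj) cardsE; apply: eq_card => x; apply/codomP/idP => [[b ->]|].
  exact: dart_letters.
exact: letters_dart.
Qed.

Let hd v := head x0 (nth [::] d v).

Lemma star_step v : v < size d ->
  forall i, i <= size (behead (nth [::] d v)) ->
  s (nth x0 (nth [::] d v) i) = nth x0 (rcons (behead (nth [::] d v)) (hd v)) i.
Proof.
move=> vd i ip; have [_ _ h _] := sd; have := h _ (mem_nth [::] vd).
rewrite (nd vd) /= => /(pathP x0)/(_ i); rewrite size_rcons ltnS => /(_ ip).
rewrite /hd => /eqP; case: i ip => [|i] //= ip.
by rewrite nth_rcons ip.
Qed.

Lemma hd_notin_letters v : v < size d -> hd v \notin letters d.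
Proof.
move=> vd; apply/negP => /letters_dart[b e].
have hv : hd v \in nth [::] d v by rewrite (nd vd) in_cons eqxx.
have /(uniq_flatten_nth ud vd (tlt b) hv) tv : hd v \in nth [::] d (tag b).
  by rewrite e dart_star.
have := uniq_star vd; rewrite (nd vd) /= -/(hd v) e tv => /andP[/negP + _]; apply.
exact: dart_mem.
Qed.

Lemma s_hd v : v < size d -> behead (nth [::] d v) != [::] ->
  s (hd v) = nth x0 (behead (nth [::] d v)) 0.
Proof.
move=> vd; have := star_step vd (leq0n _); rewrite {1}(nd vd) /= -/(hd v) => ->.
by case: (behead _).
Qed.

(** The cycle of [s] passes through the marked dart between the last branch and the first, where
    [branch_next] jumps directly; elsewhere they agree. *)
Lemma branch_next_dart (b : B) :
  if (tagged b).+1 == size (behead (nth [::] d (tag b))) then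
    s (dart b) = hd (tag b) /\ dart (branch_next b) = s (hd (tag b))
  else dart (branch_next b) = s (dart b).
Proof.
have vd := tlt b; have kp := klt b.
have kp' : (tagged b).+1 <= size (behead (nth [::] d (tag b))) by [].
have := star_step vd kp'; rewrite [in LHS](nd vd) /= -/(dart b) nth_rcons => sb.
rewrite /branch_next /dart /= -/(dart b).
case: eqP => [kl|/eqP kl].
  move: sb; rewrite kl ltnn eqxx => ->; split=> //.
  rewrite s_hd //; last by case: (behead _) kp.
  by rewrite ssz modnn.
rewrite -/(dart b) sb.
have lt : (tagged b).+1 < size (behead (nth [::] d (tag b))).
  by rewrite ltn_neqAle kl.
by rewrite lt modn_small //; apply: leq_trans lt _; rewrite -ssz.
Qed.

Section Equivalence.
Variables (a : {perm T}) (g : {ffun B -> B}).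
Hypotheses (ma : matching col d a) (ga : forall b, dart (g b) = a (dart b)).

Lemma matching_is_gluing : is_gluing g.
Proof.
have [aK aL aC] := matchingP _ _ _ ma.
apply/forallP => b; apply/and3P; split.
- by rewrite -(inj_eq dart_inj) ga aL dart_letters.
- by rewrite -(inj_eq dart_inj) !ga aK.
- by rewrite !branch_colorE ga aC.
Qed.

Lemma ix_nth v x : v < size d -> x \in nth [::] d v -> find (fun c => x \in c) d = v.
Proof.
move=> vd xv; apply: (@uniq_flatten_nth d _ _ x ud) => //.
  by rewrite -has_find; apply/hasP; exists (nth [::] d v); rewrite ?mem_nth.
apply: (@nth_find _ [::] (fun c => x \in c)).
by apply/hasP; exists (nth [::] d v); rewrite ?mem_nth.
Qed.

Lemma hd_mem v : v < size d -> hd v \in nth [::] d v.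
Proof. by move=> vd; rewrite (nd vd) in_cons eqxx. Qed.

Lemma hd_flatten v : v < size d -> hd v \in flatten d.
Proof.
by move=> vd; apply/flattenP; exists (nth [::] d v); rewrite ?mem_nth ?hd_mem.
Qed.

Lemma conn_hd v x : v < size d -> x \in nth [::] d v -> conn s a (hd v) x.
Proof.
by move=> vd xv; apply: (star_conn _ sd (mem_nth [::] vd)); rewrite ?hd_mem.
Qed.

Lemma star_adj_conn v v' : connect (star_adj g) v v' -> conn s a (hd v) (hd v').
Proof.
move=> /connectP[p + ->]; elim: p v => [|w p IH] v /=; first by rewrite conn0.
case/andP=> /existsP[b /andP[/eqP bv /eqP bw]] /IH; apply: conn_trans.
apply: (conn_trans (y := dart b)); first by apply: conn_hd; rewrite -?ssl // -bv dart_star.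
apply: (conn_trans (y := dart (g b))); first by rewrite ga conn2.
rewrite conn_sym; apply: conn_hd; rewrite -?ssl // -bw; exact: dart_star.
Qed.

(** Darts are projected to the index of their star: [s] stays in one star and [a] crosses an
    adjacency, so a chain of darts becomes a chain of stars. *)
Lemma conn_star_adj (v0 v v' : 'I_(size sl)) :
  conn s a (hd v) (hd v') -> connect (star_adj g) v v'.
Proof.
(* The default [v] concerns only the darts that lie on no star. *)
pose J x : 'I_(size sl) := insubd v (find (fun c => x \in c) d).
have JE (w : 'I_(size sl)) x : x \in nth [::] d w -> J x = w.
  move=> xw; apply: val_inj; have wd : w < size d by rewrite -ssl.
  by rewrite /J (ix_nth wd xw) val_insubd ltn_ord.
pose r x y := (x \in flatten d) ==> (y \in flatten d) && connect (star_adj g) (J x) (J y).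
have st (w : 'I_(size sl)) : hd w \in nth [::] d w by apply: hd_mem; rewrite -ssl.
move=> h; suff : r (hd v) (hd v').
  rewrite /r hd_flatten -?ssl //= => /andP[_].
  by rewrite (JE v _ (st v)) (JE v' _ (st v')).
have fl x : x \in flatten d -> exists w : 'I_(size sl), x \in nth [::] d w.
  case/flattenP => c cd xc; have vd : index c d < size sl by rewrite ssl index_mem.
  by exists (Ordinal vd); rewrite /= nth_index.
apply: conn_min h; rewrite /r.
- by move=> x; rewrite connect0 andbT implybb.
- move=> x y z /implyP h1 /implyP h2; apply/implyP => /h1 /andP[/h2/andP[-> h4] h3].
  exact: connect_trans h3 h4.
- move=> x; apply/implyP => xd; have [w xw] := fl x xd.
  have wd : w < size d by rewrite -ssl.
  have sw : s x \in nth [::] d w by apply: star_closed sd (mem_nth [::] wd) xw.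
  rewrite (JE w _ xw) (JE w _ sw) connect0 andbT.
  by apply/flattenP; exists (nth [::] d w); rewrite ?mem_nth.
- move=> x; apply/implyP => xd; rewrite (matching_closed ma) //=.
  have [/letters_dart[b ->]|xl] := boolP (x \in letters d); last first.
    by rewrite (matching_fix ma xl) connect0.
  rewrite -ga (JE _ _ (dart_star b)) (JE _ _ (dart_star (g b))).
  by apply: connect1; apply/existsP; exists b; rewrite !eqxx.
Qed.

Lemma gluing_connectedE : d != [::] -> gluing_connected g = conn_on s a d.
Proof.
move=> dn; have v0 : 'I_(size sl).
  by rewrite ssl; case: d dn => // c d' _; exact: ord0.
apply/forallP/forallP => [h x|h v].
  apply/implyP => xd; apply/forallP => y; apply/implyP => yd.
  have fl z : z \in flatten d -> exists w : 'I_(size sl), conn s a (hd w) z.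
    case/flattenP => c cd zc; have vd : index c d < size sl by rewrite ssl index_mem.
    by exists (Ordinal vd); apply: conn_hd; rewrite /= -?ssl // nth_index.
  have [w xw] := fl x xd; have [w' yw] := fl y yd.
  apply: conn_trans yw; rewrite conn_sym; apply: conn_trans xw.
  by rewrite conn_sym; apply: star_adj_conn; move/forallP: (h w); apply.
apply/forallP => v'; apply: conn_star_adj => //.
have := h (hd v); rewrite hd_flatten -?ssl //= => /forallP/(_ (hd v')).
by rewrite hd_flatten -?ssl.
Qed.

End Equivalence.

Let D := [set x in flatten d].

Lemma uniq_heads (d' : seq (seq T)) : uniq (flatten d') -> [::] \notin d' ->
  uniq (map (head x0) d').
Proof.
elim: d' => //= c d' IH; rewrite cat_uniq in_cons negb_or => /and3P[_ h u] /andP[cn nd'].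
rewrite IH // andbT; apply: contra h => /mapP[c' cd' e]; apply/hasP; exists (head x0 c').
  apply/flattenP; exists c' => //; case: c' cd' {e} => [|z c'] /=; last by rewrite in_cons eqxx.
  by rewrite (negPf nd').
by rewrite -e; case: c cn {e} => //= z c _; rewrite in_cons eqxx.
Qed.

Lemma porbit_star v x : v < size d -> x \in nth [::] d v -> x \in porbit s (hd v).
Proof.
move=> vd xv; have [_ _ h _] := sd.
have := fconnect_cycle (h _ (mem_nth [::] vd)) (hd_mem vd) x; rewrite xv.
by move=> /iter_findex <-; apply/porbitP; exists (findex s (hd v) x); rewrite permX.
Qed.

Lemma in_flatten x : x \in flatten d -> exists2 v, v < size d & x \in nth [::] d v.
Proof. by case/flattenP => c cd xc; exists (index c d); rewrite ?index_mem ?nth_index. Qed.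

(** The cycles are represented by the darts off the stars and by the head of each star. *)
Lemma verts_count : (#|porbits s| = #|~: D| + size d)%N.
Proof.
pose H := [set x in map (head x0) d].
have HE x : x \in H -> exists2 v, v < size d & x = hd v.
  rewrite inE => /mapP[c cd ->]; exists (index c d); rewrite ?index_mem //.
  by rewrite /hd nth_index.
have HI v : v < size d -> hd v \in H by move=> vd; rewrite inE; apply/map_f/mem_nth.
have -> : size d = #|H|.
  rewrite cardsE (card_uniqP _) ?size_map //; apply: uniq_heads => //.
  by case: sd.
rewrite (@porbits_transversal _ _ (~: D :|: H)).
- rewrite cardsU (_ : _ :&: _ = set0) ?cards0 ?subn0 //.
  apply/setP => x; rewrite !inE; apply/negP => /andP[xd xH].
  have [|v vd e] := HE x; first by rewrite inE.
  by move: xd; rewrite e hd_flatten.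
- move=> x; have [xd|xd] := boolP (x \in flatten d); last first.
    by exists x; rewrite ?porbit_id // !inE xd.
  have [v vd xv] := in_flatten xd; exists (hd v); first by rewrite inE HI ?orbT.
  by rewrite porbit_sym porbit_star.
- move=> x y; rewrite !in_setU !in_setC !in_set.
  have fx z : z \notin flatten d -> s z = z by case: sd => _ _ _; apply.
  move=> /orP[xd|xH] /orP[yd|yH] xy.
  + by rewrite (porbit_fix (fx x xd) xy).
  + by rewrite (porbit_fix (fx x xd) xy).
  + by rewrite porbit_sym in xy; rewrite (porbit_fix (fx y yd) xy).
  + have [|v vd ex] := HE x; first by rewrite inE.
    have [|w wd ey] := HE y; first by rewrite inE.
    have yv : y \in nth [::] d v.
      case/porbitP: xy => i ->; rewrite permX ex; elim: i => [|i IH] /=.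
        exact: hd_mem.
      exact: star_closed sd (mem_nth _ vd) IH.
    rewrite ex ey; congr hd; apply: (@uniq_flatten_nth d _ _ y) => //.
    by rewrite ey hd_mem.
Qed.

Lemma comps_count (a : {perm T}) : matching col d a -> d != [::] ->
  conn_on s a d -> nclass (conn s a) = (#|~: D|).+1.
Proof.
move=> ma dn /forallP co; have v0 : 0 < size d by case: d dn.
have con x y : x \in flatten d -> y \in flatten d -> conn s a x y.
  by move=> xd yd; have := co x; rewrite xd => /forallP/(_ y); rewrite yd.
rewrite (@nclass_transversal _ _ (hd 0 |: ~: D)).
- by rewrite cardsU1 !inE hd_flatten.
- exact: conn_eqv.
- move=> x; have [xd|xd] := boolP (x \in flatten d); last first.
    by exists x; rewrite ?conn0 // !inE xd orbT.
  by exists (hd 0); rewrite ?setU11 // con // hd_flatten.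
- have fx x y : x \notin flatten d -> conn s a x y -> x = y.
    move=> xd; rewrite conn_fixed; first by move/eqP.
      by case: sd => _ _ _; apply.
    by apply: (matching_fix ma); apply: contra xd; apply: letters_sub.
  move=> x y; rewrite !in_setU1 !in_setC !in_set => /predU1P[->|xd] /predU1P[->|yd] xy //.
  + by rewrite conn_sym in xy; rewrite (fx _ _ yd xy).
  + exact: fx xy.
  + exact: fx xy.
Qed.

Section Faces.
Variables (a : {perm T}) (g : {ffun B -> B}).
Hypotheses (ma : matching col d a) (ga : forall b, dart (g b) = a (dart b)).
Let f : B -> B := @branch_next m sl \o g.
Let phi := (a * s).

(** A face step on branches is one step of [phi], or two when [phi] first lands on a marked dart,
    which [a] fixes. *)
Lemma face_step b : dart (f b) = phi (dart b) \/
  dart (f b) = phi (phi (dart b)) /\ phi (dart b) \notin letters d.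
Proof.
have := branch_next_dart (g b); rewrite /f /phi /= !permM -ga.
case: eqP => _; last by left.
move=> [-> ->]; right; have h := hd_notin_letters (tlt (g b)).
by rewrite (matching_fix ma h).
Qed.

Lemma face_inj : injective f.
Proof.
move=> b b' e; apply: dart_inj.
have [h|[h n]] := face_step b; have [h'|[h' n']] := face_step b'.
- by apply: (@perm_inj _ phi); rewrite -h -h' e.
- by case/negP: n'; rewrite -(@perm_inj _ phi (dart b) (phi (dart b'))) ?dart_letters // -h -h' e.
- by case/negP: n; rewrite (@perm_inj _ phi (phi (dart b)) (dart b')) ?dart_letters // -h -h' e.
- by apply: (@perm_inj _ phi); apply: (@perm_inj _ phi); rewrite -h -h' e.
Qed.

Lemma face_fwd b b' : fconnect f b b' -> dart b' \in porbit phi (dart b).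
Proof.
move=> /iter_findex <-; elim: (findex _ _ _) => [|i IH] /=; first exact: porbit_id.
have st z : z \in porbit phi (dart b) -> phi z \in porbit phi (dart b).
  by rewrite -!eq_porbit_mem => /eqP <-; rewrite eq_porbit_mem (mem_porbit phi 1).
have [->|[-> _]] := face_step (iter i f b); first exact: st.
by apply/st/st.
Qed.

(** Strong induction on the number of steps of [phi], since a step on branches consumes one or two
    of them. *)
Lemma face_bwd b b' : dart b' \in porbit phi (dart b) -> fconnect f b b'.
Proof.
case/porbitP=> i; rewrite permX; have [k] := ubnP i.
elim: k i b => // k IH [|i] b; rewrite ltnS => ik e.
  by rewrite (dart_inj e) connect0.
apply: (connect_trans (fconnect1 f b)).
have [h|[h n]] := face_step b.
  by apply: (IH i) => //; rewrite h -iterSr.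
(* A walk that ends on a branch cannot stop at the marked dart just reached. *)
case: i ik e => [|i] ik e.
  by case/negP: n; move: e => /= <-; exact: dart_letters.
by apply: (IH i); [exact: ltnW|rewrite h -!iterSr].
Qed.

(** Three kinds of representatives: the darts off the stars, the heads of stars without branches,
    which match the extra term of [nb_faces], and one root per face of [g]. The head of a star with
    branches is on the same cycle as its first branch. *)
Lemma faces_count : (#|porbits phi| = #|~: D| + nb_faces g)%N.
Proof.
pose I := [set x in map (head x0) [seq c <- d | nilp (behead c)]].
pose Rt := [set dart b | b in froots f].
have fs : connect_sym (frel f) by apply: fconnect_sym; apply: face_inj.
have IE x : x \in I -> exists2 v, v < size d & x = hd v /\ nilp (behead (nth [::] d v)).
  rewrite inE => /mapP[c]; rewrite mem_filter => /andP[n cd] ->.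
  by exists (index c d); rewrite ?index_mem // /hd nth_index.
have -> : nb_faces g = (#|I| + #|Rt|)%N.
  rewrite /nb_faces addnC; congr (_ + _)%N; last first.
    rewrite card_imset; last exact: dart_inj.
    by apply: eq_card => x; rewrite !inE andbT.
  rewrite cardsE (card_uniqP _) ?size_map; last first.
    apply: (subseq_uniq (map_subseq _ (filter_subseq _ _))); apply: uniq_heads => //.
    by case: sd.
  by rewrite size_filter count_map; apply: eq_count => c; rewrite /= /nilp size_map.
have RI x : x \in Rt -> x \in letters d by case/imsetP => b _ ->; apply: dart_letters.
have ID x : x \in I -> x \in D.
  by move=> /IE[v vd [-> _]]; rewrite inE hd_flatten.
have IL x : x \in I -> x \notin letters d.
  by move=> /IE[v vd [-> _]]; apply: hd_notin_letters.
have out x : x \notin D -> phi x = x.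
  rewrite inE => xd; rewrite permM (matching_fix ma); last first.
    by apply: contra xd; apply: letters_sub.
  by case: sd => _ _ _; apply.
have fixI x : x \in I -> phi x = x.
  move=> xI; rewrite permM (matching_fix ma (IL x xI)).
  have [v vd [-> n]] := IE x xI; have := star_step vd (leq0n _).
  by rewrite {1}(nd vd) /= -/(hd v) (nilP n).
rewrite (@porbits_transversal _ _ (~: D :|: (I :|: Rt))).
- rewrite cardsU (_ : _ :&: _ = set0) ?cards0 ?subn0.
    rewrite cardsU (_ : _ :&: _ = set0) ?cards0 ?subn0 //.
    apply/setP => x; rewrite !in_setI in_set0; apply/negP => /andP[/IL/negP h /RI].
    exact: h.
  apply/setP => x; rewrite !in_setI in_setU in_setC in_set0.
  apply/negP => /andP[/negP xd /orP[/ID//|/RI/letters_sub h]].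
  by apply: xd; rewrite inE.
- move=> x; have [xd|xd] := boolP (x \in D); last first.
    by exists x; rewrite ?porbit_id // !in_setU in_setC xd.
  have cov b : exists2 y, y \in ~: D :|: (I :|: Rt) & y \in porbit phi (dart b).
    exists (dart (froot f b)); last by apply: face_fwd; apply: connect_root.
    rewrite !in_setU [_ \in Rt]imset_f ?orbT //; exact: roots_root.
  have [/letters_dart[b ->]|xl] := boolP (x \in letters d); first exact: cov.
  move: (xd); rewrite inE => /in_flatten[v vd].
  rewrite (nd vd) in_cons => /predU1P[e|xb]; last first.
    by case/negP: xl; apply/flattenP; exists (behead (nth [::] d v)) => //; apply/map_f/mem_nth.
  have [n|n] := boolP (nilp (behead (nth [::] d v))).
    exists x; rewrite ?porbit_id // !in_setU [_ \in I]inE e map_f ?orbT //.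
    by rewrite mem_filter n mem_nth.
  have e' : phi x = nth x0 (behead (nth [::] d v)) 0.
    by rewrite permM (matching_fix ma xl) e s_hd //; apply: contra n => /eqP ->.
  have /letters_dart[b eb] : phi x \in letters d.
    rewrite e'; apply/flattenP; exists (behead (nth [::] d v)); first exact/map_f/mem_nth.
    by apply: mem_nth; rewrite lt0n.
  have [y yA yb] := cov b; exists y => //.
  suff -> : porbit phi x = porbit phi (dart b) by [].
  by rewrite -eb; apply/eqP; rewrite eq_sym eq_porbit_mem (mem_porbit phi 1).
- have key x y : x \notin D \/ x \in I -> y \in porbit phi x -> x = y.
    by case=> [/out|/fixI] px /(porbit_fix px).
  move=> x y; rewrite !in_setU !in_setC => /orP[xd|/orP[xI|xR]].
  + by move=> _; apply: key; left.
  + by move=> _; apply: key; right.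
  move=> /orP[yd|/orP[yI|yR]]; rewrite porbit_sym.
  + by move=> h; rewrite (key _ _ _ h) //; left.
  + by move=> h; rewrite (key _ _ _ h) //; right.
  case/imsetP: xR => b rb ->; case/imsetP: yR => b' rb' ->.
  move=> /face_bwd; rewrite fs => /(rootP fs).
  by rewrite (eqP rb) (eqP rb') => ->.
Qed.

(** The darts off the stars contribute equally to both sides, and the cycles of [a] number [#|T|]
    minus half the branches; Euler's relation is what remains. *)
Lemma euler_planarE : d != [::] -> conn_on s a d -> euler_planar g = planar s a.
Proof.
move=> dn co; rewrite /euler_planar /planar ssl verts_count faces_count.
rewrite (comps_count ma dn co) card_branch.
have [aK aL _] := matchingP _ _ _ ma.
have := porbits_involution aK.
have -> : [set x | a x != x] = [set x in letters d] by apply/setP => x; rewrite !inE aL.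
by lia.
Qed.

End Faces.
End Bridge.

Section Bridge2.
Local Open Scope group_scope.
Variables (m : nat) (T : finType) (col : T -> 'I_m).

Lemma nbmapsE (s : {perm T}) (d : seq (seq T)) : stars s d -> d != [::] ->
  nbmaps col s d = nb_planar_maps (map (star_word col) d).
Proof.
move=> sd dn.
have x0 : T.
  case: d sd dn => // c d' [_ + _ _] _; rewrite in_cons negb_or => /andP[+ _].
  by case: c => // x c _; exact: x.
set sl := map _ d; pose B := branch sl; pose dart := @dart m T col d x0 : B -> T.
(* The default [b] is never taken for a matching, which sends branches to branches. *)
pose F (a : {perm T}) : {ffun B -> B} :=
  [ffun b => odflt b [pick b' | dart b' == a (dart b)]].
have FE a : matching col d a -> forall b, dart (F a b) = a (dart b).
  move=> ma b; rewrite ffunE; case: pickP => [b' /eqP //|].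
  have [|b' e] := @letters_dart m T col d x0 (a (dart b)).
    by rewrite (matching_letters _ ma) dart_letters.
  by move/(_ b'); rewrite -/dart in e; rewrite e eqxx.
have dinj : injective dart by apply: dart_inj sd _.
have props a (g : {ffun B -> B}) : matching col d a -> (forall b, dart (g b) = a (dart b)) ->
    [&& is_gluing g, gluing_connected g & euler_planar g]
    = [&& matching col d a, conn_on s a d & planar s a].
  move=> ma ga; rewrite (matching_is_gluing sd ma ga) ma /=.
  rewrite (gluing_connectedE sd ma ga dn); case co : (conn_on s a d) => //=.
  exact: (euler_planarE sd ma ga dn co).
rewrite /nbmaps /nb_planar_maps -(@card_in_imset _ _ F); last first.
  move=> a a'; rewrite !inE => /and3P[ma _ _] /and3P[ma' _ _] e.
  apply/permP => x; have [xl|xl] := boolP (x \in letters d); last first.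
    by rewrite (matching_fix ma xl) (matching_fix ma' xl).
  by have [b ->] := @letters_dart m T col d x0 x xl; rewrite -!FE // e.
(* The set counted by [nb_planar_maps] is a classical one, with membership a reflected
   proposition. *)
apply: eq_card => g; rewrite [RHS]inE /classical_sets.mkset boolp.asboolb.
apply/imsetP/idP => [[a]|hg].
  rewrite inE => h ->; have /and3P[ma _ _] := h.
  by have := props a (F a) ma (FE a ma); rewrite h => ->.
have /and3P[/forallP gl _ _] := hg.
have gK b : g (g b) = b by have /and3P[_ /eqP] := gl b.
(* Conversely, a gluing is extended by the identity to the darts that carry no branch. *)
pose f x := if [pick b | dart b == x] is Some b then dart (g b) else x.
have fE b : f (dart b) = dart (g b).
  by rewrite /f; case: pickP => [b' /eqP/dinj -> //|/(_ b)]; rewrite eqxx.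
have fN x : x \notin letters d -> f x = x.
  rewrite /f; case: pickP => // b /eqP <-; by rewrite dart_letters.
have lP x : x \in letters d -> exists b, x = dart b by apply: letters_dart.
have fK : involutive f.
  move=> x; have [/lP[b ->]|xl] := boolP (x \in letters d); last by rewrite !fN.
  by rewrite !fE gK.
pose a := perm (inv_inj fK).
have ga b : dart (g b) = a (dart b) by rewrite permE fE.
have ma : matching col d a.
  apply/matchingP; split=> x; rewrite ?permE //.
    have [xl|xl] := boolP (x \in letters d); last by rewrite fN // eqxx.
    have [b ->] := lP x xl; rewrite fE (inj_eq dinj).
    by have /and3P[] := gl b.
  have [/lP[b ->]|xl] := boolP (x \in letters d); last by rewrite fN.
  rewrite fE -!(@branch_colorE m T col d x0).
  by have /and3P[_ _ /eqP] := gl b.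
exists a; first by have := props a g ma ga; rewrite hg inE => <-.
by apply/ffunP => b; apply: dinj; rewrite FE.
Qed.

End Bridge2.

(** * Removing an edge *)

Section Moves.
Local Open Scope group_scope.
Variables (T : finType) (C : eqType) (col : T -> C).
Implicit Types (s a : {perm T}) (x y z : T) (d r : seq (seq T)) (c : seq T).

Lemma fpath_switch (f g : T -> T) x x' p y : g x' = f x -> {in p, g =1 f} ->
  fpath f x (rcons p y) -> fpath g x' (rcons p y).
Proof.
have aux : forall q u, {in u :: q, g =1 f} -> fpath f u (rcons q y) ->
    fpath g u (rcons q y).
  elim=> [|v q IH] u h /= /andP[h1 h2]; rewrite h ?in_cons ?eqxx // h1 //=.
  by apply: IH h2 => z zp; apply: h; rewrite in_cons zp orbT.
by case: p => [|u q] e h /=; rewrite e // => /andP[-> /(aux q u h)].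
Qed.

Lemma fcycle_cons (f : T -> T) x p : fcycle f (x :: p) = fpath f x (rcons p x).
Proof. by []. Qed.

Lemma fpath_split (f : T -> T) x p1 y p2 z :
  fpath f x (rcons (p1 ++ y :: p2) z) =
  fpath f x (rcons p1 y) && fpath f y (rcons p2 z).
Proof. by rewrite rcons_cat /= -cat_rcons cat_path last_rcons. Qed.

Lemma star_porbit s d c x y : stars s d -> c \in d -> x \in c ->
  (y \in porbit s x) = (y \in c).
Proof.
move=> sd cd xc; have [_ _ h _] := sd; apply/idP/idP => [/porbitP[i ->]|yc].
  by rewrite permX; elim: i => //= i IH; apply: star_closed sd cd IH.
have := fconnect_cycle (h _ cd) xc y; rewrite yc => /iter_findex <-.
by apply/porbitP; exists (findex s x y); rewrite permX.
Qed.

(** Local surgery: only the darts of [d0] have to be examined, and those that [d1] leaves out must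
    become fixed points. *)
Lemma stars_replace s s' d0 d1 r : stars s (d0 ++ r) -> uniq (flatten d1) ->
  {subset flatten d1 <= flatten d0} -> [::] \notin d1 ->
  {in d1, forall c, fcycle s' c} -> (forall x, x \notin flatten d0 -> s' x = s x) ->
  (forall x, x \in flatten d0 -> x \notin flatten d1 -> s' x = x) -> stars s' (d1 ++ r).
Proof.
move=> [u n cyc out] u1 sub n1 cyc1 e0 e1.
have := u; rewrite flatten_cat cat_uniq => /and3P[_ /hasPn dis ur]; split.
- rewrite flatten_cat cat_uniq u1 ur andbT; apply/hasPn => z /dis; apply: contra.
  exact: sub.
- by move: n; rewrite !mem_cat !negb_or n1 => /andP[].
- move=> c; rewrite mem_cat => /orP[/cyc1 //|cr].
  rewrite (@eq_in_cycle _ (mem c) _ (frel s)); last by apply/allP.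
    by apply: cyc; rewrite mem_cat cr orbT.
  move=> z w zc _ /=; rewrite e0 //; apply: dis; apply/flattenP; by exists c.
- move=> x; rewrite flatten_cat mem_cat negb_or => /andP[x1 xr].
  have [x0|x0] := boolP (x \in flatten d0); first exact: e1.
  by rewrite e0 // out // flatten_cat mem_cat negb_or x0.
Qed.

Definition genus0_on s d a := conn_on s a d && planar s a.

Lemma conn_onP s d a :
  reflect {in flatten d &, forall x y, conn s a x y} (conn_on s a d).
Proof.
apply: (iffP forallP) => [h x y xd yd|h x].
  by have := h x; rewrite xd => /forallP/(_ y); rewrite yd.
by apply/implyP => xd; apply/forallP => y; apply/implyP => yd; apply: h.
Qed.

(** The transposition of [x] with its predecessor takes [x] out of its cycle: this realizes the
    deletion of one letter. The remaining darts stay connected as before because an unglued [x] was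
    attached to them only through its star. *)
Lemma stars_splice s h q1 x q2 r : stars s ((h :: q1 ++ x :: q2) :: r) ->
  let y := last h q1 in let s' := tperm x y * s in
  [/\ s y = x, y != x, stars s' ((h :: q1 ++ q2) :: r) &
   forall a, a x = x -> planar s a = planar s' a /\
     genus0_on s ((h :: q1 ++ x :: q2) :: r) a = genus0_on s' ((h :: q1 ++ q2) :: r) a].
Proof.
move=> sd y s'; have [u n cyc out] := sd; set c := h :: q1 ++ x :: q2.
have cd : c \in c :: r by rewrite in_cons eqxx.
have uc : uniq c by have : uniq (c ++ flatten r) := u; rewrite cat_uniq => /and3P[].
have xc : x \in c by rewrite in_cons mem_cat in_cons eqxx !orbT.
have := cyc c cd; rewrite fcycle_cons fpath_split => /andP[cyc1 cyc2].
have sy : s y = x by move: cyc1; rewrite rcons_path => /andP[_ /eqP].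
have yq : y \in h :: q1 by apply: mem_last.
have xq : x \notin h :: q1.
  by move: uc; rewrite -[c]/((h :: q1) ++ x :: q2) cat_uniq /= negb_or => /and3P[_ /andP[]].
have yx : y != x by apply: contraNneq xq => <-.
have xq2 : x \notin q2.
  by move: uc; rewrite -[c]/((h :: q1) ++ x :: q2) cat_uniq /= => /and3P[_ _ /andP[]].
have pf : perm_eq (x :: flatten ((h :: q1 ++ q2) :: r)) (flatten (c :: r)).
  rewrite -[x :: _]/((x :: h :: q1 ++ q2) ++ flatten r).
  rewrite -[flatten (c :: r)]/(c ++ flatten r) perm_cat2r perm_sym.
  by rewrite -[c]/((h :: q1) ++ [:: x] ++ q2) perm_catCA; apply: perm_refl.
have mf z : z \in flatten ((h :: q1 ++ q2) :: r) -> z \in flatten (c :: r) /\ z != x.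
  move=> zf; split; first by rewrite -(perm_mem pf) in_cons zf orbT.
  apply: contraTneq zf => ->.
  by move: u; rewrite -(perm_uniq pf) => /andP[].
have s'E z : s' z = if z == x then x else if z == y then s x else s z.
  exact: spliceE.
have sdc : stars s ([:: c] ++ r) by [].
split=> //.
  apply: (stars_replace (d1 := [:: h :: q1 ++ q2]) sdc).
  - have : uniq ((h :: q1) ++ [:: x] ++ q2) by [].
    by rewrite uniq_catCA /= cats0 => /andP[].
  - move=> z; rewrite /= !cats0 !(in_cons, mem_cat).
    by case/or3P=> ->; rewrite ?orbT.
  - by [].
  - move=> c'; rewrite mem_seq1 => /eqP ->.
    have nx z : z \in h :: q1 -> z != x by move=> zq; apply: contraNneq xq => <-.
    rewrite fcycle_cons rcons_cat cat_path -/y; apply/andP; split; last first.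
      apply: fpath_switch cyc2; first by rewrite s'E (negPf yx) eqxx.
      move=> z zq; have zx : z != x by apply: contraNneq xq2 => <-.
      rewrite s'E (negPf zx) ifN //; apply: contraTneq zq => ->.
      move: uc; rewrite -[c]/((h :: q1) ++ x :: q2) cat_uniq => /and3P[_ /hasPn hn _].
      by apply/negP => yq2; have := hn y; rewrite /= in_cons yq2 orbT yq => /(_ isT).
    have : q1 = [::] \/ exists q, q1 = rcons q y.
      rewrite /y; case/lastP: (q1) => [|q v]; first by left.
      by right; exists q; rewrite last_rcons.
    move=> [-> //|[q qE]].
    have uq : uniq (rcons (h :: q) y).
      by move: uc; rewrite -[c]/((h :: q1) ++ x :: q2) cat_uniq qE => /andP[].
    have ny z : z \in h :: q -> s' z = s z.
      move=> zq; rewrite s'E ifN ?ifN //.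
        by apply: contraTneq zq => ->; move: uq; rewrite rcons_uniq => /andP[].
      by apply: nx; rewrite qE in_cons mem_rcons !in_cons orbCA -in_cons zq orbT.
    have : fpath s h q1 by move: cyc1; rewrite rcons_path => /andP[].
    rewrite qE; apply: fpath_switch; first by rewrite ny ?in_cons ?eqxx.
    by move=> z zq; rewrite ny // in_cons zq orbT.
  - move=> z; rewrite /= cats0 => zc; rewrite s'E !ifN //.
      by apply: contraNneq zc => ->; rewrite -[_ :: _]/((h :: q1) ++ x :: q2) mem_cat yq.
    by apply: contraNneq zc => ->.
  - move=> z; rewrite /= !cats0 s'E; have [-> //|zx] := eqVneq z x.
    by rewrite !(in_cons, mem_cat) (negPf zx) /= => ->.
move=> a ax; have pl := planar_splice ax sy yx; split; first exact: pl.
rewrite /genus0_on -pl; congr (_ && _); apply/conn_onP/conn_onP => co z w zf wf.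
  have [zc zx] := mf z zf; have [wc wx] := mf w wf.
  by rewrite -(splice_conn ax sy yx zx wx); apply: co.
have hx z' : z' \in flatten (c :: r) -> z' != x -> z' \in flatten ((h :: q1 ++ q2) :: r).
  by rewrite -(perm_mem pf) in_cons => /orP[/eqP -> |//]; rewrite eqxx.
have hc : h \in c by rewrite in_cons eqxx.
have hx' : h != x by apply: contraNneq xq => <-; rewrite in_cons eqxx.
have xh : conn s a x h by apply: (star_conn _ sd cd).
have hf : h \in flatten ((h :: q1 ++ q2) :: r) by rewrite /= in_cons eqxx.
have ch z' : z' \in flatten (c :: r) -> conn s a h z'.
  move=> zc; have [->|zx] := eqVneq z' x; first by rewrite conn_sym.
  rewrite (splice_conn ax sy yx) //; apply: co => //; exact: hx.
by apply: (conn_trans (y := h)); [rewrite conn_sym|]; apply: ch.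
Qed.

(** The bijection is multiplication by the transposition, undone by a second multiplication. The
    predicate [Q] is left arbitrary so as to carry the connectivity and genus conditions of either
    case. *)
Lemma card_unlink d d' b0 b1 (Q : pred {perm T}) : b0 != b1 ->
  col b1 = col b0 -> b0 \in letters d -> b1 \in letters d ->
  (forall x, (x \in letters d') = [&& x \in letters d, x != b0 & x != b1]) ->
  #|[set a | [&& matching col d a, a b0 == b1 & Q (a * tperm b0 b1)]]|
  = #|[set a | matching col d' a && Q a]|.
Proof.
move=> b01 cb l0 l1 lE; set t := tperm b0 b1.
rewrite -(@card_imset _ _ (fun a => a * t)); last exact: mulIg.
congr #|pred_of_set _|; apply/setP => a'; rewrite [RHS]inE.
apply/imsetP/andP => [[a]|[m q]].
  rewrite inE => /and3P[m /eqP ab q] ->; split=> //.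
  have [aK aL aC] := matchingP _ _ _ m.
  apply/matchingP; split=> [|x|x]; first exact: unlink_inv.
    rewrite (unlinkE aK ab) lE.
    case: (eqVneq x b0) => [_|_] /=; first by rewrite eqxx andbF.
    by case: (eqVneq x b1) => [_|_] /=; rewrite ?eqxx ?andbF ?andbT.
  by rewrite (unlinkE aK ab); case: ifP.
have [aK aL aC] := matchingP _ _ _ m.
have f0 : a' b0 = b0 by apply: (matching_fix m); rewrite lE eqxx andbF.
have f1 : a' b1 = b1 by apply: (matching_fix m); rewrite lE eqxx !andbF.
have aE x : (a' * t) x = if x == b0 then b1 else if x == b1 then b0 else a' x.
  rewrite permM; case: (eqVneq x b0) => [->|x0]; first by rewrite f0 tpermL.
  case: (eqVneq x b1) => [->|x1]; first by rewrite f1 tpermR.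
  apply: tpermD; rewrite eq_sym; first by rewrite -[X in _ != X]f0 (inj_eq perm_inj).
  by rewrite -[X in _ != X]f1 (inj_eq perm_inj).
have tt : a' * t * t = a' by rewrite -mulgA tperm2 mulg1.
exists (a' * t) => //; rewrite inE -/t tt q aE eqxx eqxx !andbT.
apply/matchingP; split=> x; rewrite !aE.
- case: (eqVneq x b0) => [->|x0]; first by rewrite eq_sym (negPf b01) eqxx.
  case: (eqVneq x b1) => [->|x1]; first by rewrite eqxx.
  rewrite ifN ?ifN ?aK //; first by rewrite -[X in _ != X]f1 (inj_eq perm_inj).
  by rewrite -[X in _ != X]f0 (inj_eq perm_inj).
- case: (eqVneq x b0) => [->|x0]; first by rewrite eq_sym b01 l0.
  case: (eqVneq x b1) => [->|x1]; first by rewrite b01 l1.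
  by rewrite aL lE x0 x1 !andbT.
- case: (eqVneq x b0) => [->|x0] //.
  by case: (eqVneq x b1) => [->|x1].
Qed.

Lemma tperm_off b0 b1 s z : z != b0 -> z != b1 -> (tperm b0 b1 * s) z = s z.
Proof. by move=> z0 z1; rewrite permM tpermD // eq_sym. Qed.

Lemma uniq_two x q y q' : uniq (x :: q ++ y :: q') ->
  [/\ x \notin q, x != y, x \notin q', y \notin q & y \notin q'].
Proof.
rewrite cons_uniq => /andP[xn]; rewrite cat_uniq => /and3P[_ /hasPn hn /andP[yn _]].
split=> //; try by apply: contraNN xn => xq; rewrite mem_cat ?in_cons xq ?orbT.
by apply/negP => yq; have := hn y (mem_head _ _); rewrite /= yq.
Qed.

(** The ends [b0] and [b1] exchange their successors, which cuts the star in two. No longer glued,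
    [b1] serves as the marked dart of the new star. *)
Lemma split_stars s h b0 p1 b1 p2 r : stars s ((h :: b0 :: p1 ++ b1 :: p2) :: r) ->
  stars (tperm b0 b1 * s) [:: h :: b0 :: p2, b1 :: p1 & r].
Proof.
move=> sd; have [u n cyc _] := sd; set c := h :: b0 :: _ in u n cyc.
have sdc : stars s ([:: c] ++ r) by [].
have uc : uniq c by move: u; rewrite -[flatten _]/(c ++ _) cat_uniq => /and3P[].
have pf : perm_eq (flatten [:: h :: b0 :: p2; b1 :: p1]) (flatten [:: c]).
  by rewrite /c /= !cats0; apply/seq.permP => q; rewrite /= !count_cat /=; lia.
have /andP[hc /uniq_two[b0p1 b0b1 b0p2 b1p1 b1p2]] := uc.
have [hb0 hb1] : h != b0 /\ h != b1.
  by split; apply: contraNneq hc => ->; rewrite ?(in_cons, mem_cat) eqxx ?orbT.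
have := cyc c (mem_head _ _); rewrite fcycle_cons /= => /andP[sh].
rewrite fpath_split => /andP[f1 f2].
apply: (stars_replace (d1 := [:: h :: b0 :: p2; b1 :: p1]) sdc) => //.
- by rewrite (perm_uniq pf) /= cats0.
- by move=> z; rewrite (perm_mem pf).
- move=> c'; rewrite in_cons mem_seq1 => /orP[/eqP ->|/eqP ->].
    rewrite fcycle_cons /= tperm_off // sh /=.
    apply: fpath_switch f2; first by rewrite permM tpermL.
    by move=> z zp; rewrite tperm_off //; [exact: (memPn b0p2)|exact: (memPn b1p2)].
  rewrite fcycle_cons; apply: fpath_switch f1; first by rewrite permM tpermR.
  by move=> z zp; rewrite tperm_off //; [exact: (memPn b0p1)|exact: (memPn b1p1)].
- move=> z; rewrite /= cats0 => zc.
  by rewrite tperm_off //; apply: contraNneq zc => ->; rewrite !(in_cons, mem_cat) eqxx !orbT.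
- by move=> z; rewrite (perm_mem pf) => ->.
Qed.

(** The same exchange of successors between two stars: after [b0] the second star is entered just
    behind [b1], run through up to [b1], and left towards the successor of [b0]. *)
Lemma merge_stars s h b0 p h2 q b1 q' r :
  stars s [:: h :: b0 :: p, h2 :: q ++ b1 :: q' & r] ->
  stars (tperm b0 b1 * s) ((h :: b0 :: q' ++ h2 :: q ++ b1 :: p) :: r).
Proof.
move=> sd; have [u n cyc _] := sd; set c := h :: b0 :: _ in u n cyc.
set c2 := h2 :: _ in u n cyc; set c' := h :: b0 :: q' ++ _.
have sdc : stars s ([:: c; c2] ++ r) by [].
have pf : perm_eq c' (c ++ c2).
  by apply/seq.permP => k; rewrite /c' /c /c2 /= !count_cat /= !count_cat /= ?count_cat /=; lia.
have ucc : uniq (c ++ c2).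
  by move: u; rewrite -[flatten _]/(c ++ c2 ++ _) catA cat_uniq => /and3P[].
have := ucc; rewrite cat_uniq => /and3P[uc /hasPn hn uc2].
have b0c2 : b0 \notin c2 by apply/negP => /hn /=; rewrite !in_cons eqxx orbT.
have : b1 \notin c by apply: hn; rewrite /c2 in_cons mem_cat mem_head !orbT.
rewrite /c !in_cons !negb_or => /and3P[b1h b1b0 b1p].
move: (b0c2); rewrite /c2 in_cons mem_cat in_cons !negb_or.
move=> /and4P[b0h2 b0q b0b1 b0q'].
have b0h : h != b0 by move: uc => /= /andP[+ _]; rewrite in_cons negb_or => /andP[].
have b0p : b0 \notin p by move: uc => /= /and3P[].
have [h2q h2b1 h2q' b1q b1q'] := uniq_two uc2.
have := cyc c (mem_head _ _); rewrite fcycle_cons /= => /andP[sh f1].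
have := cyc c2; rewrite !in_cons eqxx orbT => /(_ isT).
rewrite fcycle_cons fpath_split => /andP[f2 f3].
have fE : (flatten [:: c'] = c') * (flatten [:: c; c2] = c ++ c2).
  by rewrite /= !cats0.
apply: (stars_replace (d1 := [:: c']) sdc); rewrite ?fE //.
- by rewrite (perm_uniq pf).
- by move=> z; rewrite (perm_mem pf).
- move=> c0; rewrite mem_seq1 => /eqP ->.
  rewrite fcycle_cons /= tperm_off // ?sh /=; last by rewrite eq_sym.
  rewrite !fpath_split; apply/and3P; split=> //.
  + apply: fpath_switch f3; first by rewrite permM tpermL.
    by move=> z zp; rewrite tperm_off //; [exact: (memPn b0q')|exact: (memPn b1q')].
  + apply: fpath_switch f2; first by rewrite tperm_off // eq_sym.
    by move=> z zp; rewrite tperm_off //; [exact: (memPn b0q)|exact: (memPn b1q)].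
  + apply: fpath_switch f1; first by rewrite permM tpermR.
    by move=> z zp; rewrite tperm_off //; [exact: (memPn b0p)|exact: (memPn b1p)].
- move=> z zc; rewrite tperm_off //; apply: contraNneq zc => ->.
    by rewrite !(in_cons, mem_cat) eqxx !orbT.
  by rewrite !(in_cons, mem_cat) eqxx !orbT.
- by move=> z; rewrite (perm_mem pf) => ->.
Qed.

Lemma genus0_on_perm s d d' a : flatten d =i flatten d' ->
  genus0_on s d a = genus0_on s d' a.
Proof.
move=> e; rewrite /genus0_on; congr (_ && _).
by apply/conn_onP/conn_onP => h x y xd yd; apply: h; rewrite ?e // -?e.
Qed.

(** A planar loop separates, so connectedness turns into two components, one for each half of the
    root. Then [b0] is spliced out. *)
Lemma split_case s h b0 p1 b1 p2 r :
  let d' := [:: h :: p2, b1 :: p1 & r] in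
  stars s ((h :: b0 :: p1 ++ b1 :: p2) :: r) ->
  exists2 s', stars s' d' & forall a, involutive a -> a b0 = b1 ->
    let a' := a * tperm b0 b1 in
    genus0_on s ((h :: b0 :: p1 ++ b1 :: p2) :: r) a =
    [&& planar s' a', ~~ conn s' a' h b1 &
        [forall x in flatten d', conn s' a' h x || conn s' a' b1 x]].
Proof.
move=> d' sd; set c := h :: _ in sd *; set s1 := tperm b0 b1 * s.
have sd1 := split_stars sd; rewrite -/s1 in sd1.
have [sh hb0 sd' spl] := stars_splice (q1 := [::]) sd1; rewrite /= in sh hb0 sd'.
have [u _ _ _] := sd.
have /andP[hc /uniq_two[b0p1 b0b1 b0p2 b1p1 b1p2]] : uniq c.
  by have : uniq (c ++ flatten r) := u; rewrite cat_uniq => /and3P[].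
have hb1 : h != b1.
  by apply: contraNneq hc => ->; rewrite ?(in_cons, mem_cat) eqxx ?orbT.
have pf : perm_eq (b0 :: flatten d') (flatten (c :: r)).
  apply/seq.permP => q; rewrite /c /= !count_cat /= ?count_cat; lia.
have ud' : uniq (b0 :: flatten d') by rewrite (perm_uniq pf).
exists (tperm b0 h * s1) => // a aK ab a'.
have a'0 : a' b0 = b0 by rewrite /a' (unlinkE aK ab) eqxx.
have [ps _] := spl _ a'0.
rewrite /genus0_on (planar_unlink s aK ab b0b1) -/s1 -/a' -ps.
have cd : c \in c :: r by apply: mem_head.
have b0c : b0 \in c by rewrite /c !in_cons eqxx orbT.
have b1c : b1 \in c by rewrite /c !(in_cons, mem_cat) eqxx !orbT.
rewrite (star_porbit _ sd cd b1c) b0c /=.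
have scE := splice_conn a'0 sh hb0; rewrite /= in scE.
have c0h : conn s1 a' b0 h by rewrite conn_sym -[X in conn _ _ _ X]sh conn1.
have e01 : conn s1 a' b0 b1 = conn (tperm b0 h * s1) a' h b1.
  rewrite -scE // 1?eq_sym //; apply/idP/idP; apply: conn_trans => //.
  by rewrite conn_sym.
rewrite -e01 andbCA; congr (_ && _); rewrite andbC.
case c01 : (conn s1 a' b0 b1) => //=.
apply/conn_onP/forallP => [co x|co].
  apply/implyP => xd; have xb0 : x != b0.
    by apply: contraTneq xd => ->; move: ud' => /andP[].
  rewrite -!scE //; last by rewrite eq_sym.
  have hd : h \in flatten (c :: r) by rewrite /= in_cons eqxx.
  have xdd : x \in flatten (c :: r) by rewrite -(perm_mem pf) in_cons xd orbT.
  (* A path crosses the removed loop at most once, hence ends on the side of [h] or on that of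
     [b1]. *)
  have /(unlink_min b0 b1)/or3P[->//|/andP[_ ->]|/andP[_ h0]] := co _ _ hd xdd.
    by rewrite orbT.
  by rewrite (conn_trans _ h0) // conn_sym.
have sub := unlink_sub (s := s) ab; rewrite -/s1 -/a' in sub.
have ch x : x \in flatten (c :: r) -> conn s a h x.
  rewrite -(perm_mem pf) in_cons => /predU1P[->|xd].
    by apply: sub; rewrite conn_sym.
  have xb0 : x != b0.
    by apply: contraTneq xd => ->; move: ud' => /andP[].
  have := co x; rewrite xd -!scE //; last by rewrite eq_sym.
  move=> /orP[/sub //|/sub]; apply: conn_trans.
  apply: (conn_trans (y := b0)); first by apply: sub; rewrite conn_sym.
  by rewrite -ab conn2.
by move=> x y xd yd; apply: (conn_trans (y := h)); [rewrite conn_sym|]; apply: ch.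
Qed.

(** Three darts are spliced out of the merged star: both ends of the edge and the mark [h2] of the
    absorbed star. No separation condition appears, since the two ends stay on one star. *)
Lemma merge_case s h b0 p h2 q b1 q' r :
  let d := [:: h :: b0 :: p, h2 :: q ++ b1 :: q' & r] in
  let d' := (h :: q' ++ q ++ p) :: r in
  stars s d ->
  exists2 s', stars s' d' & forall a, involutive a -> a b0 = b1 -> a h2 = h2 ->
    genus0_on s d a = genus0_on s' d' (a * tperm b0 b1).
Proof.
move=> d d' sd; set s1 := tperm b0 b1 * s.
have sd1 := merge_stars sd; rewrite -/s1 in sd1.
have [_ _ sd2 e2] := stars_splice (q1 := [::]) sd1; move: sd2 e2.
set s2 := _ * _ => /= sd2 e2.
have [_ _ sd3 e3] := stars_splice sd2; move: sd3 e3.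
set s3 := tperm h2 _ * _ => /= sd3 e3.
have e4' : q' ++ q ++ b1 :: p = (q' ++ q) ++ b1 :: p by rewrite catA.
rewrite e4' in sd3 e3.
have [_ _ sd4 e4] := stars_splice sd3; move: sd4 e4.
set s4 := tperm b1 _ * _ => /= sd4 e4; rewrite -catA in sd4 e4.
exists s4 => // a aK ab a2; set a' := a * _.
have [u _ _ _] := sd.
have [b0b1 h2b0 h2b1] : [/\ b0 != b1, h2 != b0 & h2 != b1].
  move: u; rewrite -[flatten d]/((h :: b0 :: p) ++ (h2 :: q ++ b1 :: q') ++ flatten r).
  rewrite cat_uniq => /and3P[_ /hasPn hn]; rewrite cat_uniq => /and3P[/uniq_two[_ ? _ _ _] _ _].
  have b0n z : z \in h2 :: q ++ b1 :: q' -> z != b0.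
    move=> zc; have := hn z; rewrite mem_cat zc => /(_ isT); apply: contraNneq => ->.
    by rewrite /= !in_cons eqxx orbT.
  split=> //; last by apply: b0n; rewrite mem_head.
  by rewrite eq_sym b0n // in_cons mem_cat mem_head !orbT.
have f0 : a' b0 = b0 by rewrite /a' (unlinkE aK ab) eqxx.
have f1 : a' b1 = b1 by rewrite /a' (unlinkE aK ab) eqxx orbT.
have f2 : a' h2 = h2 by rewrite /a' (unlinkE aK ab) (negPf h2b0) (negPf h2b1).
have [_ <-] := e4 _ f1; have [_ <-] := e3 _ f2; have [_ <-] := e2 _ f0.
rewrite /genus0_on (planar_unlink s aK ab b0b1) -/s1 -/a'.
set c' := h :: b0 :: q' ++ h2 :: q ++ b1 :: p.
have pf : perm_eq (flatten (c' :: r)) (flatten d).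
  by apply/seq.permP => k; rewrite /c' /= !count_cat /= !count_cat /= ?count_cat /=; lia.
have b0c : b0 \in c' by rewrite /c' !in_cons eqxx orbT.
have b1c : b1 \in c' by rewrite /c' !(in_cons, mem_cat) eqxx !orbT.
have c01 : conn s1 a' b0 b1 by apply: (star_conn _ sd1 (mem_head _ _)).
have n01 : b0 \notin porbit s b1.
  rewrite (star_porbit b0 sd (c := h2 :: q ++ b1 :: q')); last 2 first.
  - by rewrite !in_cons eqxx orbT.
  - by rewrite !(in_cons, mem_cat) eqxx !orbT.
  move: u; rewrite -[flatten d]/((h :: b0 :: p) ++ (h2 :: q ++ b1 :: q') ++ flatten r).
  rewrite cat_uniq => /and3P[_ /hasPn hn _]; apply/negP => zc.
  by have := hn b0; rewrite mem_cat zc /= !in_cons eqxx orbT => /(_ isT).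
rewrite (negPf n01) implyFb andbT; congr (_ && _).
have sub := unlink_sub (s := s) ab; rewrite -/s1 -/a' in sub.
apply/conn_onP/conn_onP => co x y xd yd.
  have := co x y; rewrite -!(perm_mem pf) => /(_ xd yd) /(unlink_min b0 b1).
  rewrite -/s1 -/a' => /or3P[//|/andP[g1 g2]|/andP[g1 g2]].
    by apply: conn_trans g1 (conn_trans c01 g2).
  by apply: conn_trans g1 (conn_trans _ g2); rewrite conn_sym.
by apply: sub; apply: co; rewrite (perm_mem pf).
Qed.

End Moves.

(** * Recursion for planar maps *)

Section Realization.
Local Open Scope group_scope.

Lemma stars_exist (T : finType) (d : seq (seq T)) : uniq (flatten d) ->
  [::] \notin d -> exists s, stars s d.
Proof.
elim: d => [|c d IH]; first by exists 1; split=> // x; rewrite perm1.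
rewrite /= cat_uniq in_cons negb_or => /and3P[uc /hasPn hn ud] /andP[cn dn].
have [s [h1 h2 h3 h4]] := IH ud dn.
pose sc := perm (can_inj (prev_next uc)).
have sE x : (sc * s) x = if x \in c then next c x else s x.
  rewrite permM permE; case: ifP => xc.
    rewrite h4 //; apply/negP => /hn /=; by rewrite mem_next xc.
  by rewrite next_nth xc.
exists (sc * s); split.
- by rewrite /= cat_uniq uc ud andbT; apply/hasPn.
- by rewrite in_cons negb_or cn.
- move=> c'; rewrite in_cons => /predU1P[->|cd].
    rewrite (@eq_in_cycle _ (mem c) _ (frel (next c))); last by apply/allP.
      exact: cycle_next.
    by move=> x y xc _; rewrite /= sE [x \in c]xc.
  rewrite (@eq_in_cycle _ (mem c') _ (frel s)); last by apply/allP.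
    exact: h3.
  move=> x y xc _; rewrite /= sE ifN //.
  by apply: hn; apply/flattenP; exists c'.
- move=> x; rewrite /= mem_cat negb_or => /andP[xc xd].
  by rewrite sE (negPf xc) h4.
Qed.

Variable m : nat.

Definition star_maps (w : seq 'I_m) (S : seq (seq 'I_m)) : nat :=
  nb_planar_maps (map (@monalg.FMonom _) (w :: S)).

(** Darts are the positions in the concatenated words, where [i0] in front of each word is the
    colour given to its marked dart. *)
Lemma realize (i0 : 'I_m) (W : seq (seq 'I_m)) :
  exists (T : finType) (col : T -> 'I_m) (s : {perm T}) (d : seq (seq T)),
    stars s d /\ map (fun c => map col (behead c)) d = W.
Proof.
pose W' := map (cons i0) W; pose N := size (flatten W').
pose col (x : 'I_N) := nth i0 (flatten W') x.
pose d := reshape (shape W') (enum 'I_N).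
have fd : flatten d = enum 'I_N.
  by rewrite /d reshapeKr // -size_flatten size_enum_ord.
have dW : map (map col) d = W'.
  rewrite /d map_reshape -[RHS]flattenK; congr reshape.
  apply: (@eq_from_nth _ i0); rewrite size_map size_enum_ord // => i iN.
  have e : 0 < N by case: (N) iN.
  rewrite (nth_map (Ordinal e)) ?size_enum_ord //.
  by rewrite /col nth_enum_ord.
have ud : uniq (flatten d) by rewrite fd enum_uniq.
have nd : [::] \notin d.
  apply/negP => h; have : [::] \in W' by rewrite -dW; apply: (map_f (map col) h).
  by case/mapP.
have [s sd] := stars_exist ud nd.
exists 'I_N, col, s, d; split=> //.
have -> : W = map behead W'.
  by rewrite /W' -map_comp (eq_map (g := id)) ?map_id // => x.
by rewrite -dW -map_comp; apply: eq_map => c /=; rewrite behead_map.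
Qed.

Lemma star_maps_nbmaps (T : finType) (col : T -> 'I_m) s c r : stars s (c :: r) ->
  nbmaps col s (c :: r) = star_maps (map col (behead c)) (map (fun c => map col (behead c)) r).
Proof.
move=> sd; rewrite (nbmapsE col sd) // /star_maps /=; congr nb_planar_maps; congr (_ :: _).
by rewrite -map_comp.
Qed.

Lemma stars_perm (T : finType) (s : {perm T}) d d' : perm_eq d d' -> stars s d ->
  stars s d'.
Proof.
move=> p [h1 h2 h3 h4]; have pf := perm_flatten p; split.
- by rewrite -(perm_uniq pf).
- by rewrite -(perm_mem p).
- by move=> c; rewrite -(perm_mem p); apply: h3.
- by move=> x; rewrite -(perm_mem pf); apply: h4.
Qed.

Lemma nbmaps_perm (T : finType) (col : T -> 'I_m) s d d' : perm_eq d d' ->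
  nbmaps col s d = nbmaps col s d'.
Proof.
move=> p; rewrite /nbmaps; congr #|pred_of_set _|; apply/setP => a; rewrite !inE.
rewrite -!/(genus0_on _ _ _) (@genus0_on_perm _ _ _ d').
  congr (_ && _); rewrite /matching; congr [&& _, _ & _].
  by apply: eq_forallb => x; rewrite (perm_letters p).
by move=> x; apply: perm_mem; apply: perm_flatten.
Qed.

(** Once realized by darts, a relabelling of the stars only reorders the list, with the same
    permutation [s]. *)
Lemma star_maps_perm (i0 : 'I_m) w S S' : perm_eq S S' -> star_maps w S = star_maps w S'.
Proof.
move=> p; have [T [col [s [d [sd dE]]]]] := realize i0 (w :: S).
case: d sd dE => [//|c r] sd /= [<- rS].
have /(perm_iotaP [::])[Is pI S'E] : perm_eq S' S by rewrite perm_sym.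
pose r' := [seq nth [::] r i | i <- Is].
have szr : size r = size S by rewrite -rS size_map.
have pr : perm_eq (c :: r) (c :: r').
  rewrite perm_cons perm_sym; apply/(perm_iotaP [::]); exists Is => //.
  by rewrite szr.
rewrite -{1}rS -(star_maps_nbmaps _ sd) (nbmaps_perm _ _ pr) (star_maps_nbmaps _ (stars_perm pr sd)).
congr star_maps; rewrite S'E /r' -map_comp; apply/eq_in_map => i iI /=.
rewrite -rS (nth_map [::]) // szr.
by have := perm_mem pI i; rewrite iI mem_iota => /esym/andP[].
Qed.

Lemma porbits_mulC (T : finType) (p q : {perm T}) :
  #|porbits (p * q)| = #|porbits (q * p)|.
Proof.
have le (u v : {perm T}) : #|porbits (u * v)| <= #|porbits (v * u)|.
  have e i x : u (((u * v) ^+ i) x) = ((v * u) ^+ i) (u x).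
    elim: i => [|i IH]; first by rewrite !expg0 !perm1.
    by rewrite !expgSr !permM -IH.
  pose G (X : {set T}) := u @: X.
  have Ginj : injective G by apply: imset_inj; apply: perm_inj.
  rewrite -(card_imset _ Ginj); apply: subset_leq_card.
  apply/subsetP => _ /imsetP[_ /imsetP[x _ ->] ->]; apply/imsetP; exists (u x) => //.
  apply/setP => y; apply/imsetP/idP => [[_ /porbitP[i ->] ->]|/porbitP[i ->]].
    by rewrite e mem_porbit.
  by exists (((u * v) ^+ i) x); rewrite ?mem_porbit ?e.
by apply/eqP; rewrite eqn_leq !le.
Qed.

(** Mirror image: inverting [s] reverses every star and keeps the gluing. The faces become the
    cycles of [a * s^-1], the inverse of [s * a], as many as those of [a * s]. This symmetry makes
    the solution hermitian. *)
Lemma star_maps_rev (i0 : 'I_m) w S : star_maps (rev w) (map rev S) = star_maps w S.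
Proof.
have [T [col [s [d [sd dE]]]]] := realize i0 (w :: S).
case: d sd dE => [//|c r] sd /= [wE rS].
pose fl (c : seq T) := if c is h :: p then h :: rev p else [::].
have [u n cyc out] := sd.
have flb e : behead (fl e) = rev (behead e) by case: e.
have mfl e : fl e =i e.
  by case: e => // h p x; rewrite !in_cons mem_rev.
have fm : flatten (map fl (c :: r)) =i flatten (c :: r).
  move=> x; apply/flattenP/flattenP => [[_ /mapP[e ed ->]]|[e ed xe]].
    by rewrite mfl; exists e.
  by exists (fl e); rewrite ?map_f ?mfl.
have sd' : stars s^-1 (map fl (c :: r)).
  split.
  - rewrite (@perm_uniq _ _ (flatten (c :: r))) //.
    apply/seq.permP => k; rewrite !count_flatten; congr sumn.
    rewrite -map_comp; apply: eq_map => e /=.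
    by case: e => // h p; rewrite /= count_rev.
  - apply/negP => /mapP[[|//] e _]; by case/negP: n.
  - move=> _ /mapP[e ed ->]; have := cyc e ed; case: e ed => // h p hp.
    rewrite /fl !fcycle_cons => cp.
    have := rev_path (frel s^-1) h (rcons p h).
    rewrite last_rcons belast_rcons rev_cons => ->.
    by apply: sub_path cp => y z /eqP <-; rewrite /= permK.
  - move=> x; rewrite fm => /out sx; by rewrite -{1}sx permK.
have -> : map rev S = map (fun c => map col (behead c)) (map fl r).
  by rewrite -rS -!map_comp; apply: eq_map => e /=; rewrite flb map_rev.
rewrite -{1}wE -map_rev -flb -(star_maps_nbmaps col sd') -rS -wE -(star_maps_nbmaps col sd).
rewrite /nbmaps; congr #|pred_of_set _|; apply/setP => a; rewrite !inE.
have lE x : (x \in letters (map fl (c :: r))) = (x \in letters (c :: r)).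
  apply/flattenP/flattenP => -[e].
    by move=> /mapP[_ /mapP[e' ed ->] ->]; rewrite flb mem_rev; exists (behead e') => //; apply: map_f.
  move=> /mapP[e' ed ->] xe; exists (rev (behead e')); rewrite ?mem_rev // -flb.
  by apply/map_f/map_f.
have mE : matching col (map fl (c :: r)) a = matching col (c :: r) a.
  by rewrite /matching; congr [&& _, _ & _]; apply: eq_forallb => x; rewrite lE.
rewrite mE; case m1 : (matching _ _ _) => //=.
have [aK _ _] := matchingP _ _ _ m1.
have cE : conn s^-1 a =2 conn s a.
  move=> x y; apply/idP/idP; apply: conn_sub => z; rewrite ?conn2 //.
    by rewrite conn_sym; have := conn1 s a (s^-1 z); rewrite permKV.
  by rewrite conn_sym; have := conn1 s^-1 a (s z); rewrite permK.
congr (_ && _).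
  apply/conn_onP/conn_onP => h x y xd yd; first by rewrite -cE; apply: h; rewrite fm.
  by rewrite cE; apply: h; rewrite -fm.
rewrite /planar porbitsV (eq_nclass cE) -[porbits (a * s^-1)]porbitsV invMg invgK.
have -> : a^-1 = a.
  by apply/permP => x; apply: (@perm_inj _ a); rewrite permKV aK.
by rewrite porbits_mulC.
Qed.

End Realization.

(** * The recursion on the first branch of the root *)

Section Recursion.
Local Open Scope group_scope.
Variable m : nat.

(** A star without branches is a component by itself, so that no other star may be present. *)
Lemma star_maps_nil (i0 : 'I_m) (S : seq (seq 'I_m)) : star_maps [::] S = (S == [::]) :> nat.
Proof.
have [T [col [s [d [sd dE]]]]] := realize i0 ([::] :: S).
case: d sd dE => [//|c r] sd /= [cE rS].
have [u n cyc out] := sd.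
have [h ch] : exists h, c = [:: h].
  case: c cE n {sd cyc u out} => [|h [|x c]] //; by exists h.
rewrite -{1}rS -(_ : map col (behead c) = [::]) // -(star_maps_nbmaps _ sd) ch.
have sh : s h = h.
  by have := cyc _ (mem_head _ _); rewrite ch /= andbT => /eqP.
case: r rS sd u {n cyc out} => [|c' r] rS sd u.
  rewrite -rS eqxx /= /nbmaps -(cards1 (1%g : {perm T})).
  congr #|pred_of_set _|; apply/setP => a; rewrite !inE.
  apply/and3P/eqP => [[ma _ _]|->].
    by apply/permP => x; rewrite perm1 (matching_fix ma).
  split.
  - by apply/matchingP; split=> x; rewrite ?perm1 ?eqxx.
  - by apply/conn_onP => x y; rewrite /= !inE => /eqP -> /eqP ->; apply: conn0.
  - have i1 : involutive (1%g : {perm T}) by move=> x; rewrite !perm1.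
    have := porbits_involution i1; rewrite (_ : [set x | _] = set0); last first.
      by apply/setP => x; rewrite !inE perm1 eqxx.
    by rewrite cards0 addn0 /planar mul1g -porbit_nclass; lia.
have -> : (S == [::]) = false by rewrite -rS.
apply: eq_card0 => a; rewrite inE; apply/negP => /and3P[ma /conn_onP co _].
have [y yc] : exists y, y \in c'.
  have [_ + _ _] := sd; case: c' {rS sd u co ma} => [|y c'].
    by rewrite !inE orbT.
  by move=> _; exists y; rewrite mem_head.
have ah : a h = h.
  apply: (matching_fix ma); rewrite /letters /=.
  apply/negP => hl; have : h \in flatten (c' :: r) by apply: letters_sub.
  by move: u; rewrite ch /= => /andP[/negP].
have hy : h != y.
  move: u; rewrite ch /= => /andP[+ _]; apply: contraNneq => ->.
  by rewrite mem_cat yc.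
have : conn s a h y.
  by apply: co; rewrite /= in_cons ?eqxx // mem_cat yc orbT.
by rewrite conn_fixed // (negPf hy).
Qed.

Section Darts.
Variables (T : finType) (col : T -> 'I_m) (s : {perm T}).
Variables (h b0 : T) (P : seq T) (r : seq (seq T)).
Let d := (h :: b0 :: P) :: r.
Hypothesis sd : stars s d.

Let wd (c : seq T) := map col (behead c).

Let term x := #|[set a | [&& matching col d a, a b0 == x & genus0_on s d a]]|.

Let uL : uniq (letters d).
Proof.
have [u _ _ _] := sd; move: u.
suff sub : forall e : seq (seq T), subseq (letters e) (flatten e) by apply/subseq_uniq/sub.
elim=> // c e IH; rewrite letters_cons /=; apply: cat_subseq => //.
by case: c => // y c; apply: subseq_cons.
Qed.

Lemma letters_minus (L L' : seq T) x y : uniq L -> perm_eq L [:: x, y & L'] ->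
  forall z, (z \in L') = [&& z \in L, z != x & z != y].
Proof.
move=> u p z; move: u; rewrite (perm_uniq p) (perm_mem p) !in_cons /= in_cons negb_or.
move=> /andP[/andP[xy xn] /andP[yn _]].
have [->|zx] := eqVneq z x; first by rewrite (negPf xn) andbF.
by have [->|zy] := eqVneq z y; rewrite ?(negPf yn) ?andbT.
Qed.

Lemma nbmaps_sum : nbmaps col s d =
  (\sum_(x <- P ++ letters r | col x == col b0) term x)%N.
Proof.
rewrite -big_filter; have uF : uniq [seq x <- P ++ letters r | col x == col b0].
  by apply: filter_uniq; move: uL; rewrite /d letters_cons /= => /andP[].
rewrite (big_uniq _ uF) /nbmaps.
rewrite -sum1_card (partition_big (fun a : {perm T} => a b0) predT) //=.
rewrite [RHS]big_mkcond /=; apply: eq_bigr => x _.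
rewrite (eq_bigl [in [set a | [&& matching col d a, a b0 == x & genus0_on s d a]]]).
  rewrite sum1_card; case: ifP => // nx; apply: eq_card0 => a; rewrite inE.
  apply/negP => /and3P[ma /eqP ab _]; move: nx; rewrite mem_filter.
  have [aK aL aC] := matchingP _ _ _ ma.
  have b0L : b0 \in letters d by rewrite mem_head.
  rewrite -ab aC eqxx /=; have : a b0 \in letters d by rewrite (matching_letters _ ma).
  rewrite in_cons => /predU1P[e|->//].
  by have := aL b0; rewrite e eqxx b0L.
by move=> a; rewrite !inE -andbA [_ && (_ == x)]andbC.
Qed.

Lemma term_split p1 x p2 : P = p1 ++ x :: p2 -> col x = col b0 ->
  term x = (\sum_(b : (size r).-tuple bool)
     star_maps (map col p2) (map wd (mask b r)) * star_maps (map col p1) (map wd (mask (map negb b) r)))%N.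
Proof.
move=> PE cx; have sd1 := sd; rewrite /d PE in sd1.
have [s' sd' key] := split_case sd1; set d' := [:: _, _ & _] in sd' key.
have b0x : b0 != x.
  have /andP[b0n _] : (b0 \notin P ++ letters r) && uniq (P ++ letters r) := uL.
  by apply: contraNneq b0n => ->; rewrite PE !mem_cat mem_head !orbT.
pose Q a := [&& planar s' a, ~~ conn s' a h x &
        [forall y in flatten d', conn s' a h y || conn s' a x y]].
transitivity #|[set a | [&& matching col d a, a b0 == x & Q (a * tperm b0 x)%g]]|.
  congr #|pred_of_set _|; apply/setP => a; rewrite !inE.
  case ma : (matching _ _ _) => //=; case: eqP => //= ab.
  have [aK _ _] := matchingP _ _ _ ma.
  by have := key a aK ab; rewrite -PE -/d => ->.
rewrite (@card_unlink _ _ _ _ d') //; last first.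
- apply: (letters_minus uL); apply/seq.permP => k.
  by rewrite /d !letters_cons /= PE /= !count_cat /= ?count_cat /=; lia.
- by rewrite /d letters_cons /= PE !(in_cons, mem_cat) eqxx !orbT.
- by rewrite /d letters_cons mem_head.
(* The empty list does not occur in the sum; its value only has to fit the hypothesis on [F], where
   the permutation can then only be the identity. *)
pose F' e := if e is c :: r' then star_maps (wd c) (map wd r') else nbmaps col 1 [::].
rewrite (@card_splitting _ _ col s' h x p2 p1 r sd' F') //.
move=> s1 [|c1 e1] sub se; last exact: star_maps_nbmaps.
have [_ _ _ out] := se; congr nbmaps; apply/permP => y.
by rewrite out ?perm1.
Qed.

Lemma term_merge h2 q x q' r' : perm_eq r ((h2 :: q ++ x :: q') :: r') ->
  col x = col b0 ->
  term x = star_maps (map col q' ++ map col q ++ map col P) (map wd r').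
Proof.
move=> pr cx; pose d2 := [:: h :: b0 :: P, h2 :: q ++ x :: q' & r'].
have pd : perm_eq d d2 by rewrite /d perm_cons.
have sd2 := stars_perm pd sd.
have [s' sd' key] := merge_case sd2; set d' := _ :: r' in sd' key.
have pl : perm_eq (letters d) (letters d2) by apply/perm_flatten/perm_map.
have uL2 : uniq (letters d2) by rewrite -(perm_uniq pl).
have b0x : b0 != x.
  have /andP[b0n _] : (b0 \notin P ++ (q ++ x :: q') ++ letters r') && uniq (P ++ (q ++ x :: q') ++ letters r') := uL2.
  by apply: contraNneq b0n => ->; rewrite !mem_cat mem_head !orbT.
have h2L : h2 \notin letters d2.
  have [u _ _ _] := sd2.
  have := u; rewrite -[flatten _]/((h :: b0 :: P) ++ (h2 :: q ++ x :: q') ++ flatten r').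
  rewrite uniq_catCA -[_ ++ _ ++ _]/(h2 :: (q ++ x :: q') ++ (h :: b0 :: P) ++ flatten r').
  rewrite cons_uniq => /andP[+ _]; apply: contra.
  have sub e : {subset letters e <= flatten e} by apply: letters_sub.
  rewrite /d2 letters_cons letters_cons /= !(in_cons, mem_cat).
  move=> /or3P[->|->|]; rewrite ?orbT //.
  by move=> /orP[->|/sub ->]; rewrite ?orbT.
transitivity #|[set a | [&& matching col d a, a b0 == x & genus0_on s' d' (a * tperm b0 x)]]|.
  congr #|pred_of_set _|; apply/setP => a; rewrite !inE.
  case ma : (matching _ _ _) => //=; case: eqP => //= ab.
  have [aK _ _] := matchingP _ _ _ ma.
  have ah2 : a h2 = h2.
    by apply: (matching_fix ma); rewrite (perm_letters pd).
  rewrite -(key a aK ab ah2); apply: genus0_on_perm.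
  by move=> y; apply: perm_mem; apply: perm_flatten.
rewrite (@card_unlink _ _ _ _ d') //; last first.
- apply: (letters_minus uL); rewrite (perm_trans pl) //; apply/seq.permP => k.
  by rewrite /d2 /d' !letters_cons /= !count_cat /= ?count_cat /=; lia.
- by rewrite (perm_mem pl) /d2 !letters_cons /= !(in_cons, mem_cat) eqxx !orbT.
- by rewrite /d letters_cons mem_head.
by rewrite -[LHS]/(nbmaps col s' d') (star_maps_nbmaps _ sd') /= !map_cat.
Qed.

End Darts.

(** Tutte's recursion: the partner of the first branch is in the root, and the other stars are
    distributed between the two sides of the loop, or it is in another star, which the root
    absorbs. *)
Lemma star_maps_cons i w (S : seq (seq 'I_m)) : star_maps (i :: w) S =
  (\sum_(k < size w | nth i w k == i) \sum_(b : (size S).-tuple bool)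
      star_maps (drop k.+1 w) (mask b S) * star_maps (take k w) (mask (map negb b) S) +
   \sum_(v < size S) \sum_(l < size (nth [::] S v) | nth i (nth [::] S v) l == i)
      star_maps (drop l.+1 (nth [::] S v) ++ take l (nth [::] S v) ++ w)
        (take v S ++ drop v.+1 S))%N.
Proof.
have [T [col [s [d [sd dE]]]]] := realize i ((i :: w) :: S).
case: d sd dE => [//|c r] sd /= [cE rS].
case: c sd cE => [|h [|b0 P]] // sd /= [ib0 Pw].
subst S w i.
rewrite -[LHS](star_maps_nbmaps col sd) (nbmaps_sum col sd) big_cat /=.
have [u _ _ _] := sd.
congr (_ + _)%N.
  rewrite (big_nth h) big_mkord size_map; apply: eq_big => k.
    by rewrite (nth_map h).
  move=> /eqP ck; have PE := cat_take_drop k P.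
  rewrite (drop_nth h) // in PE.
  rewrite (term_split sd (esym PE)) ?ck //.
  rewrite size_map; apply: eq_bigr => b _.
  by rewrite map_drop map_take -!map_mask.
rewrite /letters big_mkcond big_flatten /= big_map (big_nth [::]) big_mkord.
rewrite size_map; apply: eq_bigr => v _.
have vE : nth [::] [seq map col (behead c) | c <- r] v = map col (behead (nth [::] r v)) by rewrite (nth_map [::]).
rewrite vE -big_mkcond (big_nth h) big_mkord size_map; apply: eq_big => l.
  by rewrite (nth_map h).
move=> /eqP cl; set c := nth [::] r v; set p := behead c.
have [h2 cE] : exists h2, c = h2 :: p.
  have [_ n _ _] := sd; have : c \in r by apply: mem_nth.
  case cE : c => [|h2 c'] cr; first by rewrite in_cons cr orbT in n.
  by exists h2; rewrite /p cE.
have pE := cat_take_drop l p; rewrite (drop_nth h) // in pE.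
have pr : perm_eq r ((h2 :: take l p ++ nth h p l :: drop l.+1 p) :: take v r ++ drop v.+1 r).
  rewrite pE -cE -{1}(cat_take_drop v r) (drop_nth [::]) // -cat1s perm_catCA.
  exact: perm_refl.
rewrite (term_merge sd pr) ?cl //.
by rewrite map_cat !map_take !map_drop.
Qed.

End Recursion.

(* Imported only now: [root] and [set0] would shadow those of fingraph and finset. *)
From mathcomp Require Import all_algebra.
From mathcomp Require Import finmap complex.
From mathcomp Require Import all_classical all_reals all_analysis.
From mathcomp Require Import ring lra.
Import Order.TTheory GRing.Theory Num.Theory numFieldNormedType.Exports.
Local Open Scope classical_set_scope.
Local Open Scope ring_scope.

(** * Coefficients indexed by multi-indices *)

Section MultiIndex.
Local Open Scope nat_scope.
Variable X : finType.
Notation I := {ffun X -> nat}.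
Implicit Types (p : I) (L : seq X).

Definition deg p := \sum_x p x.
Definition pred_index p x : I := [ffun y => p y - (y == x)].
Definition sub_index p p' : I := [ffun x => p x - p' x].
Definition add_index p p' : I := [ffun x => p x + p' x].

Definition up_index p x : I := [ffun y => p y + (y == x)].

Lemma up_indexK x : cancel (fun p => up_index p x) (fun p => pred_index p x).
Proof. by move=> p; apply/ffunP => y; rewrite !ffunE addnK. Qed.

Lemma up_indexE p q x : (up_index p x == q) = (0 < q x) && (pred_index q x == p).
Proof.
apply/eqP/andP => [<-|[q0 /eqP <-]].
  by rewrite ffunE eqxx addn1 (up_indexK x p).
by apply/ffunP => y; rewrite !ffunE; case: eqP => [->|_]; rewrite ?subn0 ?addn0 // subnK.
Qed.

Lemma index_neq0 p : p != [ffun => 0] -> exists x, p x != 0.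
Proof.
move=> pn; apply/existsP; rewrite -[[exists x, _]]negbK negb_exists.
apply: contra pn => /forallP h; apply/eqP/ffunP => x.
by rewrite ffunE; have := h x; rewrite negbK => /eqP.
Qed.

(** The cap [deg p] on the entries only serves to make the enumeration finite. *)
Definition below p : seq I :=
  [seq [ffun x => (f : {ffun X -> 'I_(deg p).+1}) x : nat] |
    f <- enum [pred f : {ffun X -> 'I_(deg p).+1} | [forall x, f x <= p x]]].

Lemma le_deg p x : p x <= deg p.
Proof. by rewrite /deg (bigD1 x) //= leq_addr. Qed.

Lemma below_uniq p : uniq (below p).
Proof.
rewrite map_inj_uniq ?enum_uniq // => f g e; apply/ffunP => x; apply: val_inj.
by have /ffunP/(_ x) := e; rewrite !ffunE.
Qed.

Lemma mem_below p p' : (p' \in below p) = [forall x, p' x <= p x].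
Proof.
apply/mapP/forallP => [[f + ->] x|h].
  by rewrite mem_enum inE => /forallP/(_ x); rewrite ffunE.
exists [ffun x => inord (p' x)].
  rewrite mem_enum inE; apply/forallP => x; rewrite ffunE inordK //.
  by rewrite ltnS (leq_trans (h x)) ?le_deg.
apply/ffunP => x; rewrite !ffunE inordK //.
by rewrite ltnS (leq_trans (h x)) ?le_deg.
Qed.

Definition types p : seq X := flatten [seq nseq (p x) x | x <- enum X].
Definition content L : I := [ffun x => count_mem x L].

Lemma count_types p x : count_mem x (types p) = p x.
Proof.
rewrite /types count_flatten -map_comp sumnE big_map big_enum /= (bigD1 x) //=.
rewrite count_nseq /= eqxx mul1n big1 ?addn0 // => y yx.
by rewrite count_nseq /= (negPf yx) mul0n.
Qed.

Lemma contentK p : content (types p) = p.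
Proof. by apply/ffunP => x; rewrite ffunE count_types. Qed.

Lemma perm_types L : perm_eq L (types (content L)).
Proof. by apply/allP => x _; rewrite /= count_types ffunE. Qed.

Lemma size_types p : size (types p) = deg p.
Proof.
rewrite /types size_flatten /shape -map_comp sumnE big_map big_enum /=.
by apply: eq_bigr => x _; rewrite /= size_nseq.
Qed.

Lemma big_tuple_bool k (f : seq bool -> nat) :
  \sum_(b : k.+1.-tuple bool) f b =
  \sum_(b : k.-tuple bool) f (true :: b) + \sum_(b : k.-tuple bool) f (false :: b).
Proof.
rewrite (partition_big (fun b : k.+1.-tuple bool => thead b) predT) //= big_bool /=.
congr (_ + _).
  rewrite (reindex (fun b : k.-tuple bool => [tuple of true :: b])) /=.
    by apply: eq_bigl => b; rewrite theadE eqxx.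
  exists (fun b : k.+1.-tuple bool => [tuple of behead b]) => b; first by move=> _; apply: val_inj.
  by rewrite inE => /eqP e; apply: val_inj; rewrite [b in RHS]tuple_eta /= e.
rewrite (reindex (fun b : k.-tuple bool => [tuple of false :: b])) /=.
  by apply: eq_bigl => b; rewrite theadE eqxx.
exists (fun b : k.+1.-tuple bool => [tuple of behead b]) => b; first by move=> _; apply: val_inj.
by rewrite inE => /eqP e; apply: val_inj; rewrite [b in RHS]tuple_eta /= e.
Qed.

(** A sublist is a choice, for each type, of the occurrences that are kept. The induction is
    Pascal's rule for the type of the head. *)
Lemma count_masks L p :
  \sum_(b : (size L).-tuple bool) (content (mask b L) == p)
  = \prod_x 'C(count_mem x L, p x).
Proof.
elim: L p => [|y L IH] p /=.
  rewrite (big_pred1 [tuple]) /=; last by move=> b; apply/esym/eqP; exact: tuple0.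
  have -> : content [::] = [ffun => 0] by apply/ffunP => x; rewrite !ffunE.
  have [->|/index_neq0[x px]] := eqVneq p; first by rewrite big1 // => x _; rewrite ffunE.
  by rewrite (bigD1 x) //= bin0n (negPf px) mul0n.
rewrite (@big_tuple_bool _ (fun b => content (mask b (y :: L)) == p)) /= IH.
have -> : \sum_(b : (size L).-tuple bool) (content (y :: mask b L) == p)
   = (0 < p y) * \prod_x 'C(count_mem x L, pred_index p y x).
  case: (posnP (p y)) => [py|py].
    rewrite mul0n big1 // => b _; case: eqP => // /ffunP/(_ y).
    by rewrite ffunE /= eqxx py.
  rewrite mul1n -IH; apply: eq_bigr => b _; congr nat_of_bool.
  apply/eqP/eqP => /ffunP h; apply/ffunP => x; have := h x; rewrite !ffunE /=.
    by move=> <-; rewrite [x == y]eq_sym addKn.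
  by move=> ->; rewrite [y == x]eq_sym; case: eqP => [->|_]; lia.
rewrite [\prod_x 'C(_, pred_index p y x)](bigD1 y) // [\prod_x 'C(count_mem x L, p x)](bigD1 y) //.
rewrite [RHS](bigD1 y) //= eqxx !ffunE /= eqxx.
rewrite (eq_bigr (fun x => 'C(count_mem x L, p x))); last first.
  by move=> x xy; rewrite ffunE (negPf xy) subn0.
rewrite [X in _ = _ * X](eq_bigr (fun x => 'C(count_mem x L, p x))); last first.
  by move=> x xy; rewrite [y == x]eq_sym (negPf xy).
by case: (p y) => [|k]; rewrite ?bin0 ?mul0n ?add1n //= mul1n -mulnDl binS subn1 /= addnC.
Qed.

Lemma content_maskC L b : size b = size L ->
  content (mask (map negb b) L) = sub_index (content L) (content (mask b L)).
Proof.
move=> sb; apply/ffunP => x; rewrite !ffunE.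
by rewrite -(seq.permP (perm_maskC sb) (pred1 x)) count_cat addKn.
Qed.

Lemma content_mask_below L b : content (mask b L) \in below (content L).
Proof.
rewrite mem_below; apply/forallP => x; rewrite !ffunE.
exact/leq_count_subseq/mask_subseq.
Qed.

Lemma sum_masks L (g : I -> nat) :
  \sum_(b : (size L).-tuple bool) g (content (mask b L)) =
  \sum_(p <- below (content L)) (\prod_x 'C(content L x, p x)) * g p.
Proof.
rewrite (eq_bigr (fun b : (size L).-tuple bool =>
    \sum_(p <- below (content L)) (content (mask b L) == p) * g p)); last first.
  move=> b _; rewrite (bigD1_seq (content (mask b L))) ?content_mask_below ?below_uniq //=.
  rewrite eqxx mul1n big1 ?addn0 // => p; rewrite eq_sym => /negPf ->.
  by rewrite mul0n.
rewrite exchange_big /=; apply: eq_bigr => p _; rewrite -big_distrl /= count_masks.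
by congr (_ * _); apply: eq_bigr => x _; rewrite ffunE.
Qed.

Lemma sum_types p (g : X -> nat) : \sum_(y <- types p) g y = \sum_x p x * g x.
Proof.
rewrite /types big_flatten /= big_map big_enum /=; apply: eq_bigr => x _.
by rewrite big_nseq iter_addn_0 mulnC.
Qed.

Section Counting.
Variables (m : nat) (i0 : 'I_m) (Q : X -> seq 'I_m).

Definition nmaps (w : seq 'I_m) p := star_maps w (map Q (types p)).

Lemma star_maps_content w L : star_maps w (map Q L) = nmaps w (content L).
Proof. by apply: (star_maps_perm i0); apply: perm_map; apply: perm_types. Qed.

Lemma nmaps_nil p : nmaps [::] p = (p == [ffun => 0]).
Proof.
rewrite /nmaps (star_maps_nil i0); congr nat_of_bool; apply/eqP/eqP => [|->].
  move=> e; apply/ffunP => x; rewrite ffunE -count_types.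
  by move: e; case: (types p).
by apply/eqP; rewrite -size_eq0 size_map size_types /deg big1 // => x _; rewrite ffunE.
Qed.

(** The binomials count the distributions of labels with given contents, and the factor [p x] counts
    the labelled stars of type [x] that the root may absorb. *)
Lemma nmaps_cons i w p : nmaps (i :: w) p =
  \sum_(k < size w | nth i w k == i) \sum_(p' <- below p)
    (\prod_x 'C(p x, p' x)) * (nmaps (drop k.+1 w) p' * nmaps (take k w) (sub_index p p')) +
  \sum_x p x * \sum_(l < size (Q x) | nth i (Q x) l == i)
    nmaps (drop l.+1 (Q x) ++ take l (Q x) ++ w) (pred_index p x).
Proof.
rewrite /nmaps star_maps_cons; set J := types p; congr (_ + _).
  apply: eq_bigr => k _; rewrite size_map.
  have := sum_masks J (fun p' => nmaps (drop k.+1 w) p' * nmaps (take k w) (sub_index p p')).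
  rewrite contentK => <-; apply: eq_bigr => b _.
  rewrite -!map_mask !star_maps_content content_maskC ?size_tuple //.
  by rewrite contentK.
rewrite -sum_types -/J [RHS]big_tnth size_map; apply: eq_bigr => v _.
have y0 := tnth (in_tuple J) v.
rewrite (nth_map y0) // (tnth_nth y0) /=; set x := nth y0 J v.
apply: eq_bigr => l _; rewrite -map_take -map_drop -map_cat star_maps_content.
congr nmaps; apply/ffunP => z; rewrite !ffunE -[p z]count_types -/J.
have vJ : v < size J by [].
rewrite -[in RHS](cat_take_drop v J) (drop_nth y0 vJ) !count_cat /= -/x.
by rewrite [x == z]eq_sym; lia.
Qed.

End Counting.
End MultiIndex.

(** * Coefficients of the exponential generating series *)

Section Coefficients.
Variables (R : realFieldType) (X : finType) (m : nat) (i0 : 'I_m) (Q : X -> seq 'I_m).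
Notation I := {ffun X -> nat}.
Implicit Types (p : I) (s a : X -> R).

Definition ifact (p : I) : R := \prod_x ((p x)`!)%:R.
(** The factorials absorb the binomials and the factor [p x] of [nmaps_cons]. *)
Definition coef w (p : I) : R := (nmaps Q w p)%:R / ifact p.
Definition mon (s : X -> R) (p : I) : R := \prod_x s x ^+ p x.

Lemma ifact_gt0 p : 0 < ifact p.
Proof. by apply: prodr_gt0 => x _; rewrite ltr0n fact_gt0. Qed.

Lemma coef_ge0 w p : 0 <= coef w p.
Proof. by rewrite /coef mulr_ge0 ?ler0n // invr_ge0 ltW ?ifact_gt0. Qed.

Lemma coef_nil p : coef [::] p = (p == [ffun => 0%N])%:R.
Proof.
rewrite /coef (nmaps_nil i0); case: eqP => [->|]; last by rewrite mul0r.
by rewrite /ifact big1 ?divr1 // => x _; rewrite ffunE fact0.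
Qed.

Lemma ifact_bin p p' : p' \in below p ->
  (\prod_x 'C(p x, p' x))%:R = ifact p / (ifact p' * ifact (sub_index p p')).
Proof.
rewrite mem_below => /forallP h; rewrite natr_prod /ifact -big_split /= -prodf_div.
apply: eq_bigr => x _; rewrite ffunE -(bin_fact (h x)) natrM natrM.
by rewrite mulfK // mulf_neq0 // pnatr_eq0 -lt0n fact_gt0.
Qed.

Lemma ifact_pred p x : (0 < p x)%N -> ifact p = (p x)%:R * ifact (pred_index p x).
Proof.
move=> px; rewrite /ifact (bigD1 x) // [in RHS](bigD1 x) //= !ffunE eqxx mulrA -natrM.
rewrite subn1 -[in RHS](prednK px) -factS prednK //; congr (_ * _).
by apply: eq_bigr => y yx; rewrite ffunE (negPf yx) subn0.
Qed.

(** The indicator is needed because [pred_index] truncates: it returns [p] itself when [p x] is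
    0. *)
Lemma coef_cons i w p : coef (i :: w) p =
  \sum_(k < size w | nth i w k == i) \sum_(p' <- below p)
    coef (drop k.+1 w) p' * coef (take k w) (sub_index p p') +
  \sum_x \sum_(l < size (Q x) | nth i (Q x) l == i)
    (0 < p x)%N%:R * coef (drop l.+1 (Q x) ++ take l (Q x) ++ w) (pred_index p x).
Proof.
rewrite /coef (nmaps_cons i0) natrD mulrDl !natr_sum !mulr_suml; congr (_ + _).
  apply: eq_bigr => k _; rewrite natr_sum mulr_suml big_seq [RHS]big_seq.
  apply: eq_bigr => p' hp'; rewrite !natrM ifact_bin //.
  have := ifact_gt0 p; have := ifact_gt0 p'; have := ifact_gt0 (sub_index p p').
  by move=> h1 h2 h3; field; rewrite !gt_eqF.
apply: eq_bigr => x _; rewrite natrM natr_sum -mulrA mulr_suml mulr_sumr.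
apply: eq_bigr => l _; case: (posnP (p x)) => [->|px]; first by rewrite !mul0r.
rewrite (ifact_pred px); have h1 := ifact_gt0 (pred_index p x).
have h2 : 0 < (p x)%:R :> R by rewrite ltr0n.
by rewrite mul1r; field; rewrite !gt_eqF.
Qed.

Lemma monD s p p' : mon s (add_index p p') = mon s p * mon s p'.
Proof.
by rewrite /mon -big_split /=; apply: eq_bigr => x _; rewrite ffunE exprD.
Qed.

Lemma mon_sub s p p' : p' \in below p -> mon s p = mon s p' * mon s (sub_index p p').
Proof.
rewrite mem_below => /forallP h; rewrite -monD; congr mon; apply/ffunP => x.
by rewrite !ffunE subnKC.
Qed.

Lemma mon_pred s p x : (0 < p x)%N -> mon s p = s x * mon s (pred_index p x).
Proof.
move=> px; rewrite /mon (bigD1 x) // [in RHS](bigD1 x) //= !ffunE eqxx mulrA -exprS.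
rewrite subn1 prednK //; congr (_ * _).
by apply: eq_bigr => y yx; rewrite ffunE (negPf yx) subn0.
Qed.

Lemma mon_norm s p : `|mon s p| = mon (fun x => `|s x|) p.
Proof. by rewrite /mon normr_prod; apply: eq_bigr => x _; rewrite normrX. Qed.

Lemma mon_le s a p : (forall x, 0 <= s x <= a x) -> mon s p <= mon a p.
Proof.
move=> h; apply: ler_prod => x _; have /andP[s0 sa] := h x.
by rewrite exprn_ge0 //=; apply: lerXn2r; rewrite ?nnegrE // (le_trans s0).
Qed.

Lemma mon_pos s p : (forall x, 0 <= s x) -> 0 <= mon s p.
Proof. by move=> h; apply: prodr_ge0 => x _; apply: exprn_ge0. Qed.

Lemma coef_mon_cons s i w p : coef (i :: w) p * mon s p =
  \sum_(k < size w | nth i w k == i) \sum_(p' <- below p)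
    (coef (drop k.+1 w) p' * mon s p') *
    (coef (take k w) (sub_index p p') * mon s (sub_index p p')) +
  \sum_x \sum_(l < size (Q x) | nth i (Q x) l == i)
    s x * ((0 < p x)%N%:R * (coef (drop l.+1 (Q x) ++ take l (Q x) ++ w) (pred_index p x)
     * mon s (pred_index p x))).
Proof.
rewrite coef_cons mulrDl !mulr_suml; congr (_ + _).
  apply: eq_bigr => k _; rewrite mulr_suml big_seq [RHS]big_seq.
  by apply: eq_bigr => p' hp'; rewrite (mon_sub s hp'); ring.
apply: eq_bigr => x _; rewrite mulr_suml; apply: eq_bigr => l _.
case: (posnP (p x)) => [_|px]; first by rewrite !(mul0r, mulr0).
by rewrite (mon_pred s px); ring.
Qed.

End Coefficients.

(** * Unordered sums *)

Section Unordered.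
Variable R : realType.

(* Finite partial sums are indexed by duplicate-free sequences. *)
Definition has_sum (I : choiceType) (u : I -> R) (v : R) : Prop :=
  forall e : R, 0 < e -> exists s0 : seq I, forall s : seq I,
    uniq s -> {subset s0 <= s} -> `|\sum_(i <- s) u i - v| <= e.

Definition abs_bounded (I : choiceType) (u : I -> R) (M : R) : Prop :=
  forall s : seq I, uniq s -> \sum_(i <- s) `|u i| <= M.

Section OneIndex.
Variable I : choiceType.
Implicit Types (u w : I -> R) (s : seq I).

Lemma sum_subset u s s' : uniq s -> {subset s <= s'} -> (forall i, 0 <= u i) ->
  \sum_(i <- s) u i <= \sum_(i <- s') u i.
Proof.
move=> us sub u0.
have p : perm_eq s [seq i <- undup s' | i \in s].
  apply: uniq_perm => //; first by rewrite filter_uniq ?undup_uniq.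
  move=> i; rewrite mem_filter mem_undup; case is_ : (i \in s) => //=.
  by rewrite (sub _ is_).
rewrite (perm_big _ p) /= big_filter.
apply: (@le_trans _ _ (\sum_(i <- undup s') u i)).
  rewrite [leRHS](bigID (mem s)) /= lerDl; exact: sumr_ge0.
elim: s' {sub p} => //= i s' IH; rewrite big_cons; case: ifP => _.
  by apply: (le_trans IH); rewrite lerDr.
by rewrite big_cons lerD2l.
Qed.

Lemma has_sum_unique u v v' : has_sum u v -> has_sum u v' -> v = v'.
Proof.
move=> h h'; apply/eqP; rewrite -subr_eq0 -normr_le0; apply/ler_addgt0Pr => e e0.
rewrite add0r; have e2 : 0 < e / 2 by rewrite divr_gt0.
have [s0 h0] := h _ e2; have [s1 h1] := h' _ e2.
pose s := undup (s0 ++ s1).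
have us : uniq s by apply: undup_uniq.
have a0 := h0 s us; have a1 := h1 s us.
have {}a0 : `|\sum_(i <- s) u i - v| <= e / 2.
  by apply: a0 => i hi; rewrite mem_undup mem_cat hi.
have {}a1 : `|\sum_(i <- s) u i - v'| <= e / 2.
  by apply: a1 => i hi; rewrite mem_undup mem_cat hi orbT.
rewrite distrC in a0; have -> : v - v' = (v - \sum_(i <- s) u i) + (\sum_(i <- s) u i - v') by ring.
by apply: (le_trans (ler_normD _ _)); lra.
Qed.

Lemma eq_has_sum u w v : u =1 w -> has_sum u v -> has_sum w v.
Proof.
move=> e h d d0; have [s0 h0] := h d d0; exists s0 => s us ss.
by rewrite -(eq_bigr _ (fun i _ => e i)); apply: h0.
Qed.

Lemma has_sumD u w v v' : has_sum u v -> has_sum w v' ->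
  has_sum (fun i => u i + w i) (v + v').
Proof.
move=> h h' e e0; have e2 : 0 < e / 2 by rewrite divr_gt0.
have [s0 h0] := h _ e2; have [s1 h1] := h' _ e2.
exists (s0 ++ s1) => s us sub; rewrite big_split /=.
have a0 := h0 s us; have a1 := h1 s us.
have {}a0 : `|\sum_(i <- s) u i - v| <= e / 2.
  by apply: a0 => i hi; apply: sub; rewrite mem_cat hi.
have {}a1 : `|\sum_(i <- s) w i - v'| <= e / 2.
  by apply: a1 => i hi; apply: sub; rewrite mem_cat hi orbT.
rewrite opprD addrACA; apply: (le_trans (ler_normD _ _)); lra.
Qed.

Lemma has_sum0 : has_sum (fun _ : I => 0) 0.
Proof. by move=> e e0; exists [::] => s _ _; rewrite big1 // subr0 normr0 ltW. Qed.

Lemma has_sumZ u v a : has_sum u v -> has_sum (fun i => a * u i) (a * v).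
Proof.
move=> h e e0; have d0 : 0 < e / (`|a| + 1) by rewrite divr_gt0 // ltr_wpDl.
have [s0 h0] := h _ d0; exists s0 => s us sub.
rewrite -mulr_sumr -mulrBr normrM; apply: (le_trans (ler_wpM2l _ (h0 s us sub))) => //.
rewrite mulrA ler_pdivrMr ?ltr_wpDl // mulrC ler_wpM2l ?ltW //; lra.
Qed.

Lemma has_sum_sum (J : Type) (l : seq J) (P : pred J) (u : J -> I -> R) (v : J -> R) :
  (forall j, P j -> has_sum (u j) (v j)) ->
  has_sum (fun i => \sum_(j <- l | P j) u j i) (\sum_(j <- l | P j) v j).
Proof.
move=> h; elim: l => [|j l IH].
  by rewrite big_nil; apply: eq_has_sum has_sum0 => i; rewrite big_nil.
rewrite big_cons; case: ifP => Pj.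
  by apply: eq_has_sum (has_sumD (h j Pj) IH) => i; rewrite big_cons Pj.
by apply: eq_has_sum IH => i; rewrite big_cons Pj.
Qed.

Lemma has_sum_fin u s : uniq s -> (forall i, i \notin s -> u i = 0) ->
  has_sum u (\sum_(i <- s) u i).
Proof.
move=> us u0 e e0; exists s => s' us' sub.
suff -> : \sum_(i <- s') u i = \sum_(i <- s) u i by rewrite subrr normr0 ltW.
have p : perm_eq s [seq i <- s' | i \in s].
  apply: uniq_perm => //; first by rewrite filter_uniq.
  by move=> i; rewrite mem_filter; case is_ : (i \in s) => //=; rewrite (sub _ is_).
rewrite (perm_big _ p) /= big_filter [LHS](bigID (mem s)) /=.
by rewrite [X in _ + X]big1 ?addr0 // => i; apply: u0.
Qed.

Lemma has_sum_le u v M : abs_bounded u M -> has_sum u v -> `|v| <= M.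
Proof.
move=> b h; apply/ler_addgt0Pr => e e0; have [s0 h0] := h e e0.
have a0 := h0 (undup s0) (undup_uniq _).
have {}a0 : `|\sum_(i <- undup s0) u i - v| <= e by apply: a0 => i; rewrite mem_undup.
have b0 : `|\sum_(i <- undup s0) u i| <= M.
  by apply: (le_trans (ler_norm_sum _ _ _)); apply: b; apply: undup_uniq.
rewrite distrC in a0.
have -> : v = \sum_(i <- undup s0) u i + (v - \sum_(i <- undup s0) u i) by ring.
by apply: (le_trans (ler_normD _ _)); lra.
Qed.

Lemma nonneg_has_sum u M : (forall i, 0 <= u i) ->
  (forall s, uniq s -> \sum_(i <- s) u i <= M) -> exists v, has_sum u v.
Proof.
move=> u0 b.
pose E : set R := fun x => exists2 s : seq I, uniq s & x = \sum_(i <- s) u i.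
have hE : has_sup E.
  split; first by exists 0; exists [::]; rewrite ?big_nil.
  by exists M => x [s us ->]; apply: b.
exists (sup E) => e e0; have [x [s0 us0 ->] hx] := sup_adherent e0 hE.
exists s0 => s us sub.
have l1 : \sum_(i <- s) u i <= sup E.
  by apply: ub_le_sup; [case: hE|exists s].
have l2 := sum_subset us0 sub u0.
by rewrite ler_norml; apply/andP; split; lra.
Qed.

(** Both [|u| + u] and [|u|] are nonnegative with bounded partial sums, hence summable to a
    supremum; [u] is their difference. *)
Lemma has_sum_exists u M : abs_bounded u M -> exists v, has_sum u v.
Proof.
move=> b.
have [v hv] : exists v, has_sum (fun i => `|u i| + u i) v.
  apply: (@nonneg_has_sum _ (M + M)) => [i|s us].
    by have := ler_norm (- u i); rewrite normrN; lra.
  rewrite big_split /= lerD ?b //.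
  apply: (le_trans (ler_norm _)); apply: (le_trans (ler_norm_sum _ _ _)); exact: b.
have [z hz] : exists z, has_sum (fun i => `|u i|) z.
  by apply: (@nonneg_has_sum _ M) => // i.
exists (v + (-1) * z); apply: eq_has_sum (has_sumD hv (has_sumZ (-1) hz)) => i.
by ring.
Qed.

Lemma abs_bounded_le u w M : (forall i, `|u i| <= `|w i|) -> abs_bounded w M ->
  abs_bounded u M.
Proof. by move=> le b s us; apply: le_trans (b s us); apply: ler_sum. Qed.

End OneIndex.

Section Fibers.
Variables (K I : choiceType) (pi : K -> I).

(** Summation by packets: finitely many packets are approximated simultaneously by one finite set of
    indices, large enough in each of them. *)
Lemma has_sum_fiber (u : K -> R) (v : I -> R) (t : R) : has_sum u t ->
  (forall i, has_sum (fun k => if pi k == i then u k else 0) (v i)) -> has_sum v t.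
Proof.
move=> h hf e e0; have e2 : 0 < e / 2 by rewrite divr_gt0.
have [s0 h0] := h _ e2; exists (map pi s0) => s us sub.
(* The error is shared among the packets; [+ 1] keeps the divisor positive. *)
pose d := e / 2 / ((size s)%:R + 1).
have d0 : 0 < d by rewrite divr_gt0 // ltr_wpDl.
have [A hA] : exists A : seq K, forall i, i \in s -> forall B, uniq B ->
    {subset A <= B} -> `|\sum_(k <- B) (if pi k == i then u k else 0) - v i| <= d.
  elim: (s) => [|j l [A hA]]; first by exists [::].
  have [A' hA'] := hf j _ d0; exists (A' ++ A) => i.
  rewrite in_cons => /predU1P[->|il] B uB sB.
    by apply: hA' => // k kA; apply: sB; rewrite mem_cat kA.
  by apply: hA => // k kA; apply: sB; rewrite mem_cat kA orbT.
pose B := undup (A ++ s0); pose B' := [seq k <- B | pi k \in s].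
have uB : uniq B by apply: undup_uniq.
have sB' : {subset s0 <= B'}.
  move=> k ks; rewrite mem_filter mem_undup mem_cat ks orbT andbT.
  by apply: sub; apply: map_f.
have e1 : \sum_(k <- B') u k = \sum_(i <- s) \sum_(k <- B) (if pi k == i then u k else 0).
  rewrite exchange_big /= big_filter big_mkcond /=; apply: eq_bigr => k _.
  case: ifP => ks; last first.
    by rewrite big_seq big1 // => i is_; case: eqP => // ke; rewrite ke is_ in ks.
  rewrite (bigD1_seq (pi k)) //= eqxx big1 ?addr0 // => i; rewrite eq_sym => /negPf.
  by move->.
have := h0 B' (filter_uniq _ uB) sB'; rewrite e1 => l1.
have l2 : `|\sum_(i <- s) v i - \sum_(i <- s) \sum_(k <- B) (if pi k == i then u k else 0)| <= e / 2.
  rewrite -sumrB; apply: (le_trans (ler_norm_sum _ _ _)).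
  apply: (@le_trans _ _ (\sum_(i <- s) d)).
    rewrite big_seq [leRHS]big_seq; apply: ler_sum => i is_; rewrite distrC; apply: hA => //.
    by move=> k kA; rewrite mem_undup mem_cat kA.
  rewrite big_const_seq count_predT iter_addr_0 -[d *+ _]mulr_natr /d.
  rewrite mulrAC ler_pdivrMr ?ltr_wpDl // ler_wpM2l ?ltW //; lra.
set S := \sum_(i <- s) \sum_(k <- B) _ in l1 l2.
have -> : \sum_(i <- s) v i - t = (\sum_(i <- s) v i - S) + (S - t) by ring.
by apply: (le_trans (ler_normD _ _)); lra.
Qed.

Lemma has_sum_finite_fiber (u : K -> R) (l : I -> seq K) (t : R) : has_sum u t ->
  (forall i, uniq (l i)) -> (forall i k, (k \in l i) = (pi k == i)) ->
  has_sum (fun i => \sum_(k <- l i) u k) t.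
Proof.
move=> h ul lE; apply: (has_sum_fiber h) => i.
rewrite (_ : \sum_(k <- l i) u k = \sum_(k <- l i) (if pi k == i then u k else 0)); last first.
  by rewrite big_seq [RHS]big_seq; apply: eq_bigr => k; rewrite lE => ->.
by apply: has_sum_fin => // k; rewrite lE => /negPf ->.
Qed.

Lemma abs_bounded_fiber (u : K -> R) (l : I -> seq K) (w : I -> R) (M : R) :
  (forall i, uniq (l i)) -> (forall i k, (k \in l i) = (pi k == i)) ->
  (forall i, \sum_(k <- l i) `|u k| <= `|w i|) -> abs_bounded w M -> abs_bounded u M.
Proof.
move=> ul lE le b s us.
apply: le_trans (b (undup (map pi s)) (undup_uniq _)).
apply: (@le_trans _ _ (\sum_(i <- undup (map pi s)) \sum_(k <- l i) `|u k|)); last first.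
  exact: ler_sum.
rewrite -(big_allpairs_dep (h := fun i k => k) (r1 := undup (map pi s)) (r2 := l)
   (F := fun k => `|u k|)).
apply: sum_subset => // k ks; apply/allpairsPdep; exists (pi k), k; split=> //.
  by rewrite mem_undup map_f.
by rewrite lE.
Qed.

End Fibers.

(** Extension by zero along an injection [f] with image [P] and inverse [g]. It serves to shift a
    multi-index by one and to place a family on one fiber of a product. *)
Lemma has_sum_embed (J K : choiceType) (f : J -> K) (g : K -> J) (P : pred K)
    (u : J -> R) v : has_sum u v ->
  (forall j k, (f j == k) = P k && (g k == j)) ->
  has_sum (fun k => if P k then u (g k) else 0) v.
Proof.
move=> h e; have := has_sum_finite_fiber (pi := f)
  (l := fun k => if P k then [:: g k] else [::]) h.
move=> h'; apply: eq_has_sum (h' _ _) => [k|k|k j].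
- by case: ifP => _; rewrite ?big_seq1 ?big_nil.
- by case: ifP.
- by rewrite e; case: ifP => _; rewrite ?inE // eq_sym.
Qed.

Lemma abs_bounded_prod (I J : choiceType) (u : I -> R) (w : J -> R) M N :
  abs_bounded u M -> abs_bounded w N ->
  abs_bounded (fun k : I * J => u k.1 * w k.2) (M * N).
Proof.
move=> bu bw s us; pose s1 := undup (map fst s); pose s2 := undup (map snd s).
apply: (@le_trans _ _ (\sum_(i <- s1) \sum_(j <- s2) `|u i * w j|)).
  rewrite -(big_allpairs_dep (h := fun (i : I) (j : J) => (i, j)) (r1 := s1) (r2 := fun=> s2)
    (F := fun k => `|u k.1 * w k.2|)) /=.
  apply: sum_subset => // k ks; apply/allpairsP; exists k; split => //.
  - by rewrite mem_undup map_f.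
  - by rewrite mem_undup map_f.
  - by case: k {ks}.
under eq_bigr => i _ do (under eq_bigr do rewrite normrM; rewrite -mulr_sumr).
rewrite -mulr_suml; apply: ler_pM; try (by apply: sumr_ge0).
- exact: bu (undup_uniq _).
- exact: bw (undup_uniq _).
Qed.

(** The double family is summable by the product bound; its sum is then identified by summing along
    the first coordinate. *)
Lemma has_sum_prod (I J : choiceType) (u : I -> R) (w : J -> R) M N a b :
  abs_bounded u M -> abs_bounded w N -> has_sum u a -> has_sum w b ->
  has_sum (fun k : I * J => u k.1 * w k.2) (a * b).
Proof.
move=> bu bw hu hw; have [t ht] := has_sum_exists (abs_bounded_prod bu bw).
suff -> : a * b = t by [].
have h1 : has_sum (fun i => u i * b) t.
  apply: (has_sum_fiber (pi := fst) ht) => i.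
  have [v hv] : exists v, v = u i * b by exists (u i * b).
  rewrite -hv => e e0; have d0 : 0 < e / (`|u i| + 1) by rewrite divr_gt0 // ltr_wpDl.
  have [s0 h0] := hw _ d0; exists (map (pair i) s0) => s us sub.
  pose s' := [seq k.2 | k <- s & k.1 == i].
  have us' : uniq s'.
    rewrite map_inj_in_uniq ?filter_uniq // => -[i1 j1] [i2 j2] /=.
    by rewrite !mem_filter /= => /andP[/eqP -> _] /andP[/eqP -> _] ->.
  have ss' : {subset s0 <= s'}.
    move=> j js; apply/mapP; exists (i, j) => //; rewrite mem_filter /= eqxx /=.
    by apply: sub; apply: map_f.
  have -> : \sum_(k <- s) (if k.1 == i then u k.1 * w k.2 else 0) = u i * \sum_(j <- s') w j.
    rewrite -big_mkcond /= mulr_sumr /s' big_map big_filter.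
    by apply: eq_bigr => k /eqP ->.
  rewrite hv -mulrBr normrM; apply: (le_trans (ler_wpM2l _ (h0 s' us' ss'))) => //.
  rewrite mulrA ler_pdivrMr ?ltr_wpDl // mulrC ler_wpM2l ?ltW //; lra.
have h2 := has_sumZ b hu; rewrite mulrC; apply: has_sum_unique h2 _.
by apply: eq_has_sum h1 => i; rewrite mulrC.
Qed.

End Unordered.

(** * Weighted Motzkin numbers *)

Section Motzkin.
Variables (R : realFieldType) (e : R).

(** All earlier values are kept, as the recursion refers to each of them. *)
Fixpoint motzkin_seq n : seq R :=
  if n is n'.+1 then
    let l := motzkin_seq n' in
    rcons l (e * l`_n' + \sum_(k < n') l`_k * l`_(n'.-1 - k))
  else [:: 1].

(** This is the [n]-th moment of the semicircle law of variance 1 centred at [e], whose support ends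
    at [2 + e]; hence the growth rate in [motzkin_upper]. *)
Definition motzkin n := (motzkin_seq n)`_n.
Local Notation b := motzkin.

Lemma size_motzkin_seq n : size (motzkin_seq n) = n.+1.
Proof. by elim: n => //= n IH; rewrite size_rcons IH. Qed.

Lemma nth_motzkin_seq n k : (k <= n)%N -> (motzkin_seq n)`_k = b k.
Proof.
elim: n => [|n IH]; first by rewrite leqn0 => /eqP ->.
rewrite leq_eqVlt ltnS => /predU1P[->//|kn].
by rewrite /= nth_rcons size_motzkin_seq ltnS kn IH.
Qed.

Definition mconv n := \sum_(k < n) b k * b (n.-1 - k).

Lemma motzkin0 : b 0 = 1. Proof. by []. Qed.

Lemma motzkinS n : b n.+1 = e * b n + mconv n.
Proof.
rewrite /motzkin /= nth_rcons size_motzkin_seq ltnn eqxx nth_motzkin_seq //.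
congr (_ + _); apply: eq_bigr => k _; rewrite !nth_motzkin_seq //.
  by case: n k => [[]//|n] k /=; rewrite (leq_trans (leq_subr _ _)).
exact: ltnW.
Qed.

(** The reflection exchanging [k] and [n - 1 - k] replaces the weight by its average. *)
Lemma mconv_moment n :
  2 * \sum_(k < n) k%:R * (b k * b (n.-1 - k)) = (n%:R - 1) * mconv n.
Proof.
rewrite -[2]/(1 + 1) mulrDl mul1r {2}(reindex_inj rev_ord_inj) /= -big_split /=.
rewrite /mconv mulr_sumr; apply: eq_bigr => k _.
have -> : (n - k.+1 = n.-1 - k)%N by lia.
have -> : (n.-1 - (n.-1 - k) = k)%N by have := ltn_ord k; lia.
have -> : n%:R = (n.-1 - k)%:R + k%:R + 1 :> R.
  by rewrite -natrD natr1; congr (_%:R); have := ltn_ord k; lia.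
ring.
Qed.

(* The generating function is algebraic, [B = 1 + e x B + x^2 B^2]; this is the
   linear recursion coming from its differential equation. *)
Lemma motzkin_recursion n :
  (n%:R + 3) * b n.+1 = (2 * n%:R + 3) * e * b n + n%:R * (4 - e ^+ 2) * b n.-1.
Proof.
elim/ltn_ind: n => -[|n] IH.
  by rewrite motzkinS /mconv big_ord0 /= motzkin0; ring.
have A : ((n.+1)%:R + 3) * mconv n.+1 = 4 * b n + 2 * e * ((n.+1)%:R + 1) * mconv n
   + (4 - e ^+ 2) * n%:R * mconv n.-1.
  (* After a shift of [k] the weight [k + 2] becomes [k + 3], the left coefficient of the recursion,
     so that the induction hypothesis applies inside the sum. *)
  transitivity (2 * \sum_(k < n.+1) (k%:R + 2) * (b k * b (n - k))).
    under [in RHS]eq_bigr do rewrite mulrDl.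
    by rewrite big_split /= mulrDr mconv_moment -mulr_sumr -/(mconv n.+1); ring.
  rewrite big_ord_recl /= subn0 motzkin0.
  under eq_bigr => k _.
    rewrite /bump /= add1n.
    have -> : (k.+1%:R + 2) * (b k.+1 * b (n - k.+1)) =
       2 * e * (k%:R * (b k * b (n.-1 - k))) + 3 * e * (b k * b (n.-1 - k))
       + (4 - e ^+ 2) * (k%:R * b k.-1 * b (n - k.+1)).
      have := IH k (leq_trans (ltn_ord k) (leqnSn n)).
      have -> : (n - k.+1 = n.-1 - k)%N by lia.
      move=> h; rewrite mulrA.
      have -> : (k.+1%:R + 2) * b k.+1 = (k%:R + 3) * b k.+1 by rewrite -natr1; ring.
      by rewrite h; ring.
    over.
  rewrite !big_split /= -!mulr_sumr -/(mconv n).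
  have -> : \sum_(k < n) k%:R * b k.-1 * b (n - k.+1) =
     \sum_(k < n.-1) k%:R * (b k * b (n.-1.-1 - k)) + mconv n.-1.
    case: (n) => [|n']; first by rewrite /mconv !big_ord0 addr0.
    rewrite big_ord_recl /= !mul0r add0r /mconv -big_split /=; apply: eq_bigr => k _.
    rewrite /bump /= add1n subSS.
    have -> : (n' - k.+1 = n'.-1 - k)%N by lia.
    by rewrite -natr1; ring.
  have m1 := mconv_moment n; have m2 := mconv_moment n.-1.
  have -> : 2 * ((0%:R + 2) * (1 * b n) + (2 * e * \sum_(i < n) i%:R * (b i * b (n.-1 - i)) + 3 * e * mconv n + (4 - e ^+ 2) * (\sum_(k < n.-1) k%:R * (b k * b (n.-1.-1 - k)) + mconv n.-1)))
    = 4 * b n + 2 * e * (2 * \sum_(i < n) i%:R * (b i * b (n.-1 - i))) + 6 * e * mconv n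
     + (4 - e ^+ 2) * (2 * \sum_(k < n.-1) k%:R * (b k * b (n.-1.-1 - k))) + 2 * (4 - e ^+ 2) * mconv n.-1 by ring.
  rewrite m1 m2; case: (n) => [|n']; first by rewrite /mconv !big_ord0; ring.
  by rewrite -!natr1; ring.
rewrite motzkinS mulrDr A /=.
case: n IH {A} => [|n] IH.
  by rewrite /mconv !big_ord0 motzkinS /mconv big_ord0 motzkin0; ring.
have T1 : mconv n.+1 = b n.+2 - e * b n.+1 by rewrite motzkinS; ring.
have T2 : mconv n = b n.+1 - e * b n by rewrite motzkinS; ring.
have P := IH n.+1 (ltnSn _); rewrite /= in P.
rewrite /= T1 T2; apply/eqP; rewrite -subr_eq0; apply/eqP.
(* The difference of the two sides is [e] times the recursion one rank below. *)
transitivity (e * ((n.+1%:R + 3) * b n.+2 - ((2 * n.+1%:R + 3) * e * b n.+1 + n.+1%:R * (4 - e ^+ 2) * b n))).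
  by rewrite -!natr1; ring.
by rewrite P subrr mulr0.
Qed.

Hypotheses (e0 : 0 < e) (e1 : e <= 1).

Lemma motzkin_ge0 n : 0 <= b n.
Proof.
elim/ltn_ind: n => -[|n] IH; first by rewrite motzkin0.
rewrite motzkinS addr_ge0 ?mulr_ge0 ?IH ?(ltW e0) //.
by apply: sumr_ge0 => k _; rewrite mulr_ge0 // IH //; have := ltn_ord k; lia.
Qed.

Lemma motzkin_lower n : e * b n <= b n.+1.
Proof. by rewrite motzkinS lerDl; apply: sumr_ge0 => k _; rewrite mulr_ge0 ?motzkin_ge0. Qed.

(** For large [n] the recursion tends to the equation x^2 = 2 e x + 4 - e^2, whose larger root is
    [2 + e]; the correction at finite rank is [y * (6 * e + 12)], of the right sign. *)
Lemma motzkin_upper n : b n <= (2 + e) ^+ n.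
Proof.
have [e0' e1'] := (e0, e1).
elim/ltn_ind: n => -[|[|n]] IH; first by rewrite motzkin0.
  by rewrite motzkinS /mconv big_ord0 motzkin0 expr1; lra.
have h := motzkin_recursion n.+1; rewrite /= in h.
have n0 : 0 < n.+1%:R :> R by rewrite ltr0n.
move: h n0; move: (n.+1%:R) => x h n0.
have i1 := IH n.+1 (ltnSn _); have i2 := IH n (leqnSn _).
rewrite -(ler_pM2l (_ : 0 < x + 3)) ?h; last by lra.
have e4 : 0 <= 4 - e ^+ 2.
  have : e ^+ 2 <= 1 by rewrite expr_le1 // ltW.
  by lra.
have y0 : 0 <= (2 + e) ^+ n by apply: exprn_ge0; lra.
have h1 : (2 * x + 3) * e * b n.+1 <= (2 * x + 3) * e * (2 + e) ^+ n.+1.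
  by apply: ler_wpM2l => //; rewrite mulr_ge0 ?(ltW e0) //; lra.
have h2 : x * (4 - e ^+ 2) * b n <= x * (4 - e ^+ 2) * (2 + e) ^+ n.
  by apply: ler_wpM2l => //; apply: mulr_ge0 => //; lra.
apply: le_trans (lerD h1 h2) _; rewrite [in leRHS]exprS [in leRHS]exprS exprS.
move: y0; move: ((2 + e) ^+ n) => y y0; rewrite -subr_ge0.
have -> : (x + 3) * ((2 + e) * ((2 + e) * y)) - ((2 * x + 3) * e * ((2 + e) * y) + x * (4 - e ^+ 2) * y)
  = y * (6 * e + 12) by ring.
by apply: mulr_ge0 => //; lra.
Qed.

(** The two terms of the linear recursion give [2 * e] and [4 / e], the latter through
    [e * b n <= b n.+1]. Positivity of [e] is essential: for [e = 0] the odd values vanish and the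
    even ones do not. *)
Lemma motzkin_ratio n j : b (n + j) <= (2 * e + 4 / e) ^+ j * b n.
Proof.
have [e0' e1'] := (e0, e1).
have K0 : 0 <= 2 * e + 4 / e.
  by apply: addr_ge0; [apply: mulr_ge0|apply: divr_ge0]; lra.
have step k : b k.+1 <= (2 * e + 4 / e) * b k.
  case: k => [|k].
    rewrite motzkinS /mconv big_ord0 motzkin0 addr0 ler_wpM2r //.
    have : 0 <= 4 / e by rewrite divr_ge0 // ltW.
    by lra.
  have h := motzkin_recursion k.+1; rewrite /= in h.
  have n0 : 0 < k.+1%:R :> R by rewrite ltr0n.
  move: h n0; move: (k.+1%:R) => x h n0.
  have l := motzkin_lower k; have b0 := motzkin_ge0 k; have b1 := motzkin_ge0 k.+1.
  rewrite -(ler_pM2l (_ : 0 < x + 3)) ?h; last by lra.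
  have h1 : (2 * x + 3) * e * b k.+1 <= (x + 3) * (2 * e * b k.+1).
    rewrite -subr_ge0.
    have -> : (x + 3) * (2 * e * b k.+1) - (2 * x + 3) * e * b k.+1 = 3 * (e * b k.+1) by ring.
    by rewrite !mulr_ge0 // ltW.
  have h2 : x * (4 - e ^+ 2) * b k <= (x + 3) * (4 / e * b k.+1).
    apply: (@le_trans _ _ ((x + 3) * (4 * b k))).
      have e2 : 0 <= e ^+ 2 by rewrite exprn_ge0 // ltW.
      have xx : 0 <= x * e ^+ 2 by rewrite mulr_ge0 // ltW.
      have xb : 0 <= x * e ^+ 2 * b k by rewrite mulr_ge0.
      rewrite -subr_ge0.
      have -> : (x + 3) * (4 * b k) - x * (4 - e ^+ 2) * b k
        = x * e ^+ 2 * b k + 12 * b k by ring.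
      by lra.
    apply: ler_wpM2l; first by lra.
    have -> : 4 / e * b k.+1 = 4 * (b k.+1 / e) by ring.
    by apply: ler_wpM2l => //; rewrite ler_pdivlMr // mulrC.
  by apply: (le_trans (lerD h1 h2)); rewrite -mulrDr -mulrDl.
elim: j => [|j IH]; first by rewrite addn0 mul1r.
rewrite addnS exprS -mulrA; apply: (le_trans (step _)).
exact: ler_wpM2l.
Qed.

End Motzkin.

(** * The series solution *)

Section Solution.
Variables (R : realType) (X : finType) (m : nat) (i0 : 'I_m) (Q : X -> seq 'I_m).
Notation I := {ffun X -> nat}.
Implicit Types (p : I) (w : seq 'I_m).
Notation cf := (coef R Q).

Lemma deg_pred p x : (0 < p x)%N -> deg p = (deg (pred_index p x)).+1.
Proof.
move=> px; rewrite /deg (bigD1 x) // [in RHS](bigD1 x) //= ffunE eqxx subn1.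
rewrite -addSn prednK //; congr (_ + _)%N.
by apply: eq_bigr => y yx; rewrite ffunE (negPf yx) subn0.
Qed.

Lemma add_sub_index p p' : p' \in below p -> add_index p' (sub_index p p') = p.
Proof.
by rewrite mem_below => /forallP h; apply/ffunP => x; rewrite !ffunE subnKC.
Qed.

Lemma deg_add p p' : deg (add_index p p') = (deg p + deg p')%N.
Proof. by rewrite /deg -big_split /=; apply: eq_bigr => x _; rewrite ffunE. Qed.

Definition splits p : seq (I * I) := [seq (p', sub_index p p') | p' <- below p].

Lemma splits_uniq p : uniq (splits p).
Proof. by rewrite map_inj_uniq ?below_uniq // => x y []. Qed.

Lemma mem_splits p (k : I * I) : (k \in splits p) = (add_index k.1 k.2 == p).
Proof.
apply/mapP/eqP => [[p' pp' ->]|<-]; first by rewrite add_sub_index.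
exists k.1.
  by rewrite mem_below; apply/forallP => x; rewrite ffunE leq_addr.
by case: k => a b /=; congr (_, _); apply/ffunP => x; rewrite !ffunE addKn.
Qed.

(** A pair of parts determines the whole, so the terms on the left are distinct terms of a product
    of two sums. The predicate [B], later a bound on the degree, is inherited by the parts. *)
Lemma sum_splits_le (f g : I -> R) (s : seq I) M N (B : pred I) :
  (forall p, 0 <= f p) -> (forall p, 0 <= g p) -> uniq s ->
  (forall p p', p \in s -> p' \in below p -> B p' /\ B (sub_index p p')) ->
  (forall s', uniq s' -> all B s' -> \sum_(p <- s') f p <= M) ->
  (forall s', uniq s' -> all B s' -> \sum_(p <- s') g p <= N) ->
  \sum_(p <- s) \sum_(p' <- below p) f p' * g (sub_index p p') <= M * N.
Proof.
move=> f0 g0 us hB hM hN.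
pose L := [seq k | p <- s, k <- splits p].
pose s1 := undup (map fst L); pose s2 := undup (map snd L).
have uL : uniq L.
  apply: allpairs_uniq_dep => //; first by move=> p _; apply: splits_uniq.
  move=> [p k] [p' k'] /allpairsPdep[q [l [qs ls [-> ->]]]].
  move=> /allpairsPdep[q' [l' [qs' ls' [-> ->]]]] /= e; rewrite -e.
  move: ls ls'; rewrite -e !mem_splits => /eqP <- /eqP <-.
  by [].
have B1 : all B s1 /\ all B s2.
  split; apply/allP => q; rewrite mem_undup => /mapP[_ /allpairsPdep[p [_ [ps /mapP[p' pp' ->] ->]]] ->];
  by have [] := hB p p' ps pp'.
apply: (@le_trans _ _ (\sum_(i <- s1) \sum_(j <- s2) f i * g j)); last first.
  under eq_bigr do rewrite -mulr_sumr.
  rewrite -mulr_suml; apply: ler_pM; try by apply: sumr_ge0.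
    by apply: hM; [apply: undup_uniq|case: B1].
  by apply: hN; [apply: undup_uniq|case: B1].
have -> : \sum_(p <- s) \sum_(p' <- below p) f p' * g (sub_index p p') =
   \sum_(k <- L) f k.1 * g k.2.
  rewrite big_allpairs_dep /=; apply: eq_bigr => p _.
  by rewrite /splits big_map.
rewrite -(big_allpairs_dep (h := fun i j : I => (i, j)) (r1 := s1) (r2 := fun=> s2)
    (F := fun k => f k.1 * g k.2)) /=.
apply: sum_subset => // [k kL|k]; last by rewrite mulr_ge0.
apply/allpairsP; exists k; split; try by rewrite mem_undup map_f.
by case: k {kL}.
Qed.

Section Bound.
Variables (e r : R).
Hypotheses (e0 : 0 < e) (e1 : e <= 1) (r0 : 0 <= r).
Let K : R := 2 * e + 4 / e.
(** Total weight of absorbing a star: [size (Q x)] possible letters, each choice lengthening the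
    word by one less than the size, at a cost [K] per letter. *)
Hypothesis rC : r * (\sum_x (size (Q x))%:R * K ^+ (size (Q x)).-1) <= e.
Let b := motzkin e.

Let u0 w p : 0 <= cf w p * mon (fun=> r) p.
Proof. by rewrite mulr_ge0 ?coef_ge0 ?mon_pos. Qed.

Let b0 : forall n, 0 <= b n. Proof. exact: motzkin_ge0. Qed.

(* Truncating the degree at [N] makes the recursion for the coefficients well
   founded, since its second term lengthens the word but lowers the degree. *)
Let bounded N w := forall s : seq I, uniq s -> all (fun p => (deg p <= N)%N) s ->
  \sum_(p <- s) cf w p * mon (fun=> r) p <= b (size w).

Let bounded_nil N : bounded N [::].
Proof.
move=> s us _; rewrite /b motzkin0.
under eq_bigr do rewrite (coef_nil _ i0).
have [z|z] := boolP ([ffun => 0%N] \in s); last first.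
  by rewrite big_seq big1 // => p ps; rewrite (negPf (memPn z p ps)) mul0r.
rewrite (bigD1_seq _ z us) /= eqxx mul1r big1 => [|p /negPf ->]; last by rewrite mul0r.
by rewrite addr0 /mon big1 // => x _; rewrite ffunE.
Qed.

Let K1 : 1 <= K.
Proof.
have [e0' e1'] := (e0, e1).
have : 1 <= e^-1 by rewrite invf_ge1.
by rewrite /K; lra.
Qed.

(** The recursion is matched with that of [b] term by term: splits with [mconv], absorptions with
    [e * b (size w)] through [rC] and [motzkin_ratio]. *)
Let bounded_cons N i w : (forall w', (size w' <= size w)%N -> bounded N w') ->
  (forall w', (0 < N)%N -> bounded N.-1 w') -> bounded N (i :: w).
Proof.
move=> hw hN s us /allP hs.
rewrite (eq_bigr _ (fun p _ => coef_mon_cons i0 Q (fun=> r) i w p)) big_split /=.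
rewrite /b motzkinS addrC; apply: lerD; last first.
  rewrite exchange_big /= /mconv -/b.
  apply: (@le_trans _ _ (\sum_(k < size w | nth i w k == i) b k * b ((size w).-1 - k)%N)); last first.
    rewrite [leLHS]big_mkcond; apply: ler_sum => k _; case: ifP => // _.
    by rewrite mulr_ge0.
  apply: ler_sum => k _; rewrite mulrC.
  apply: (@sum_splits_le (fun p => cf (drop k.+1 w) p * mon (fun=> r) p)
    (fun p => cf (take k w) p * mon (fun=> r) p) s _ _ (fun p => (deg p <= N)%N)) => //.
  - move=> p p' ps pp'; have := hs p ps; rewrite -{1}(add_sub_index pp') deg_add.
    by move=> h; split; lia.
  - move=> s' us' hs'; have -> : ((size w).-1 - k = size (drop k.+1 w))%N.
      by rewrite size_drop; lia.
    by apply: hw => //; rewrite size_drop leq_subr.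
  - move=> s' us' hs'; have {2}-> : (nat_of_ord k = size (take k w))%N.
      by rewrite size_take ltn_ord.
    by apply: hw => //; rewrite size_take ltn_ord; apply: ltnW.
rewrite exchange_big /=.
apply: (@le_trans _ _ (\sum_x (size (Q x))%:R * (r * (K ^+ (size (Q x)).-1 * b (size w))))); last first.
  have -> : \sum_x (size (Q x))%:R * (r * (K ^+ (size (Q x)).-1 * b (size w)))
     = r * (\sum_x (size (Q x))%:R * K ^+ (size (Q x)).-1) * b (size w).
    by rewrite mulr_sumr mulr_suml; apply: eq_bigr => x _; ring.
  exact: ler_wpM2r.
apply: ler_sum => x _; rewrite exchange_big /=.
apply: (@le_trans _ _ (\sum_(l < size (Q x)) r * (K ^+ (size (Q x)).-1 * b (size w)))); last first.
  by rewrite sumr_const card_ord -[_ *+ _]mulr_natl.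
have c0 : 0 <= r * (K ^+ (size (Q x)).-1 * b (size w)).
  by rewrite !mulr_ge0 // exprn_ge0 // (le_trans _ K1).
rewrite [leLHS]big_mkcond; apply: ler_sum => l _; case: ifP => // _.
rewrite -mulr_sumr; apply: ler_wpM2l => //; set w' := drop _ _ ++ _.
pose s' := [seq pred_index p x | p <- s & (0 < p x)%N].
have -> : \sum_(p <- s) (0 < p x)%N%:R * (cf w' (pred_index p x) * mon (fun=> r) (pred_index p x))
   = \sum_(p <- s') cf w' p * mon (fun=> r) p.
  rewrite big_map big_filter [RHS]big_mkcond /=; apply: eq_bigr => p _.
  by case: (0 < p x)%N; rewrite ?mul1r ?mul0r.
have us' : uniq s'.
  rewrite map_inj_in_uniq ?filter_uniq // => p p'; rewrite !mem_filter.
  move=> /andP[px _] /andP[px' _] /ffunP h; apply/ffunP => y; have := h y.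
  rewrite !ffunE; case: eqP => [->|_]; rewrite ?subn0 // !subn1 => h'.
  by rewrite -(prednK px) -(prednK px') h'.
have sw : size w' = (size w + (size (Q x)).-1)%N.
  rewrite /w' !size_cat size_drop size_take ltn_ord; have := ltn_ord l; lia.
apply: (@le_trans _ _ (b (size w'))); last by rewrite sw; apply: motzkin_ratio.
(* For [N = 0] the multi-indices of [s] contain no star to absorb, and the sum is empty. *)
have [N0|N0] := posnP N.
  rewrite (_ : s' = [::]) ?big_nil //.
  apply/eqP; rewrite -size_eq0 size_map size_filter -leqn0 -ltnS ltnNge -has_count.
  apply/hasPn => p ps; rewrite -leqNgt (leq_trans (le_deg p x)) // -N0; exact: hs.
apply: hN => //; apply/allP => _ /mapP[p + ->]; rewrite mem_filter => /andP[px ps].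
by have := hs p ps; rewrite (deg_pred px); lia.
Qed.

Lemma coef_sum_bound w (s : seq I) : uniq s ->
  \sum_(p <- s) cf w p * mon (fun=> r) p <= b (size w).
Proof.
move=> us; have h N : forall w', bounded N w'.
  elim: N => [|N IHN] w'; have [k] := ubnP (size w');
    elim: k w' => // k IH [|i w'] wk; try exact: bounded_nil.
    by apply: bounded_cons => // w'' le; apply: IH; apply: leq_ltn_trans le wk.
  by apply: bounded_cons => // w'' le; apply: IH; apply: leq_ltn_trans le wk.
(* A finite family has bounded degree, and the truncated bound does not depend on the truncation. *)
apply: (h (\max_(p <- s) deg p)%N) => //; apply/allP => p ps.
by rewrite (big_rem p) //= leq_maxl.
Qed.

Section Weights.
Variable t : X -> R.
Hypothesis tr : forall x, `|t x| <= r.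

Lemma coef_mon_bounded w : abs_bounded (fun p => cf w p * mon t p) (b (size w)).
Proof.
move=> s us; apply: le_trans (coef_sum_bound w us); apply: ler_sum => p _.
rewrite normrM mon_norm ger0_norm ?coef_ge0 //; apply: ler_wpM2l; first exact: coef_ge0.
by apply: mon_le => x; rewrite normr_ge0 /=.
Qed.

(** The series converges under the hypotheses of the section, by [tauP], so the default 0 is never
    the reason for a value. *)
Definition tau w : R := xget 0 [set v | has_sum (fun p => cf w p * mon t p) v].

Lemma tauP w : has_sum (fun p => cf w p * mon t p) (tau w).
Proof.
by have [v hv] := has_sum_exists (coef_mon_bounded w); apply: (@xgetI _ 0 _ v).
Qed.

Lemma tau_bound w : `|tau w| <= b (size w).
Proof. exact: has_sum_le (coef_mon_bounded w) (tauP w). Qed.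

Lemma tau_nil : tau [::] = 1.
Proof.
apply: has_sum_unique (tauP [::]) _.
have -> : 1 = \sum_(p <- [:: [ffun=> 0%N] : I]) cf [::] p * mon t p.
  rewrite big_seq1 (coef_nil _ i0) eqxx mul1r /mon big1 // => x _.
  by rewrite ffunE.
apply: has_sum_fin => // p; rewrite inE (coef_nil _ i0) => /negPf ->.
by rewrite mul0r.
Qed.

(** The recursion of the coefficients is summed: splits form a Cauchy product, regrouped along
    [add_index], and absorptions a series shifted by one in the exponent of [x]. *)
Lemma tau_cons i w : tau (i :: w) =
  \sum_(k < size w | nth i w k == i) tau (drop k.+1 w) * tau (take k w) +
  \sum_x \sum_(l < size (Q x) | nth i (Q x) l == i)
    t x * tau (drop l.+1 (Q x) ++ take l (Q x) ++ w).
Proof.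
apply: has_sum_unique (tauP (i :: w)) _.
apply: eq_has_sum (fun p => esym (coef_mon_cons i0 Q t i w p)) _.
apply: has_sumD; last first.
  apply: has_sum_sum => x _; apply: has_sum_sum => l _; apply: has_sumZ.
  set w' := drop _ _ ++ _.
  have h := has_sum_embed (f := fun p => up_index p x) (g := fun p => pred_index p x)
    (P := fun p : I => (0 < p x)%N) (tauP w').
  apply: eq_has_sum (h _) => [p|p q]; last exact: up_indexE.
  by case: posnP => _; rewrite ?mul1r ?mul0r.
apply: has_sum_sum => k _.
have := has_sum_prod (coef_mon_bounded (drop k.+1 w)) (coef_mon_bounded (take k w))
  (tauP _) (tauP _).
move=> h; apply: eq_has_sum (has_sum_finite_fiber
  (pi := fun k : I * I => add_index k.1 k.2) (l := splits) h splits_uniq mem_splits).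
by move=> p; rewrite /splits big_map.
Qed.

(** The mirror symmetry [star_maps_rev], combined with a reindexing of the series along [f]. Later
    [f] exchanges each monomial of the potential with its adjoint. *)
Lemma tau_rev (f : X -> X) w : involutive f -> (forall x, Q (f x) = rev (Q x)) ->
  (forall x, t (f x) = t x) -> tau (rev w) = tau w.
Proof.
move=> fK Qf tf; pose g (p : I) : I := [ffun x => p (f x)].
have gK : involutive g by move=> p; apply/ffunP => x; rewrite !ffunE fK.
apply: has_sum_unique (tauP (rev w)) _.
have h := has_sum_finite_fiber (pi := g) (l := fun p => [:: g p]) (tauP w) (fun=> erefl).
apply: eq_has_sum (h _) => [p|p k]; last first.
  by rewrite inE; apply/eqP/eqP => [->|<-]; rewrite gK.
have finj : injective f by apply: inv_inj.
rewrite big_seq1; congr (_ * _).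
  rewrite /coef; congr (_%:R / _).
    rewrite /nmaps -(star_maps_rev i0 w) -map_comp.
    rewrite (eq_map (g := Q \o f)); last by move=> x; rewrite /= Qf.
    rewrite (map_comp Q f) (star_maps_content i0); congr nmaps; apply/ffunP => x.
    rewrite ffunE count_map -[RHS](_ : g p (f x) = p x); last by rewrite ffunE fK.
    rewrite -count_types; apply: eq_count => y /=.
    by rewrite -(inj_eq finj) fK.
  rewrite /ifact (reindex_inj finj) /=; apply: eq_bigr => x _.
  by rewrite ffunE fK.
rewrite /mon (reindex_inj finj) /=; apply: eq_bigr => x _.
by rewrite ffunE fK tf.
Qed.

End Weights.
End Bound.
End Solution.

(** * Uniqueness *)

Section Modulus.
Local Open Scope complex_scope.
Variable R : realType.
Implicit Types (x y : R[i]).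

Definition modulus x : R := complex.Re `|x|.

Lemma modulusE x : `|x| = (modulus x)%:C.
Proof. by rewrite /modulus normc_def. Qed.

Lemma modulus_ge0 x : 0 <= modulus x.
Proof. by rewrite -lecR -modulusE; exact: normr_ge0. Qed.

Lemma modulusD x y : modulus (x + y) <= modulus x + modulus y.
Proof. by rewrite -lecR rmorphD -!modulusE; exact: ler_normD. Qed.

Lemma modulusM x y : modulus (x * y) = modulus x * modulus y.
Proof. by apply: complexI; rewrite rmorphM -!modulusE normrM. Qed.

Lemma modulus0 : modulus 0 = 0.
Proof. by apply: complexI; rewrite -modulusE normr0. Qed.

Lemma modulus_sum (J : Type) (l : seq J) (P : pred J) (f : J -> R[i]) :
  modulus (\sum_(j <- l | P j) f j) <= \sum_(j <- l | P j) modulus (f j).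
Proof.
elim: l => [|j l IH]; first by rewrite !big_nil modulus0.
rewrite !big_cons; case: ifP => // _.
by apply: le_trans (modulusD _ _) _; rewrite lerD2l.
Qed.

Lemma modulus_real (a : R) : modulus a%:C = `|a|.
Proof.
apply: complexI; rewrite -modulusE normc_def /= expr0n /= addr0 sqrtr_sqr //.
Qed.

Lemma modulus_eq0 x : modulus x <= 0 -> x = 0.
Proof.
by rewrite -lecR -modulusE => h; apply/eqP; rewrite -normr_le0.
Qed.

Lemma modulus_le x (a : R) : (`|x| <= a%:C) = (modulus x <= a).
Proof. by rewrite modulusE lecR. Qed.

End Modulus.

Section Uniqueness.
Local Open Scope complex_scope.
Variables (R : realType) (X : finType) (m : nat) (Q : X -> seq 'I_m).
Implicit Types (w : seq 'I_m).

Definition word_eq (t : X -> R) (x : seq 'I_m -> R[i]) :=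
  x [::] = 1 /\ forall i w, x (i :: w) =
    \sum_(k < size w | nth i w k == i) x (drop k.+1 w) * x (take k w) +
    \sum_y \sum_(l < size (Q y) | nth i (Q y) l == i)
      (t y)%:C * x (drop l.+1 (Q y) ++ take l (Q y) ++ w).

Variables (rho r : R).
Hypotheses (rho2 : 2 < rho) (r0 : 0 <= r).
Let g := 2 * rho.
Hypothesis rC : r * (\sum_y (size (Q y))%:R * g ^+ (size (Q y)).-1) <= 1.

(** The sum is the quotient of g^n - rho^n by g - rho, and the choice [g = 2 * rho] makes this
    denominator [rho]. *)
Let geom n : \sum_(k < n) g ^+ k * rho ^+ (n.-1 - k) <= g ^+ n / rho.
Proof.
have rho2' := rho2.
elim: n => [|n IH].
  by rewrite big_ord0 divr_ge0 ?ler01 //; lra.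
rewrite big_ord_recr /= subnn mulr1.
have -> : \sum_(i < n) g ^+ i * rho ^+ (n - i) = (\sum_(i < n) g ^+ i * rho ^+ (n.-1 - i)) * rho.
  rewrite mulr_suml; apply: eq_bigr => k _.
  have -> : (n - k = (n.-1 - k).+1)%N by have := ltn_ord k; lia.
  by rewrite exprSr; ring.
have rho0 : 0 < rho by lra.
apply: (@le_trans _ _ (g ^+ n / rho * rho + g ^+ n)).
  by apply: lerD => //; apply: ler_wpM2r => //; apply: ltW.
rewrite exprSr /g le_eqVlt; apply/orP; left; apply/eqP.
by field; rewrite gt_eqF.
Qed.

Lemma word_eq_unique (t : X -> R) x y : (forall z, `|t z| <= r) ->
  word_eq t x -> word_eq t y ->
  (forall w, modulus (x w) <= rho ^+ size w) ->
  (forall w, modulus (y w) <= rho ^+ size w) -> x =1 y.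
Proof.
move=> tr [x0 xE] [y0 yE] xb yb.
have rho2' := rho2; have r0' := r0.
have g0 : 0 < g by rewrite /g; lra.
have g1 : 1 <= g by rewrite /g; lra.
have rho0 : 0 <= rho by lra.
(* Contraction by 3/4 in the norm that weighs a word [w] by [(2 rho)^-|w|]. *)
have key j : forall w, modulus (x w - y w) <= 2 * (3 / 4) ^+ j * g ^+ size w.
  elim: j => [|j IH] w.
    rewrite expr0 mulr1; apply: le_trans (modulusD _ _) _.
    have -> : modulus (- y w) = modulus (y w) by rewrite /modulus normrN.
    have : rho ^+ size w <= g ^+ size w by apply: lerXn2r; rewrite ?nnegrE // /g; lra.
    by have := xb w; have := yb w; lra.
  set D := 2 * (3 / 4) ^+ j in IH.
  have D0 : 0 <= D by rewrite /D mulr_ge0 // exprn_ge0 //; lra.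
  have -> : 2 * (3 / 4) ^+ j.+1 = D * (3 / 4) by rewrite /D exprSr mulrA.
  case: w => [|i w].
    by rewrite x0 y0 subrr modulus0 mulr_ge0 ?exprn_ge0 ?(ltW g0) // mulr_ge0 //; lra.
  rewrite xE yE opprD addrACA -!sumrB /=.
  apply: le_trans (modulusD _ _) _.
  set n := size w.
  have h1 : modulus (\sum_(k < n | nth i w k == i)
      (x (drop k.+1 w) * x (take k w) - y (drop k.+1 w) * y (take k w))) <=
      D * (g ^+ n / rho) + D * (g ^+ n / rho).
    apply: (@le_trans _ _ (\sum_(k < n) (D * (g ^+ k * rho ^+ (n.-1 - k)) +
        D * (g ^+ (n.-1 - k) * rho ^+ k)))).
      apply: le_trans (modulus_sum _ _ _) _.
      have pos k : 0 <= D * (g ^+ k * rho ^+ (n.-1 - k)) + D * (g ^+ (n.-1 - k) * rho ^+ k).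
        by apply: addr_ge0; apply: mulr_ge0 => //; apply: mulr_ge0; apply: exprn_ge0; lra.
      rewrite [leLHS]big_mkcond; apply: ler_sum => k _; case: ifP => // _.
      have s1 : size (take k w) = k by rewrite size_take ltn_ord.
      have s2 : size (drop k.+1 w) = (n.-1 - k)%N by rewrite size_drop /n; lia.
      set a := x (drop _ _); set b := x (take _ _).
      set c := y (drop _ _); set d := y (take _ _).
      (* In each product one factor is a solution, bounded through [rho], and the other a
         difference, to which the induction hypothesis applies. *)
      have -> : a * b - c * d = a * (b - d) + (a - c) * d by ring.
      apply: le_trans (modulusD _ _) _; rewrite !modulusM; apply: lerD.
        have -> : D * (g ^+ k * rho ^+ (n.-1 - k)) = rho ^+ (n.-1 - k) * (D * g ^+ k) by ring.
        apply: ler_pM; rewrite ?modulus_ge0 //; first by rewrite -s2; apply: xb.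
        by rewrite -[X in g ^+ X]s1; apply: IH.
      have -> : D * (g ^+ (n.-1 - k) * rho ^+ k) = (D * g ^+ (n.-1 - k)) * rho ^+ k by ring.
      apply: ler_pM; rewrite ?modulus_ge0 //; first by rewrite -s2; apply: IH.
      by rewrite -[X in rho ^+ X]s1; apply: yb.
    rewrite big_split /= -!mulr_sumr; apply: lerD; apply: ler_wpM2l => //.
      exact: geom.
    rewrite (reindex_inj rev_ord_inj) /=.
    apply: (le_trans _ (geom n)); rewrite le_eqVlt; apply/orP; left; apply/eqP.
    apply: eq_bigr => k _; have := ltn_ord k => kn.
    by congr (_ ^+ _ * _ ^+ _); lia.
  have h2 : modulus (\sum_z
       (\sum_(l < size (Q z) | nth i (Q z) l == i) (t z)%:C * x (drop l.+1 (Q z) ++ take l (Q z) ++ w) -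
        \sum_(l < size (Q z) | nth i (Q z) l == i) (t z)%:C * y (drop l.+1 (Q z) ++ take l (Q z) ++ w)))
       <= D * g ^+ n.
    apply: (@le_trans _ _ (\sum_z (size (Q z))%:R * (r * (D * g ^+ ((size (Q z)).-1 + n))))); last first.
      have -> : \sum_z (size (Q z))%:R * (r * (D * g ^+ ((size (Q z)).-1 + n))) =
         (r * (\sum_z (size (Q z))%:R * g ^+ (size (Q z)).-1)) * (D * g ^+ n).
        by rewrite mulr_sumr mulr_suml; apply: eq_bigr => z _; rewrite exprD; ring.
      by rewrite -[leRHS]mul1r; apply: ler_wpM2r => //; rewrite mulr_ge0 // exprn_ge0 // ltW.
    apply: le_trans (modulus_sum _ _ _) _; apply: ler_sum => z _.
    rewrite -sumrB; apply: le_trans (modulus_sum _ _ _) _.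
    apply: (@le_trans _ _ (\sum_(l < size (Q z)) r * (D * g ^+ ((size (Q z)).-1 + n)))); last first.
      by rewrite sumr_const card_ord -[_ *+ _]mulr_natl.
    rewrite [leLHS]big_mkcond; apply: ler_sum => l _.
    case: ifP => _; last by apply: mulr_ge0 => //; apply: mulr_ge0 => //; apply: exprn_ge0; lra.
    rewrite -mulrBr modulusM modulus_real; apply: ler_pM; rewrite ?modulus_ge0 //.
    have -> : ((size (Q z)).-1 + n = size (drop l.+1 (Q z) ++ take l (Q z) ++ w))%N.
      by rewrite !size_cat size_drop size_take ltn_ord /n; have := ltn_ord l; lia.
    exact: IH.
  apply: le_trans (lerD h1 h2) _.
  have G0 : 0 <= D * g ^+ n by rewrite mulr_ge0 // exprn_ge0 // ltW.
  (* The quadratic part contributes [2 / rho] and the potential 1, at most 2 in all, whereas the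
     allowance [3 / 4 * g] exceeds 3. *)
  have rhoi : rho^-1 <= 2^-1 by rewrite lef_pV2 ?posrE; lra.
  have -> : D * (g ^+ n / rho) + D * (g ^+ n / rho) + D * g ^+ n = (D * g ^+ n) * (2 * rho^-1 + 1) by ring.
  have -> : D * (3 / 4) * g ^+ n.+1 = (D * g ^+ n) * (3 / 2 * rho) by rewrite exprSr /g; field.
  apply: ler_wpM2l => //; lra.
move=> w; apply/eqP; rewrite -subr_eq0; apply/eqP/modulus_eq0.
pose C := 2 * g ^+ size w; have C0 : 0 < C by rewrite mulr_gt0 // exprn_gt0.
have q1 : `|3 / 4 : R| < 1 by rewrite ger0_norm; lra.
apply/ler_addgt0Pr => e e0; rewrite add0r; have eC : 0 < e / C by rewrite divr_gt0.
have [N _ /(_ N (leqnn N))] := (cvgrPdist_le _ _).1 (cvg_expr q1) _ eC.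
rewrite /= sub0r normrN => /(le_trans (ler_norm _)) hN; apply: le_trans (key N w) _.
by rewrite mulrAC -/C mulrC -ler_pdivlMr.
Qed.

End Uniqueness.

(** * The Schwinger-Dyson equation on words *)

Section LinearExtension.
Local Open Scope complex_scope.
Variables (K : choiceType) (R : comNzRingType) (V : lmodType R).
Implicit Types (h : K -> V) (P : malg K R).

(** The common shape, up to unfolding, of [ncder], [cycder] and [tensor_form], whose linearity is
    thus proved once. *)
Definition lext h P : V := \sum_(k <- msupp P) mcoeff k P *: h k.

Lemma lextEw h P (d : {fset K}) : (msupp P `<=` d)%fset ->
  lext h P = \sum_(k <- d) mcoeff k P *: h k.
Proof.
move=> sub; rewrite /lext [RHS](bigID (mem (msupp P))) /= [X in _ + X]big1 ?addr0; last first.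
  by move=> k; rewrite -mcoeff_eq0 => /eqP ->; rewrite scale0r.
rewrite -[RHS]big_filter; apply: perm_big; apply: uniq_perm; rewrite ?filter_uniq ?fset_uniq //.
move=> k; rewrite mem_filter /=; case kP : (k \in msupp P) => //=.
by rewrite (fsubsetP sub).
Qed.

Lemma lext_linear h a P P' : lext h (a *: P + P') = a *: lext h P + lext h P'.
Proof.
pose d := (msupp P `|` msupp P' `|` msupp (a *: P + P'))%fset.
rewrite !(@lextEw _ _ d) /d; first last.
- by rewrite fsubsetUr.
- by rewrite -fsetUA fsubsetUl.
- by rewrite fsetUC fsetUA fsubsetUr.
rewrite scaler_sumr -big_split /=; apply: eq_bigr => k _.
by rewrite mcoeffD mcoeffZ scalerDl scalerA.
Qed.

Lemma lextU h k c : lext h (mkmalgU k c) = c *: h k.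
Proof.
rewrite (lextEw _ (@msuppU_le _ _ k c)) big_seq_fset1 mcoeffUU //.
Qed.

End LinearExtension.

Section FreeAlgebra.
Local Open Scope complex_scope.
Variables (R : realType) (m : nat).
Notation C := R[i].
Implicit Types (w : seq 'I_m) (P : ncpoly R m).
Let W : seq 'I_m -> word m := @FMonom _.
Let mon w : ncpoly R m := ncmon R (W w).

Lemma ncmonM w w' : mon w * mon w' = mon (w ++ w').
Proof. by rewrite /mon /ncmon malgM_def fgmulUU mulr1 /= /mmul /= fmmulE. Qed.

Lemma ncmon1 : mon [::] = 1.
Proof. by rewrite /mon /ncmon /W -fmoneE. Qed.

Lemma ncpolyE P : P = \sum_(w <- msupp P) mcoeff w P *: ncmon R w.
Proof.
rewrite {1}[P]monalgE; apply: eq_bigr => w _; apply/malgP => k.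
by rewrite mcoeffZ /ncmon !mcoeffU mulr_natr.
Qed.

Lemma mul_scale_mon P (c : C) w : P * (c *: mon w) = c *: (P * mon w).
Proof.
rewrite [P]ncpolyE !mulr_suml scaler_sumr; apply: eq_bigr => v _.
rewrite -!scalerAl scalerA [c * _]mulrC -scalerA; congr (_ *: _).
have -> : c *: mon w = mkmalgU (W w) c.
  by apply/malgP => k; rewrite mcoeffZ /mon /ncmon !mcoeffU mulr_natr.
have -> : ncmon R v = mon v by rewrite /mon /W fmK.
rewrite ncmonM /mon /ncmon malgM_def fgmulUU mul1r /mmul /= fmmulE.
by apply/malgP => k; rewrite mcoeffZ !mcoeffU mulr_natr.
Qed.

Lemma msupp_mon w : msupp (mon w) = [fset W w]%fset.
Proof. by rewrite /mon /ncmon msuppU oner_eq0. Qed.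

Lemma ncder_mon i w : ncder i (mon w) =
  \sum_(k < size w | nth i w k == i) mkmalgU (W (take k w), W (drop k.+1 w)) 1.
Proof.
rewrite /ncder msupp_mon big_seq_fset1 mcoeffUU scale1r.
by apply: eq_bigl => k; rewrite (tnth_nth i).
Qed.

Lemma cycder_mon i w : cycder i (mon w) =
  \sum_(k < size w | nth i w k == i) mon (drop k.+1 w ++ take k w).
Proof.
rewrite /cycder msupp_mon big_seq_fset1 mcoeffUU scale1r.
by apply: eq_bigl => k; rewrite (tnth_nth i).
Qed.

Lemma ncstar_mon w : ncstar (mon w) = mon (rev w).
Proof. by rewrite /ncstar msupp_mon big_seq_fset1 mcoeffUU rmorph1. Qed.

Lemma cycder_linear i a P P' : cycder i (a *: P + P') = a *: cycder i P + cycder i P'.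
Proof. exact: (lext_linear (fun w : word m => \sum_(k < size w | tnth (in_tuple w) k == i) ncmon R (W (drop k.+1 w ++ take k w)))). Qed.

Lemma ncder_linear i a P P' : ncder i (a *: P + P') = a *: ncder i P + ncder i P'.
Proof.
exact: (lext_linear (fun w : word m => \sum_(k < size w | tnth (in_tuple w) k == i)
  (mkmalgU (W (take k w), W (drop k.+1 w)) 1 : nctensor R m))).
Qed.

Lemma tensor_form_linear (tau : ncpoly R m -> C) a T T' :
  tensor_form tau (a *: T + T') = a * tensor_form tau T + tensor_form tau T'.
Proof.
exact: (@lext_linear _ C C^o (fun uv : word m * word m => tau (ncmon R uv.1) * tau (ncmon R uv.2))).
Qed.

Lemma tensor_formU (tau : ncpoly R m -> C) u v :
  tensor_form tau (mkmalgU (u, v) 1) = tau (ncmon R u) * tau (ncmon R v).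
Proof.
rewrite -[LHS]/(@lext _ C C^o (fun uv : word m * word m => tau (ncmon R uv.1) * tau (ncmon R uv.2)) _).
by rewrite lextU scale1r.
Qed.

Lemma linear_sum (V V' : lmodType C) (f : V -> V') : linear f ->
  forall (J : Type) (l : seq J) (Pr : pred J) (a : J -> C) (v : J -> V),
  f (\sum_(j <- l | Pr j) a j *: v j) = \sum_(j <- l | Pr j) a j *: f (v j).
Proof.
move=> lf J l Pr a v; elim: l => [|j l IH].
  rewrite !big_nil; have := lf 1 0 0; rewrite !scale1r addr0 => e.
  by apply: (@addrI _ (f 0)); rewrite addr0 -e.
by rewrite !big_cons; case: ifP => // _; rewrite lf IH.
Qed.

(** A monomial and its adjoint are two types of stars even when they coincide as words, in agreement
    with the binomials of [Mstar]. *)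
Definition pot_word n (q : 'I_n -> word m) (x : 'I_n * bool) : seq 'I_m :=
  if x.2 then fmonom_val (q x.1) else rev (fmonom_val (q x.1)).

(** The sign comes from solving the equation for [tau (X_i P)], which moves the potential to the
    other side. *)
Definition pot_weight n (t : 'rV[R]_n) (x : 'I_n * bool) : R := - t 0 x.1.

Lemma cycder_potential n (q : 'I_n -> word m) (t : 'rV[R]_n) i :
  cycder i (potential q t) =
  \sum_j ((t 0 j)%:C) *: (cycder i (mon (q j)) + cycder i (mon (rev (q j)))).
Proof.
rewrite /potential (linear_sum (cycder_linear i)); apply: eq_bigr => j _.
congr (_ *: _); have -> : ncmon R (q j) = mon (q j) by rewrite /mon /W fmK.
rewrite ncstar_mon; have := cycder_linear i 1 (mon (q j)) (mon (rev (q j))).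
by rewrite !scale1r.
Qed.

(** Both sides of the equation are linear in [P], so monomials suffice; there the summand [ncX R i]
    isolates the longer word [i :: w]. *)
Lemma schwinger_dysonP n (q : 'I_n -> word m) (t : 'rV[R]_n) (tau : {scalar ncpoly R m}) :
  schwinger_dyson (potential q t) tau <->
  word_eq (pot_word q) (pot_weight t) (fun w => tau (mon w)).
Proof.
have key i w : tensor_form tau (ncder i (mon w)) =
    \sum_(k < size w | nth i w k == i) tau (mon (take k w)) * tau (mon (drop k.+1 w)).
  rewrite ncder_mon.
  have := linear_sum (V' := C^o) (tensor_form_linear tau) (index_enum 'I_(size w))
    (fun k => nth i w k == i) (fun _ => 1)
    (fun k => (mkmalgU (W (take k w), W (drop k.+1 w)) 1 : nctensor R m)).
  under eq_bigr do rewrite scale1r.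
  move=> ->; apply: eq_bigr => k _.
  by rewrite [LHS]mul1r tensor_formU.
have tauZ a v : tau (a *: v) = a * tau v by exact: linearZ.
have tauD u v : tau (u + v) = tau u + tau v by exact: raddfD.
have tauS := raddf_sum tau.
have key2 i w : tau ((cycder i (potential q t) + ncX R i) * mon w) = tau (mon (i :: w)) -
    \sum_y \sum_(l < size (pot_word q y) | nth i (pot_word q y) l == i)
      (pot_weight t y)%:C * tau (mon (drop l.+1 (pot_word q y) ++ take l (pot_word q y) ++ w)).
  have -> : ncX R i = mon [:: i] by rewrite /ncX fmuE.
  rewrite mulrDl ncmonM tauD addrC; congr (_ + _).
  have cm u : tau (cycder i (mon u) * mon w) =
     \sum_(l < size u | nth i u l == i) tau (mon (drop l.+1 u ++ take l u ++ w)).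
    by rewrite cycder_mon mulr_suml tauS; apply: eq_bigr => l _; rewrite ncmonM -catA.
  have ct j : tau ((t 0 j)%:C *: (cycder i (mon (q j)) + cycder i (mon (rev (q j)))) * mon w) =
     (t 0 j)%:C * (tau (cycder i (mon (q j)) * mon w) + tau (cycder i (mon (rev (q j))) * mon w)).
    by rewrite -tauD -mulrDl -tauZ; congr (tau _); rewrite scalerAl.
  rewrite cycder_potential mulr_suml tauS -sumrN /=.
  rewrite -(pair_bigA _ (fun j b => - \sum_(l < size (pot_word q (j, b)) | nth i (pot_word q (j, b)) l == i)
      (pot_weight t (j, b))%:C * tau (mon (drop l.+1 (pot_word q (j, b)) ++ take l (pot_word q (j, b)) ++ w)))) /=.
  apply: eq_bigr => j _.
  apply: etrans (etrans (ct j) (congr1 (fun z => (t 0 j)%:C * z)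
    (f_equal2 +%R (cm (q j)) (cm (rev (q j)))))) _.
  rewrite big_bool.
  rewrite /pot_weight /pot_word /= rmorphN -!mulr_sumr !mulNr !opprK -mulrDr //.
split=> [[t1 sd]|[x0 xE]].
  split=> [|i w]; first by rewrite ncmon1.
  have := sd i (mon w); rewrite key key2 => /eqP; rewrite eq_sym subr_eq => /eqP ->.
  by congr (_ + _); apply: eq_bigr => k _; rewrite mulrC.
split=> [|i P]; first by rewrite -ncmon1.
rewrite [P]ncpolyE (linear_sum (ncder_linear i)).
rewrite (linear_sum (V' := C^o) (tensor_form_linear tau)) mulr_sumr tauS /=.
apply: eq_bigr => w _.
have -> : ncmon R w = mon w by rewrite /mon /W fmK.
rewrite mul_scale_mon tauZ; congr (_ * _).
rewrite key key2 xE addrK.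
by apply: eq_bigr => k _; rewrite mulrC.
Qed.

Section Form.
Variable x : seq 'I_m -> C.

Definition word_form (P : ncpoly R m) : C := @lext _ C C^o (fun w : word m => x w) P.

Fact word_form_linear : linear_for *%R word_form.
Proof. exact: (@lext_linear _ C C^o). Qed.

HB.instance Definition _ :=
  GRing.isLinear.Build C (ncpoly R m) C *%R word_form word_form_linear.

Lemma word_form_mon w : word_form (mon w) = x w.
Proof. by rewrite /word_form lextU scale1r. Qed.

Lemma word_form_hermitian : (forall w, x (rev w) = ((x w)^*)%R) -> hermitian_form word_form.
Proof.
move=> xr a; rewrite /ncstar raddf_sum /= {2}/word_form /lext rmorph_sum.
apply: eq_bigr => w _; rewrite /word_form lextU -[wrev w]/(W (rev w)) /= xr.
by rewrite rmorphM.
Qed.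

End Form.

Lemma scalar_ext (tau tau' : {scalar ncpoly R m}) :
  (forall w, tau (mon w) = tau' (mon w)) -> tau =1 tau'.
Proof.
have tZ (f : {scalar ncpoly R m}) : linear (f : _ -> C^o) by move=> a u v; exact: linearP.
move=> h P; rewrite [P]ncpolyE !(linear_sum (V' := C^o) (tZ _)).
by apply: eq_bigr => w _; congr (_ *: _); have := h w; rewrite /mon /W fmK.
Qed.

End FreeAlgebra.

(** * Power series in several variables *)

Section MonAdd.
Variables (R : realType) (X : finType).
Notation I := {ffun X -> nat}.
Implicit Types (p : I) (s a : X -> R).

Definition ibin p p' : R := \prod_x 'C(p x, p' x)%:R.

Lemma mon_add s a p : mon (fun x => a x + s x) p =
  \sum_(p' <- below p) ibin p p' * mon s p' * mon a (sub_index p p').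
Proof.
(* Vanishing binomials extend every expansion to the common range [deg p], so that the product of
   sums can be distributed. *)
have e x : (a x + s x) ^+ p x =
    \sum_(j < (deg p).+1) 'C(p x, j)%:R * s x ^+ j * a x ^+ (p x - j).
  rewrite exprDn (big_ord_widen_cond (deg p).+1 xpredT (fun j => (a x ^+ (p x - j) * s x ^+ j) *+ 'C(p x, j))) ?ltnS ?le_deg //=.
  rewrite big_mkcond /=; apply: eq_bigr => j _; case: ifP => h.
    by rewrite -mulr_natl; ring.
  by rewrite bin_small ?mul0r //; move: h; rewrite ltnS; lia.
rewrite /mon (eq_bigr _ (fun x _ => e x)) bigA_distr_bigA /=.
rewrite (bigID (fun f : {ffun X -> 'I_(deg p).+1} => [forall x, f x <= p x]%N)) /= addrC big1 ?add0r.
  rewrite /below big_map big_enum /=; apply: eq_big => f; first by rewrite inE.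
  move=> _; rewrite /ibin -!big_split /=; apply: eq_bigr => x _.
  by rewrite !ffunE.
move=> f; rewrite negb_forall => /existsP[x]; rewrite -ltnNge => lx.
by rewrite (bigD1 x) //= bin_small // !mul0r.
Qed.

Lemma ibin_ge0 p p' : 0 <= ibin p p'.
Proof. by apply: prodr_ge0. Qed.

End MonAdd.

Section SumExtra.
Variable R : realType.

Lemma abs_bounded_inj (I J : choiceType) (f : J -> I) (u : I -> R) M :
  injective f -> abs_bounded u M -> abs_bounded (u \o f) M.
Proof. by move=> fi b s us; have := b (map f s); rewrite map_inj_uniq // big_map; apply. Qed.

Lemma abs_boundedZ (I : choiceType) (u : I -> R) a M :
  abs_bounded u M -> abs_bounded (fun i => a * u i) (`|a| * M).
Proof.
move=> b s us; under eq_bigr do rewrite normrM; rewrite -mulr_sumr.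
by apply: ler_wpM2l => //; apply: b.
Qed.

Lemma Rcomplex_norm_real (x : R) : `|((x)%:C)%C : Rcomplex R| = `|x|.
Proof.
apply: complexI; rewrite -[LHS]/(`|(x%:C)%C|) normc_def /= expr0n /= addr0.
by rewrite sqrtr_sqr.
Qed.

Lemma has_sum_partial (I : choiceType) (u : I -> R) (v : R) : has_sum u v ->
  summability.partial_sum (fun i => ((u i)%:C)%C : Rcomplex R)
    @ summability.totally --> (((v)%:C)%C : Rcomplex R).
Proof.
move=> h; have PF := @summability.totally_filter I.
apply/cvgrPdist_le => e e0; have [s0 hs] := h e e0.
exists [fset i in s0]%fset => // B sub.
have -> : summability.partial_sum (fun i => ((u i)%:C)%C : Rcomplex R) B
   = \sum_(i <- B) (((u i)%:C)%C : Rcomplex R).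
  by rewrite [RHS]big_seq_fsetE.
have -> : \sum_(i <- B) (((u i)%:C)%C : Rcomplex R) = ((\sum_(i <- B) u i)%:C)%C.
  by rewrite rmorph_sum.
have -> : (((v)%:C)%C : Rcomplex R) - ((\sum_(i <- B) u i)%:C)%C = ((v - \sum_(i <- B) u i)%:C)%C.
  by rewrite rmorphB.
rewrite Rcomplex_norm_real distrC; apply: hs; first exact: fset_uniq.
by move=> i is0; apply: (fsubsetP sub); rewrite inE.
Qed.

End SumExtra.

Section PowerSeries.
Variables (R : realType) (n : nat).
Notation I := {ffun 'I_n -> nat}.
Implicit Types (c : I -> R) (p : I) (t : 'rV[R]_n).

(** The absolute bound at radius [r] is carried along since recentring and differentiation consume
    it; [f] is constrained only on the open cube. *)
Definition real_series (c : I -> R) (B r : R) (f : 'rV[R]_n -> Rcomplex R) :=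
  [/\ 0 < r, abs_bounded (fun p => c p * mon (fun=> r) p) B &
   forall t, (forall i, `|t 0 i| < r) -> exists2 g : R,
     has_sum (fun p => c p * mon (t 0) p) g & f t = (g%:C)%C].

Lemma ball_rV (a t : 'rV[R]_n) (r : R) :
  ball a r t <-> 0 < r /\ forall i, `|a 0 i - t 0 i| < r.
Proof.
split=> [[r0 h]|[r0 h]]; split=> //; first by move=> i; exact: (h 0 i).
by move=> i j; rewrite (ord1 i); apply: h.
Qed.

(** The double family [u s] is absolutely summable. Grouped by the sum of the two indices it is the
    series at [a + s]; grouped by the first index it is a power series in [s]. *)
Lemma recenter c B r (a : 'I_n -> R) (rho : R) :
  abs_bounded (fun p => c p * mon (fun=> r) p) B -> 0 < rho -> 0 < r ->
  (forall i, `|a i| + rho <= r) ->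
  exists d : I -> R, forall s : 'I_n -> R, (forall i, `|s i| <= rho) ->
    forall g, has_sum (fun p => c p * mon (fun i => a i + s i) p) g ->
    has_sum (fun p => d p * mon s p) g.
Proof.
move=> cb rho0 r0 ar.
pose u (s : 'I_n -> R) (k : I * I) :=
  c (add_index k.1 k.2) * ibin R (add_index k.1 k.2) k.1 * mon s k.1 * mon a k.2.
have fib s p : \sum_(k <- splits p) u s k = c p * mon (fun i => a i + s i) p.
  rewrite mon_add mulr_sumr /splits big_map big_seq [RHS]big_seq.
  by apply: eq_bigr => p' hp; rewrite /u /= add_sub_index //; ring.
have ub s : (forall i, `|s i| <= rho) -> abs_bounded (u s) B.
  move=> sr; apply: (abs_bounded_fiber (pi := fun k => add_index k.1 k.2) (l := @splits _)
    (@splits_uniq _) (@mem_splits _)) cb => p.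
  rewrite normrM [X in _ * X]ger0_norm; last by apply: mon_pos => _; apply: ltW.
  have -> : \sum_(k <- splits p) `|u s k| = `|c p| * mon (fun i => `|a i| + `|s i|) p.
    rewrite mon_add mulr_sumr /splits big_map big_seq [RHS]big_seq.
    apply: eq_bigr => p' hp; rewrite /u /= add_sub_index // !normrM !mon_norm.
    by rewrite (ger0_norm (ibin_ge0 _ _ _)); ring.
  apply: ler_wpM2l => //; apply: mon_le => i; rewrite addr_ge0 //=.
  by apply: le_trans (ar i); rewrite lerD2l.
pose v (b g : I) := c (add_index b g) * ibin R (add_index b g) b * mon a g.
(* Convergence of a new coefficient: take [s] constant equal to [rho] and divide by the nonzero
   monomial of index [b]. *)
have vs b : exists d, has_sum (v b) d.
  have hb : forall i : 'I_n, `|rho| <= rho by move=> i; rewrite gtr0_norm.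
  have m0 : 0 < mon (fun=> rho) b by apply: prodr_gt0 => x _; apply: exprn_gt0.
  have inj : injective (pair b : I -> I * I) by move=> x y [].
  have := abs_boundedZ (mon (fun=> rho) b)^-1 (abs_bounded_inj inj (ub _ hb)).
  move=> /has_sum_exists[d hd]; exists d; apply: eq_has_sum hd => g.
  by rewrite /u /v /=; field; rewrite gt_eqF.
pose d b := xget 0 [set x | has_sum (v b) x].
have dP b : has_sum (v b) (d b).
  by have [x hx] := vs b; apply: (@xgetI _ 0 _ x).
exists d => s sr g hg.
have [T hT] := has_sum_exists (ub s sr).
have gT : g = T.
  apply: has_sum_unique hg _; apply: eq_has_sum (has_sum_finite_fiber hT (@splits_uniq _) (@mem_splits _)).
  by move=> p; apply: fib.
rewrite gT; apply: (has_sum_fiber (pi := fst) hT) => b.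
rewrite mulrC; have h := has_sum_embed (f := pair b) (g := snd) (P := fun k => k.1 == b)
  (has_sumZ (mon s b) (dP b)).
apply: eq_has_sum (h _) => [k|j k].
  by case: eqP => // kb; rewrite /u /v kb; ring.
by case: k => k1 k2; rewrite xpair_eqE /= [b == _]eq_sym [j == _]eq_sym.
Qed.

Lemma real_series_analytic c B r f (eps : R) : real_series c B r f -> eps <= r ->
  analytic_on (ball (0 : 'rV[R]_n) eps) f.
Proof.
move=> [r0 cb fE] er a /ball_rV[eps0 ha].
pose na := \big[Num.max/0]_(i < n) `|a 0 i|.
have nar : na < r.
  apply: lt_le_trans er; apply: bigmax_lt => // i _.
  by have := ha i; rewrite mxE sub0r normrN.
have ale i : `|a 0 i| <= na by apply: (le_bigmax _ (fun i => `|a 0 i|)).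
pose rho := r - na; have rho0 : 0 < rho by rewrite subr_gt0.
have [|d hd] := recenter (a := a 0) cb rho0 r0.
  by move=> i; rewrite /rho; have := ale i; lra.
exists (fun p => ((d p)%:C)%C); exists rho => // t /ball_rV[_ ht].
have st i : `|t 0 i - a 0 i| < rho by rewrite distrC.
have [|g hg ->] := fE t.
  move=> i; have -> : t 0 i = a 0 i + (t 0 i - a 0 i) by ring.
  apply: le_lt_trans (ler_normD _ _) _; have := st i; have := ale i; rewrite /rho; lra.
have h : has_sum (fun p => d p * mon (fun i => t 0 i - a 0 i) p) g.
  apply: hd => [i|]; first by apply: ltW; apply: st.
  apply: eq_has_sum hg => p; congr (_ * _); apply: eq_bigr => i _.
  by congr (_ ^+ _); ring.
have := has_sum_partial h.
suff -> : (fun i : I => ((d i * mon (fun i0 : 'I_n => t 0 i0 - a 0 i0) i)%:C)%C : Rcomplex R) =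
  (fun al : I => (\prod_(i < n) (t 0 i - a 0 i) ^+ al i) *: (((d al)%:C)%C : Rcomplex R)) by [].
apply: funext => al; rewrite /mon mulrC.
by apply/eqP; rewrite eq_complex /= mulr0 !eqxx.
Qed.

End PowerSeries.

Section ScalarEstimate.
Variable R : realType.

(** A term of order j >= 2 satisfies |h|^j <= (h/d)^2 d^j, so the remainder at [h] is controlled by
    the one at [d]. The factor does not depend on [k], which lets the estimate be summed over a
    power series. *)
Lemma taylor_monomial (x h d : R) k : `|h| <= d -> 0 < d ->
  `|(x + h) ^+ k - x ^+ k - k%:R * h * x ^+ k.-1| <=
  (h / d) ^+ 2 * ((`|x| + d) ^+ k - `|x| ^+ k - k%:R * d * `|x| ^+ k.-1).
Proof.
move=> hd d0; elim: k => [|k IH].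
  by rewrite !expr0 !subrr !mul0r !subr0 normr0 mulr0.
set E := _ - _ - _ in IH; set F := _ - _ - _ in IH.
have -> : (x + h) ^+ k.+1 - x ^+ k.+1 - k.+1%:R * h * x ^+ k.+1.-1
   = (x + h) * E + k%:R * h ^+ 2 * x ^+ k.-1.
  rewrite /E /= -natr1; case: k {IH E F} => [|k] /=; first by rewrite !expr1 !expr0; ring.
  by rewrite !exprS; ring.
have -> : (`|x| + d) ^+ k.+1 - `|x| ^+ k.+1 - k.+1%:R * d * `|x| ^+ k.+1.-1
   = (`|x| + d) * F + k%:R * d ^+ 2 * `|x| ^+ k.-1.
  rewrite /F /= -natr1; case: k {IH E F} => [|k] /=; first by rewrite !expr1 !expr0; ring.
  by rewrite !exprS; ring.
apply: le_trans (ler_normD _ _) _; rewrite [leRHS]mulrDr; apply: lerD.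
  rewrite normrM mulrCA; apply: ler_pM => //.
  by apply: le_trans (ler_normD _ _) _; rewrite lerD2l.
rewrite 2!normrM !normrX normr_nat real_normK ?num_real //.
rewrite le_eqVlt; apply/orP; left; apply/eqP.
by field; rewrite gt_eqF.
Qed.

Lemma monomial_remainder_ge0 (x d : R) k : 0 <= x -> 0 < d ->
  0 <= (x + d) ^+ k - x ^+ k - k%:R * d * x ^+ k.-1.
Proof.
move=> x0 d0; have hd : `|d| <= d by rewrite gtr0_norm.
have := taylor_monomial x k hd d0.
rewrite divff ?gt_eqF // expr1n mul1r (ger0_norm x0) => h.
exact: le_trans (normr_ge0 _) h.
Qed.

End ScalarEstimate.

(** * Termwise differentiation and derivatives at the origin *)

Section Derivative.
Variables (R : realType) (n : nat).
Notation I := {ffun 'I_n -> nat}.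
Implicit Types (c : I -> R) (p : I) (t : 'rV[R]_n).

Definition dcoef i c p : R := (p i).+1%:R * c (up_index p i).

Let rest (s : 'I_n -> R) p i := \prod_(j | j != i) s j ^+ p j.

Lemma mon_split s p i : mon s p = s i ^+ p i * rest s p i.
Proof. by rewrite /mon (bigD1 i). Qed.

Lemma mon_pred_split s p i : mon s (pred_index p i) = s i ^+ (p i).-1 * rest s p i.
Proof.
rewrite (mon_split _ _ i) ffunE eqxx subn1; congr (_ * _).
by apply: eq_bigr => j ji; rewrite ffunE (negPf ji) subn0.
Qed.

Lemma rest_ge0 s p i : (forall j, 0 <= s j) -> 0 <= rest s p i.
Proof. by move=> h; apply: prodr_ge0 => j _; apply: exprn_ge0. Qed.

Lemma rest_le s s' p i : (forall j, `|s j| <= s' j) -> `|rest s p i| <= rest s' p i.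
Proof.
move=> h; rewrite /rest normr_prod; apply: ler_prod => j _; rewrite normr_ge0 normrX /=.
by apply: lerXn2r; rewrite ?nnegrE // (le_trans (normr_ge0 _) (h j)).
Qed.

(** Halving the radius pays for the factor created by differentiation: k (r/2)^k <= r^k, read off
    the nonnegative remainder at [x = d = r / 2]. *)
Lemma dcoef_bounded c B r i : 0 < r ->
  abs_bounded (fun p => c p * mon (fun=> r) p) B ->
  abs_bounded (fun p => dcoef i c p * mon (fun=> r / 2) p) (B / (r / 2)).
Proof.
move=> r0 cb; have r2 : 0 < r / 2 by lra.
have := abs_boundedZ (r / 2)^-1 (abs_bounded_inj (can_inj (@up_indexK _ i)) cb).
rewrite ger0_norm ?invr_ge0 ?ltW // [_ * B]mulrC; apply: abs_bounded_le => p /=.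
have m0 (a : R) q : 0 < a -> 0 <= mon (fun=> a) q by move=> a0; apply: mon_pos => _; apply: ltW.
rewrite /dcoef !normrM normfV (ger0_norm (m0 _ (r / 2) p r2)) (ger0_norm (m0 _ r (up_index p i) r0)) // normr_nat (gtr0_norm r2).
rewrite ler_pdivlMl //.
have -> : r / 2 * ((p i).+1%:R * `|c (up_index p i)| * mon (fun=> r / 2) p) =
  `|c (up_index p i)| * ((p i).+1%:R * (r / 2) * mon (fun=> r / 2) p) by ring.
apply: ler_wpM2l => //; rewrite !(mon_split _ _ i).
have -> : rest (fun=> r) (up_index p i) i = rest (fun=> r) p i.
  by apply: eq_bigr => j ji; rewrite ffunE (negPf ji) addn0.
rewrite [leLHS]mulrA; apply: ler_pM.
- by rewrite !mulr_ge0 // ?exprn_ge0 ?ltW.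
- by apply: rest_ge0 => _; apply: ltW.
- rewrite ffunE eqxx addn1.
  have := @monomial_remainder_ge0 R (r / 2) (r / 2) (p i).+1 (ltW r2) r2.
  have -> : r / 2 + r / 2 = r by field.
  have : 0 <= (r / 2) ^+ (p i).+1 by apply: exprn_ge0; exact: ltW.
  by rewrite /=; lra.
- by rewrite -[leLHS]ger0_norm; [apply: rest_le => j; rewrite gtr0_norm //; lra|apply: rest_ge0 => _; apply: ltW].
Qed.

Lemma real_series_derivative c B r f i : real_series c B r f ->
  real_series (dcoef i c) (B / (r / 2)) (r / 2) (pderiv i f).
Proof.
move=> [r0 cb fE]; have r2 : 0 < r / 2 by lra.
split => //; first exact: dcoef_bounded.
(* As the coordinates of [t] are below [r / 2], an increment up to [r / 4] keeps the point, and
   [|t 0 i| + d] as well, within the radius [r]. *)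
move=> t tr; pose d := r / 4; have d0 : 0 < d by rewrite /d; lra.
have db := dcoef_bounded i r0 cb.
have tb : abs_bounded (fun p => dcoef i c p * mon (t 0) p) (B / (r / 2)).
  apply: abs_bounded_le db => p; rewrite !normrM; apply: ler_wpM2l => //.
  rewrite !mon_norm; apply: mon_le => j; rewrite normr_ge0 /= [leRHS]gtr0_norm //.
  exact: ltW.
have [D hD] := has_sum_exists tb; exists D => //.
have hD' : has_sum (fun p => c p * ((p i)%:R * mon (t 0) (pred_index p i))) D.
  have := has_sum_embed (f := fun p => up_index p i) (g := fun p => pred_index p i)
    (P := fun p : I => (0 < p i)%N) hD.
  move=> h; apply: eq_has_sum (h _) => [p|p k]; last exact: up_indexE.
  case: posnP => [->|pi]; first by rewrite mul0r mulr0.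
  rewrite /dcoef ffunE eqxx subn1 prednK //.
  have -> : up_index (pred_index p i) i = p.
    by apply/eqP; rewrite up_indexE pi eqxx.
  by ring.
have [G hG ft] := fE t (fun j => lt_trans (tr j) (ltac:(lra) : r / 2 < r)).
have est h : `|h| <= d -> exists2 G', f (t + h *: delta_mx 0 i) = (G'%:C)%C &
    `|G' - G - h * D| <= (h / d) ^+ 2 * B.
  move=> hd; pose t' := t + h *: delta_mx 0 i.
  have t'E j : t' 0 j = t 0 j + (if j == i then h else 0).
    by rewrite !mxE eqxx /=; case: eqP => _; rewrite ?mulr1 ?mulr0.
  have [|G' hG' ft'] := fE t'.
    move=> j; rewrite t'E; apply: le_lt_trans (ler_normD _ _) _.
    have := tr j; case: eqP => _; rewrite ?normr0; move: hd; rewrite /d; lra.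
  exists G' => //.
  have hs := has_sumD (has_sumD hG' (has_sumZ (-1) hG)) (has_sumZ (- h) hD').
  have -> : G' - G - h * D = G' + -1 * G + - h * D by ring.
  apply: has_sum_le hs => s us.
  apply: le_trans (_ : (h / d) ^+ 2 * \sum_(p <- s) `|c p * mon (fun=> r) p| <= _); last first.
    by apply: ler_wpM2l; [apply: sqr_ge0|apply: cb].
  rewrite mulr_sumr; apply: ler_sum => p _.
  have -> : c p * mon (t' 0) p + -1 * (c p * mon (t 0) p) +
      - h * (c p * ((p i)%:R * mon (t 0) (pred_index p i)))
    = c p * (((t 0 i + h) ^+ p i - t 0 i ^+ p i - (p i)%:R * h * t 0 i ^+ (p i).-1) * rest (t 0) p i).
    rewrite mon_pred_split !(mon_split _ _ i) t'E eqxx.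
    have -> : rest (t' 0) p i = rest (t 0) p i.
      by apply: eq_bigr => j ji; rewrite t'E (negPf ji) addr0.
    by ring.
  rewrite !normrM [leRHS]mulrCA; apply: ler_wpM2l => //.
  have mp : 0 <= mon (fun=> r) p by apply: mon_pos => _; apply: ltW.
  rewrite (ger0_norm mp).
  rewrite (mon_split _ _ i) [leRHS]mulrA; apply: ler_pM => //; last first.
    by apply: rest_le => j; have := tr j; lra.
  apply: le_trans (taylor_monomial _ _ hd d0) _; apply: ler_wpM2l; first exact: sqr_ge0.
  apply: le_trans (_ : (`|t 0 i| + d) ^+ p i <= _).
    rewrite -subr_ge0; set A := _ ^+ _.
    have -> : A - (A - `|t 0 i| ^+ p i - (p i)%:R * d * `|t 0 i| ^+ (p i).-1)
      = `|t 0 i| ^+ p i + (p i)%:R * d * `|t 0 i| ^+ (p i).-1 by ring.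
    by rewrite addr_ge0 // ?exprn_ge0 // !mulr_ge0 // ?exprn_ge0 // ltW.
  apply: lerXn2r; rewrite ?nnegrE; first by rewrite addr_ge0 // ltW.
    exact: ltW.
  by have := tr i; rewrite /d; lra.
have B0 : 0 <= B by have := cb [::] isT; rewrite big_nil.
rewrite /pderiv /derive; apply: cvg_lim => //.
apply/cvgrPdist_le => e e0.
pose C := B / d ^+ 2 + 1; have C0 : 0 < C by rewrite /C ltr_wpDl // divr_ge0 // exprn_ge0 // ltW.
have eC : 0 < e / C by rewrite divr_gt0.
near=> h.
have h0 : h != 0 by near: h; exact: nbhs_dnbhs_neq.
have hd : `|h| <= d by apply: ltW; near: h; apply: dnbhs0_lt.
have he : `|h| <= e / C by apply: ltW; near: h; apply: dnbhs0_lt.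
have [G' f' hb] := est h hd.
rewrite /= [_ *: _ + t]addrC f' ft.
have -> : ((D%:C)%C : Rcomplex R) - h^-1 *: (((G'%:C)%C : Rcomplex R) - (G%:C)%C)
  = ((D - h^-1 * (G' - G))%:C)%C.
  by apply/eqP; rewrite eq_complex /=; apply/andP; split; apply/eqP; ring.
rewrite Rcomplex_norm_real.
have -> : D - h^-1 * (G' - G) = - (h^-1 * (G' - G - h * D)) by field.
rewrite normrN normrM normfV ler_pdivrMl ?normr_gt0 //; apply: le_trans hb _.
have -> : (h / d) ^+ 2 * B = `|h| * (`|h| * (B / d ^+ 2)).
  rewrite expr_div_n mulrA -expr2 real_normK ?num_real //; by field; rewrite gt_eqF.
apply: ler_wpM2l => //; apply: le_trans (_ : e / C * (B / d ^+ 2) <= _).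
  by apply: ler_wpM2r => //; apply: divr_ge0 => //; apply: exprn_ge0; apply: ltW.
rewrite -mulrAC ler_pdivrMr // ler_wpM2l ?(ltW e0) //.
by rewrite /C lerDl.
Unshelve. all: by end_near.
Qed.

Lemma iter_real_series c B r f i k : real_series c B r f ->
  exists B' r', real_series (iter k (dcoef i) c) B' r' (iter k (pderiv i) f).
Proof.
move=> h; elim: k => [|k [B' [r' IH]]]; first by exists B, r.
by exists (B' / (r' / 2)), (r' / 2); apply: real_series_derivative.
Qed.

Lemma foldr_real_series c B r f (k : 'I_n -> nat) (l : seq 'I_n) : real_series c B r f ->
  exists B' r', real_series (foldr (fun i g => iter (k i) (dcoef i) g) c l) B' r'
    (foldr (fun i g => iter (k i) (pderiv i) g) f l).
Proof.
move=> h; elim: l => [|i l [B' [r' IH]]]; first by exists B, r.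
exact: iter_real_series IH.
Qed.

(** Factorials on both sides replace a falling factorial and avoid division. *)
Lemma iter_dcoef c i k p : iter k (dcoef i) c p * ((p i)`!)%:R =
  ((p i + k)`!)%:R * c [ffun j => (p j + (if j == i then k else 0))%N].
Proof.
elim: k p => [|k IH] p.
  rewrite addn0 mulrC /=; congr (_ * c _); apply/ffunP => j.
  by rewrite ffunE; case: ifP; rewrite addn0.
have := IH (up_index p i); rewrite ffunE eqxx addn1 => h.
rewrite iterS {1}/dcoef mulrAC -natrM mulrC -factS h.
rewrite addSnnS; congr (_ * c _); apply/ffunP => j; rewrite !ffunE.
by case: ifP => _; rewrite ?addn0 // addn1 addSnnS.
Qed.

Lemma foldr_dcoef c (k : 'I_n -> nat) (l : seq 'I_n) p : uniq l ->
  foldr (fun i g => iter (k i) (dcoef i) g) c l p * \prod_(i <- l) ((p i)`!)%:R =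
  \prod_(i <- l) ((p i + k i)`!)%:R *
    c [ffun j => (p j + (if j \in l then k j else 0))%N].
Proof.
elim: l p => [|i l IH] p /=.
  rewrite !big_nil mulr1 mul1r => _; congr c; apply/ffunP => j.
  by rewrite ffunE addn0.
move=> /andP[il ul]; rewrite !big_cons mulrA iter_dcoef.
set p' := finfun _; have := IH p' ul.
have e (g : 'I_n -> nat -> nat) : \prod_(j <- l) ((g j (p' j))`!)%:R = \prod_(j <- l) ((g j (p j))`!)%:R :> R.
  rewrite big_seq [RHS]big_seq; apply: eq_bigr => j jl.
  by rewrite ffunE ifN ?addn0 //; apply: contraNneq il => <-.
rewrite (e (fun _ x => x)) (e (fun j x => x + k j)%N) => h.
rewrite -mulrA h mulrA; congr (_ * c _); apply/ffunP => j; rewrite !ffunE in_cons.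
case: eqP => [->|_] /=; last by rewrite addn0.
by rewrite (negPf il) addn0.
Qed.

Lemma real_series0 c B r f : real_series c B r f ->
  f 0 = ((c [ffun => 0%N])%:C)%C.
Proof.
move=> [r0 cb fE]; have [|g hg ->] := fE 0; first by move=> i; rewrite mxE normr0.
congr (_%:C)%C; apply: has_sum_unique hg _.
have -> : c [ffun => 0%N] = \sum_(p <- [:: [ffun => 0%N] : I]) c p * mon ((0 : 'rV[R]_n) 0) p.
  by rewrite big_seq1 /mon big1 ?mulr1 // => i _; rewrite ffunE.
apply: has_sum_fin => // p; rewrite inE => pn.
have [i pi] := index_neq0 pn.
by rewrite /mon (bigD1 i) //= mxE expr0n (negPf pi) mul0r mulr0.
Qed.

Lemma mixed_pderiv_series c B r f (k : 'I_n -> nat) : real_series c B r f ->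
  mixed_pderiv k f 0 = ((c (finfun k) * \prod_i ((k i)`!)%:R)%:C)%C.
Proof.
move=> h; have [B' [r' h']] := foldr_real_series k (enum 'I_n) h.
rewrite /mixed_pderiv (real_series0 h'); congr (_%:C)%C.
have := foldr_dcoef c k [ffun => 0%N] (enum_uniq 'I_n).
rewrite [X in _ * X]big1 ?mulr1 => [->|i _]; last by rewrite ffunE.
rewrite mulrC big_enum; congr (c _ * _).
  by apply/ffunP => j; rewrite !ffunE mem_enum.
by apply: eq_bigr => i _; rewrite ffunE.
Qed.

End Derivative.

(** * Conclusion *)

Section Regroup.
Variables (m n : nat) (i0 : 'I_m) (q : 'I_n -> word m).
Notation X := ('I_n * bool)%type.
Notation K := {ffun 'I_n -> nat}.
Notation I := {ffun X -> nat}.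

Definition merge_index (p : I) : K := [ffun j => (p (j, true) + p (j, false))%N].
Definition split_index (k k' : K) : I :=
  [ffun x => if x.2 then k' x.1 else (k x.1 - k' x.1)%N].
Definition split_indices k : seq I := [seq split_index k k' | k' <- below k].

Lemma split_indices_uniq k : uniq (split_indices k).
Proof.
rewrite map_inj_uniq ?below_uniq // => k' k'' /ffunP h; apply/ffunP => j.
by have := h (j, true); rewrite !ffunE.
Qed.

Lemma mem_split_indices k p : (p \in split_indices k) = (merge_index p == k).
Proof.
apply/mapP/eqP => [[k' + ->]|<-].
  rewrite mem_below => /forallP h; apply/ffunP => j; rewrite !ffunE /=.
  by rewrite subnKC.
exists [ffun j => p (j, true)].
  by rewrite mem_below; apply/forallP => j; rewrite !ffunE leq_addr.
by apply/ffunP => -[j b]; rewrite !ffunE /=; case: b; rewrite // addKn.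
Qed.

Lemma prod_pairs (S : comNzRingType) (f : X -> S) :
  \prod_x f x = \prod_j (f (j, true) * f (j, false)).
Proof.
transitivity (\prod_x f (x.1, x.2)); first by apply: eq_bigr => -[].
rewrite -(pair_bigA _ (fun j b => f (j, b))) /=.
by apply: eq_bigr => j _; rewrite big_bool.
Qed.

(** The list of stars in [Mstar] alternates blocks of [q i] and of its reversal; only its content
    matters, and this is [split_index]. *)
Lemma Mstar_nmaps (P : word m) (k : 'I_n -> nat) :
  Mstar P q k = (\sum_(k' <- below (finfun k))
    (\prod_i 'C(k i, k' i)) * nmaps (pot_word q) P (split_index (finfun k) k'))%N.
Proof.
pose v (p : {dffun forall i : 'I_n, 'I_(k i).+1}) : K := [ffun i => p i : nat].
have -> : Mstar P q k = (\sum_(k' <- [seq v p | p <- index_enum _])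
    (\prod_i 'C(k i, k' i)) * nmaps (pot_word q) P (split_index (finfun k) k'))%N.
  rewrite big_map; apply: eq_bigr => p _; congr (_ * _)%N.
    by apply: eq_bigr => i _; rewrite ffunE.
  set p' := split_index _ _.
  pose J := flatten [seq nseq (p' (i, true)) (i, true) ++ nseq (p' (i, false)) (i, false)
                    | i <- enum 'I_n].
  have JE : content J = p'.
    apply/ffunP => -[j b]; rewrite ffunE /J count_flatten -map_comp sumnE big_map big_enum /=.
    rewrite (bigD1 j) //= big1 => [|i ij]; rewrite count_cat !count_nseq /= !xpair_eqE.
      by rewrite eqxx addn0; case: b; rewrite /= ?mul1n ?mul0n ?addn0.
    by rewrite (negPf ij).
  rewrite -JE -(star_maps_content i0) /star_maps /M0; congr nb_planar_maps => /=.
  have fm (w : word m) : FMonom w = w by case: w.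
  rewrite fm; congr (_ :: _); rewrite /J.
  elim: (enum 'I_n) => [//|i l IH] /=.
  rewrite !map_cat !map_nseq {}IH !ffunE /= fm catA; congr (_ ++ _).
apply: perm_big; apply: uniq_perm; rewrite ?below_uniq //.
  rewrite map_inj_uniq ?index_enum_uniq // => p p' /ffunP h; apply/ffunP => i.
  by apply: val_inj; have := h i; rewrite !ffunE.
move=> k'; rewrite mem_below; apply/mapP/forallP => [[p _ ->] i|h].
  by rewrite !ffunE -ltnS.
exists [ffun i => inord (k' i)]; first by rewrite mem_index_enum.
by apply/ffunP => i; have := h i; rewrite !ffunE => ki; rewrite inordK.
Qed.

Variable R : realType.

(** The coefficient of the monomial of index [k] in [t]: a monomial and its adjoint share one
    variable, and each star brings a sign. *)
Definition regroup (P : word m) (k : K) : R :=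
  (-1) ^+ deg k * \sum_(p <- split_indices k) coef R (pot_word q) P p.

Lemma mon_const r (p : I) : mon (fun=> r : R) p = mon (fun=> r) (merge_index p).
Proof. by rewrite /mon prod_pairs; apply: eq_bigr => j _; rewrite ffunE exprD. Qed.

Lemma mon_pot_weight (t : 'rV[R]_n) p :
  mon (pot_weight t) p = (-1) ^+ deg (merge_index p) * mon (t 0) (merge_index p).
Proof.
rewrite /mon prod_pairs /deg -prodrXr -big_split /=; apply: eq_bigr => j _.
by rewrite ffunE -exprD /pot_weight /= -[in LHS]mulN1r exprMn.
Qed.

(** The factorial of [k] divided by those of the two parts of a splitting is the product of
    binomials that weighs this splitting in [Mstar]. *)
Lemma Mstar_regroup (P : word m) (k : 'I_n -> nat) :
  (-1) ^+ (\sum_i k i)%N * (regroup P (finfun k) * \prod_i ((k i)`!)%:R)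
  = (Mstar P q k)%:R.
Proof.
have -> : (\sum_i k i)%N = deg (finfun k) by apply: eq_bigr => i _; rewrite ffunE.
rewrite /regroup.
rewrite !mulrA -expr2 sqrr_sign mul1r Mstar_nmaps natr_sum big_map mulr_suml.
rewrite big_seq [RHS]big_seq; apply: eq_bigr => k' k'b.
rewrite natrM (eq_bigr (fun i => 'C(finfun k i, k' i))) => [|i _]; last by rewrite ffunE.
rewrite ifact_bin // /coef.
have -> : \prod_i ((k i)`!)%:R = ifact R (finfun k).
  by apply: eq_bigr => i _; rewrite ffunE.
have -> : ifact R (split_index (finfun k) k') = ifact R k' * ifact R (sub_index (finfun k) k').
  by rewrite /ifact prod_pairs -big_split /=; apply: eq_bigr => i _; rewrite !ffunE.
by rewrite mulrC mulrA mulrAC.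
Qed.

End Regroup.

Section Solutions.
Variables (R : realType) (m n : nat) (i0 : 'I_m) (q : 'I_n -> word m) (e r rho : R).
Hypotheses (e0 : 0 < e) (e1 : e <= 1) (r0 : 0 < r) (rho2 : 2 + e <= rho).
Notation Q := (pot_word q).
Hypothesis rC : r * (\sum_x (size (Q x))%:R * (2 * e + 4 / e) ^+ (size (Q x)).-1) <= e.
Hypothesis rC' : r * (\sum_x (size (Q x))%:R * (2 * rho) ^+ (size (Q x)).-1) <= 1.
Implicit Types (t : 'rV[R]_n).

Let r_ge0 : 0 <= r. Proof. exact: ltW. Qed.

Lemma pot_weight_le t : (forall j, `|t 0 j| < r) -> forall x, `|pot_weight t x| <= r.
Proof. by move=> tr x; rewrite normrN ltW. Qed.

Definition sol t (w : seq 'I_m) : R[i] := ((tau Q (pot_weight t) w)%:C)%C.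

Lemma sol_word_eq t : (forall j, `|t 0 j| < r) -> word_eq Q (pot_weight t) (sol t).
Proof.
move=> /pot_weight_le tr; split=> [|i w].
  by rewrite /sol (tau_nil i0 e0 e1 r_ge0 rC tr).
rewrite /sol (tau_cons i0 e0 e1 r_ge0 rC tr) rmorphD /=; congr (_ + _).
  by rewrite rmorph_sum; apply: eq_bigr => k _; rewrite rmorphM.
rewrite rmorph_sum; apply: eq_bigr => x _.
by rewrite rmorph_sum; apply: eq_bigr => l _; rewrite rmorphM.
Qed.

Lemma sol_modulus t w : (forall j, `|t 0 j| < r) -> modulus (sol t w) <= rho ^+ size w.
Proof.
move=> /pot_weight_le tr; rewrite modulus_real.
apply: le_trans (tau_bound i0 e0 e1 r_ge0 rC tr w) _.
apply: le_trans (motzkin_upper e0 e1 _) _.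
by have := e0; have := rho2; move=> h h'; apply: lerXn2r; rewrite ?nnegrE //; lra.
Qed.

Lemma sol_rev t w : (forall j, `|t 0 j| < r) -> sol t (rev w) = ((sol t w)^*)%R.
Proof.
move=> /pot_weight_le tr.
have := @tau_rev R _ m i0 Q e r e0 e1 r_ge0 rC _ tr (fun x => (x.1, ~~ x.2)) w.
move=> h; rewrite /sol h.
- by rewrite /Num.conj /= /conjc oppr0.
- by move=> [j b] /=; rewrite negbK.
- by move=> [j []] //=; rewrite /pot_word /= revK.
- by [].
Qed.

Lemma sol_bounded_SD t : (forall j, `|t 0 j| < r) ->
  bounded_SD_solution (potential q t) rho (word_form (sol t)).
Proof.
move=> tr; split.
- by apply: word_form_hermitian => w; apply: sol_rev.
- apply/schwinger_dysonP; rewrite (_ : (fun w => _) = sol t); first exact: sol_word_eq.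
  by apply/funext => w; exact: word_form_mon.
- move=> [w]; rewrite word_form_mon modulus_le; exact: sol_modulus.
Qed.

Lemma bounded_SD_sol t (tau : {scalar ncpoly R m}) : (forall j, `|t 0 j| < r) ->
  bounded_SD_solution (potential q t) rho tau ->
  forall w : word m, tau (ncmon R w) = sol t w.
Proof.
move=> tr [_ /schwinger_dysonP eqn bnd] [w].
have rho_gt2 : 2 < rho by apply: lt_le_trans rho2; rewrite ltrDl.
apply: (word_eq_unique rho_gt2 r_ge0 rC' (pot_weight_le tr) eqn (sol_word_eq tr)) => v.
  by rewrite -modulus_le; exact: bnd.
exact: sol_modulus.
Qed.

(** Grouping the indices keeps the absolute bound, as the coefficients are nonnegative and the sign
    depends on the group only. *)
Lemma sol_real_series (P : word m) (f : 'rV[R]_n -> Rcomplex R) :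
  (forall t, (forall j, `|t 0 j| < r) -> f t = sol t P) ->
  real_series (regroup q R P) (motzkin e (size P)) r f.
Proof.
move=> fE; split => // [s us|t tr].
  have -> : \sum_(k <- s) `|regroup q R P k * mon (fun=> r) k| =
      \sum_(p <- [seq p | k <- s, p <- split_indices k]) coef R Q P p * mon (fun=> r) p.
    rewrite big_allpairs_dep; apply: eq_bigr => k _.
    rewrite normrM normrM normrX normrN1 expr1n mul1r ger0_norm ?sumr_ge0 // => [|p _]; last exact: coef_ge0.
    rewrite ger0_norm ?mon_pos // mulr_suml big_seq [RHS]big_seq; apply: eq_bigr => p.
    by rewrite mem_split_indices => /eqP <-; rewrite -mon_const.
  apply: coef_sum_bound => //; apply: allpairs_uniq_dep => //.
    by move=> k _; exact: split_indices_uniq.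
  move=> _ _ /allpairsPdep[k [p [_ pk ->]]] /allpairsPdep[k' [p' [_ pk' ->]]] /= e'.
  move: pk pk'; rewrite -{}e' !mem_split_indices => /eqP -> /eqP.
  by move=> ->.
exists (tau Q (pot_weight t) P); last exact: fE.
have := has_sum_finite_fiber (pi := @merge_index n) (l := @split_indices n)
  (tauP i0 e0 e1 r_ge0 rC (pot_weight_le tr) P) (@split_indices_uniq n) (@mem_split_indices n).
apply: eq_has_sum => k; rewrite /regroup -mulrA mulr_suml mulr_sumr big_seq [RHS]big_seq.
apply: eq_bigr => p; rewrite mem_split_indices => /eqP <-.
by rewrite mon_pot_weight mulrCA.
Qed.

End Solutions.

Theorem theorem1p1 (R : realType) (m n : nat) (m_gt0 : (0 < m)%N)
    (n_gt0 : (0 < n)%N) (q : 'I_n -> word m) (rho : R) (rho_gt2 : 2 < rho) :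
  exists2 eps : R, 0 < eps &
  let U := ball (0 : 'rV[R]_n) eps in
  let is_tau (t : 'rV[R]_n) (tau : {scalar ncpoly R m}) :=
    bounded_SD_solution (potential q t) rho tau in
  (forall t, U t ->
     exists tau : {scalar ncpoly R m},
       is_tau t tau /\
       forall tau' : {scalar ncpoly R m}, is_tau t tau' -> tau' =1 tau) /\
  (forall tau_ : 'rV[R]_n -> {scalar ncpoly R m},
     (forall t, U t -> is_tau t (tau_ t)) ->
     forall P : word m,
       let f : 'rV[R]_n -> Rcomplex R := fun t => tau_ t (ncmon R P) in
       analytic_on U f /\
       forall k : 'I_n -> nat,
         (-1) ^+ (\sum_(i < n) k i)%N * mixed_pderiv k f 0
         = (Mstar P q k)%:R).
Proof.
pose i0 := Ordinal m_gt0.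
(* The Motzkin estimates ask for [e <= 1], and the bound on [tau] for [2 + e <= rho]. *)
pose e := Num.min 1 (rho - 2).
have e0 : 0 < e by rewrite lt_min ltr01 subr_gt0.
have e1 : e <= 1 by rewrite ge_min lexx.
have rho2 : 2 + e <= rho by rewrite -lerBrDl ge_min lexx orbT.
have [r r0 [rC rC']] : exists2 r : R, 0 < r &
    r * (\sum_x (size (pot_word q x))%:R * (2 * e + 4 / e) ^+ (size (pot_word q x)).-1) <= e /\
    r * (\sum_x (size (pot_word q x))%:R * (2 * rho) ^+ (size (pot_word q x)).-1) <= 1.
  set C := \sum_x _; set C' := \sum_x _.
  have C0 : 0 <= C.
    by apply: sumr_ge0 => x _; rewrite mulr_ge0 // exprn_ge0 // addr_ge0 // mulr_ge0 ?invr_ge0 ?(ltW e0).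
  have C0' : 0 <= C'.
    by apply: sumr_ge0 => x _; rewrite mulr_ge0 // exprn_ge0 // mulr_ge0 // ltW // (lt_trans _ rho_gt2).
  have D0 : 0 < C + C' + 1 by lra.
  (* Since [e <= 1], this one radius meets the condition for existence and the one for
     contraction. *)
  exists (e / (C + C' + 1)); first exact: divr_gt0.
  rewrite ![_ / _ * _]mulrAC !ler_pdivrMr //; split.
    by apply: ler_wpM2l; lra.
  by nra.
have Ur t : ball (0 : 'rV[R]_n) r t -> forall j, `|t 0 j| < r.
  by move=> /ball_rV[_ h] j; have := h j; rewrite mxE sub0r normrN.
exists r => //= ; split => [t /Ur tr|tau_ tau_SD P].
  exists (word_form (sol q t)); split.
    exact: (sol_bounded_SD i0 e0 e1 r0 rho2 rC tr).
  move=> tau' /(bounded_SD_sol i0 e0 e1 r0 rho2 rC rC' tr) h.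
  by apply: scalar_ext => w; exact: etrans (h _) (esym (word_form_mon _ _)).
(* By uniqueness, any family of solutions agrees with the series on the ball; outside it [tau_] is
   arbitrary. *)
have tau_sol (t : 'rV[R]_n) : (forall j, `|t 0 j| < r) -> tau_ t (ncmon R P) = sol q t P.
  move=> tr; apply: (bounded_SD_sol i0 e0 e1 r0 rho2 rC rC' tr); apply: tau_SD.
  by apply/ball_rV; split => // j; rewrite mxE sub0r normrN.
have fs := sol_real_series i0 e0 e1 r0 rC tau_sol.
split => [|k]; first exact: real_series_analytic fs (lexx r).
rewrite (mixed_pderiv_series k fs) -(rmorph_nat (real_complex R)) -(Mstar_regroup i0).
rewrite [RHS]rmorphM; congr (_ * _); exact: esym (rmorph_sign _ _).
Qed.
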